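(* Let $f \in L^1(\mathbb{T})$ be real valued, and suppose that there exist $\kappa > 1$ and $C_\kappa > 0$ such that $|\hat{f}(j)| \le C_\kappa |j|^{-\kappa}$ for all $0 \neq j \in \mathbb{Z}$. For each $n \in \mathbb{N}$ let $M_n$ be a Haar distributed random element of the unitary group $\mathrm{U}_n$, with eigenvalues $\lambda_{n1}, \ldots, \lambda_{nn} \in \mathbb{T}$ (counted with multiplicities), and let $L_n = \frac{1}{n}\sum_{j=1}^n \delta_{\lambda_{nj}}$ be its empirical eigenvalue measure, so that $L_n(f) = \frac1n \sum_{j=1}^n f(\lambda_{nj})$. Then, as $n \to \infty$, the fluctuation $n(L_n(f) - \mathbb{E} L_n(f))$ converges in distribution to a centered Gaussian random variable with variance $$ \sigma^2 := \sum_{j=-\infty}^{\infty} |\hat{f}(j)|^2 |j| = 2 \sum_{j=1}^{\infty} j\,|\hat{f}(j)|^2 < \infty. $$ Moreover, if $\mathcal{L}_n$ denotes the law of $n(L_n(f) - \mathbb{E} L_n(f))$, then there exists $C = C(f,\kappa) > 0$ such that for every $n \in \mathbb{N}$ $$ d_{\mathcal{W}}(\mathcal{L}_n, \mathrm{N}(0,\sigma^2)) \le C\, n^{-\frac{\kappa-1}{\kappa+5/2}}. $$ In particular, if $f \in C^\infty(\mathbb{T})$, then for every $\epsilon > 0$ one has $d_{\mathcal{W}}(\mathcal{L}_n, \mathrm{N}(0,\sigma^2)) = O\left(\frac{1}{n^{1-\epsilon}}\right)$ as $n \to \infty$.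
   Context: $\mathbb{T}$ is the unit circle in $\mathbb{C}$; a function $f$ on $\mathbb{T}$ is identified with a $2\pi$-periodic function on $\mathbb{R}$ by writing $f(x)$ for $f(e^{ix})$. The Fourier coefficients of $f \in L^1(\mathbb{T})$ are $\hat{f}(j) = \frac{1}{2\pi}\int_0^{2\pi} f(x) e^{-ijx}\,dx$ for $j \in \mathbb{Z}$. Under the stated decay condition with $\kappa > 1$, the Fourier series of $f$ converges absolutely and uniformly, and $f$ is identified with its sum (its continuous representative), so the values $f(\lambda_{nj})$ make sense. $\mathrm{U}_n$ is the group of unitary $n\times n$ matrices, and Haar distributed means distributed according to the Haar probability measure on $\mathrm{U}_n$. $\mathrm{N}(0,\sigma^2)$ denotes the centered normal distribution on $\mathbb{R}$ with variance $\sigma^2$ (understood as the point mass at $0$ if $\sigma^2 = 0$). The Wasserstein distance between probability measures $\mu,\nu$ on $\mathbb{R}$ is $$d_{\mathcal{W}}(\mu,\nu) = \sup\left\{\left|\int h\,d\mu - \int h\,d\nu\right| : h:\mathbb{R}\to\mathbb{R},\ \|h\|_{\mathrm{Lip}} \le 1\right\}, \qquad \|h\|_{\mathrm{Lip}} = \sup_{x\neq y}\frac{|h(x)-h(y)|}{|x-y|}.$$ *)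

(* Defs.v *)
From HB Require Import structures.
From mathcomp Require Import all_boot all_order all_algebra.
From mathcomp Require Import complex.
From mathcomp Require Import all_classical all_reals all_analysis.

Set Implicit Arguments.
Unset Strict Implicit.
Unset Printing Implicit Defensive.

Import Order.TTheory GRing.Theory Num.Theory.
Import numFieldNormedType.Exports.

Local Open Scope classical_set_scope.
Local Open Scope ring_scope.
Local Open Scope complex_scope.

(* Functions on the unit circle are represented by functions f : R[i] -> R, of
   which only the values on the circle matter; the associated 2pi-periodic
   function on R is x |-> f (expi x). *)
Section circle_functions.
Variable R : realType.
Implicit Types (f : R[i] -> R) (j : int).

Definition expi (x : R) : R[i] := cos x +i* sin x.

Definition circle_integrable f : Prop :=
  lebesgue_measure.-integrable `[0, 2 * pi] (fun x : R => (f (expi x))%:E).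

Definition circle_smooth f : Prop :=
  forall (k : nat) (x : R), derivable (derive1n k (fun y : R => f (expi y))) x 1.

Definition complex_integral (D : set R) (g : R -> R[i]) : R[i] :=
  (\int[lebesgue_measure]_(x in D) complex.Re (g x)) +i*
  (\int[lebesgue_measure]_(x in D) complex.Im (g x)).

Definition fourier_coef f j : R[i] :=
  ((2 * pi)^-1)%:C *
  complex_integral `[0, 2 * pi]
    (fun x => (f (expi x))%:C * expi (- (j%:~R * x))).

Definition fourier_decay f (kappa : R) : Prop :=
  exists2 C : R, 0 < C &
    forall j, j != 0 ->
      Normc.normc (fourier_coef f j) <= C * (`|j|%N%:R `^ (- kappa)).

(* On the circle, expi x ^ j = expi (j x). *)
Definition fourier_partial_sum f (N : nat) (z : R[i]) : R[i] :=
  fourier_coef f 0 +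
  \sum_(1 <= k < N.+1)
    (fourier_coef f k%:Z * z ^ k%:Z + fourier_coef f (- k%:Z) * z ^ (- k%:Z)).

(* The partial sums are real on the circle, because f is real valued. *)
Definition fourier_sum f (z : R[i]) : R :=
  limn (fun N => complex.Re (fourier_partial_sum f N z)).

Definition fourier_variance f : \bar R :=
  \esum_(j in [set: int])
    (Normc.normc (fourier_coef f j) ^+ 2 * `|j|%N%:R)%:E.

End circle_functions.

(* R[i]^o is R[i] with the topology of its norm, and a set coerced to a type
   carries the subspace topology. *)
Definition unitary_matrix (R : realType) (n : nat) : Type :=
  [set U : 'M[R[i]^o]_n | (U : 'M[R[i]]_n) \is unitarymx].

Definition unitary_val (R : realType) (n : nat) (U : unitary_matrix R n) :
  'M[R[i]]_n := \val U.

Section unitary_group.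
Variables (R : realType) (n : nat).

HB.instance Definition _ := Topological.on (unitary_matrix R n).

Lemma unitary1_subproof :
  1%:M \in [set U : 'M[R[i]^o]_n | (U : 'M[R[i]]_n) \is unitarymx].
Proof.
by apply/mem_set => /=; apply/unitarymxP; rewrite trmx1 map_mx1 mulmx1.
Qed.

Definition unitary1 : unitary_matrix R n := exist _ 1%:M unitary1_subproof.

HB.instance Definition _ := isPointed.Build (unitary_matrix R n) unitary1.

Lemma unitaryM_subproof (U V : unitary_matrix R n) :
  unitary_val U *m unitary_val V
    \in [set U : 'M[R[i]^o]_n | (U : 'M[R[i]]_n) \is unitarymx].
Proof.
apply/mem_set; apply: mul_unitarymx; first exact: set_mem (valP U).
exact: set_mem (valP V).
Qed.

Definition unitaryM (U V : unitary_matrix R n) : unitary_matrix R n :=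
  exist _ (unitary_val U *m unitary_val V) (unitaryM_subproof U V).

End unitary_group.

(* The unitary group with its Borel sigma-algebra. *)
Notation unitary R n := (g_sigma_algebraType (@open (unitary_matrix R n))).

Section random_unitary.
Variable R : realType.

(* The unitary group is compact, so a left-invariant probability measure is the
   (bi-invariant) Haar probability measure. *)
Definition is_haar (n : nat) (mu : probability (unitary R n) R) : Prop :=
  forall (U : unitary R n) (A : set (unitary R n)), measurable A ->
    mu (unitaryM U @` A) = mu A.

Definition eigenvalues (n : nat) (A : 'M[R[i]]_n) : seq R[i] :=
  sval (closed_field_poly_normal (char_poly A)).

(* The integral of f against the empirical eigenvalue measure of U. *)
Definition empirical_mean (f : R[i] -> R) (n : nat) (U : unitary R n) : R :=
  n%:R^-1 * \sum_(z <- eigenvalues (unitary_val U)) f z.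

Definition fluctuation (f : R[i] -> R) (n : nat) (d : measure_display)
    (T : measurableType d) (P : probability T R) (M : {RV P >-> unitary R n})
    (w : T) : R :=
  n%:R * (empirical_mean f (M w) -
          fine ('E_P[fun w' => empirical_mean f (M w')])%E).

End random_unitary.

Section laws_on_the_line.
Variable R : realType.

(* normal_prob lives on measurableTypeR R, which has the same measurable sets as
   R but another display. *)
Definition line_id (x : measurableTypeR R) : R := x.

HB.instance Definition _ :=
  @isMeasurableFun.Build _ _ (measurableTypeR R) R line_id
    (@measurable_id _ _ setT).

(* normal_prob takes the standard deviation, and is not a point mass when the
   latter is 0. *)
Definition centered_normal (v : R) : probability R R :=
  if v == 0 then (dirac (0 : R) : probability R R)
  else (distribution (normal_prob 0 (Num.sqrt v)) line_id : probability R R).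

Definition cvg_in_law (mu : nat -> probability R R) (nu : probability R R) :
    Prop :=
  forall h : R -> R, continuous h -> bounded_fun h ->
    (\int[mu n]_x h x) @[n --> \oo] --> \int[nu]_x h x.

Definition wasserstein (mu nu : probability R R) : \bar R :=
  ereal_sup [set `| \int[mu]_x (h x)%:E - \int[nu]_x (h x)%:E |%E
            | h in [set h : R -> R | 1.-lipschitz h]].

End laws_on_the_line.

(* Main.v *)
Require Import Defs.
From HB Require Import structures.
From mathcomp Require Import all_boot all_order all_algebra.
From mathcomp Require Import complex.
From mathcomp Require Import all_classical all_reals all_analysis.
From mathcomp Require Import measurable_realfun.
From mathcomp Require Import ring lra zify.

Set Implicit Arguments.
Unset Strict Implicit.
Unset Printing Implicit Defensive.

Import Order.TTheory GRing.Theory Num.Theory.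
Import numFieldNormedType.Exports.

(* The Fourier series of f turns n (L_n(f) - E L_n(f)) into the limit of
   S_d = sum_(1 <= j <= d) 2 Re (c_j p_j), where p_j = tr M^j, and Stein's method
   for the Gaussian law is applied to S_d.

   All moments of the p_j come from left invariance of the Haar measure.
   Differentiating along the unitary matrices 1 + (w - 1) P, with P a Hermitian
   projection and |w| = 1, shows that gradients integrate to 0, hence the
   Schwinger-Dyson equations
     E [h (sum_(0 <= l < k) p_l p_(k-l))] + E [tr (M^k Phi_h)] = 0,
   where Phi_h is the gradient of h.  They yield the orthogonality of the p_j
   and, applied to the matrix coefficients K_b and L_a of the generating
   functions of elementary and complete symmetric functions (products K_b L_a
   correspond to hooks), the identity E |p_m|^2 = min (m, n); the minimum
   appears because K_b = 0 for b >= n, by the Cayley-Hamilton theorem.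
   Applied to a bounded solution h of Stein's equation they give
     |E [S_d h(S_d)] - sigma_d^2 E [h'(S_d)]| <= const * d^2 / n,
   the error terms being controlled by the second moments only.

   The discarded tail has L^1 norm O(d^(1 - kappa)), again by the second
   moments, and d ~ n^(1 / (kappa + 5/2)) gives the rate.  Convergence in law
   follows from the Wasserstein bound by approximating bounded continuous
   functions from below by Lipschitz ones.  For smooth f the coefficients decay
   faster than any power, and f is the sum of its Fourier series because its
   difference quotient at a point of the circle is bounded, so that the partial
   sums telescope to Fourier coefficients tending to 0 by Bessel's inequality. *)

Local Open Scope ring_scope.

(** * Newton polynomials *)

(** The curves 1 + (w - 1) P are exactly unitary and affine in w, so no matrix exponential occurs;
    the projections span all matrices, so every entry of a gradient has mean 0. In the
    Schwinger-Dyson equation for h(S_d) two terms carry a factor n: the summand l = 0, since p_0 =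
    n, and the pairing of M^k with its own adjoint, whose trace is n. The other terms are O(d^2)
    because E |p_m|^2 <= m, a bound free of n; division by n leaves d^2 / n. The hook identities
    replace the characters of the symmetric group: tr (M K_b L_a) is a + b + 1 times the Schur
    function of the hook (a + 1, 1^b), and p_m is the alternating sum of the hooks of size m.
    Balancing d^2 / n against d^(1 - kappa) would allow the exponent 1 / (kappa + 1), so 1 / (kappa
    + 5/2) leaves room. Stein's equation needs sigma > 0; if sigma = 0, all c_j with j >= 1 vanish
    and so does the fluctuation. *)

Lemma exchange_big_ord_lt (V : nmodType) (A : nat) (H : nat -> nat -> V) :
  \sum_(q < A) \sum_(r < A | (q < r)%N) H q r = \sum_(r < A) \sum_(q < r) H q r.
Proof.
rewrite (exchange_big_dep xpredT) //=; apply: eq_bigr => r _.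
by rewrite (big_ord_widen A (fun q => H q r)) // ltnW.
Qed.

Section NewtonPolynomials.
Variables (F : numFieldType) (tau : {scalar {poly F}}).

Local Notation p i := (tau 'X^i).

(* For tau q = \tr (q.[M]), s = -1 and s = 1 give the generating functions
   det (1 + u M) (1 + u M)^-1 and det (1 - u M)^-1 (1 - u M)^-1. *)
Fixpoint newton_poly (s : F) (k : nat) : {poly F} :=
  if k is k'.+1 then
    (tau ('X * newton_poly s k') / k%:R)%:P + s *: ('X * newton_poly s k')
  else 1.

(** By Newton's identities this is the elementary symmetric function e_k of the eigenvalues for s =
    -1 and the complete one h_k for s = 1. It is the constant coefficient of [newton_poly s k]. *)
Definition newton_coef (s : F) (k : nat) : F :=
  if k is k'.+1 then tau ('X * newton_poly s k') / k%:R else 1.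

Arguments newton_poly : simpl never.
Arguments newton_coef : simpl never.

Lemma newton_poly0 s : newton_poly s 0 = 1. Proof. by []. Qed.

Lemma newton_coef0 s : newton_coef s 0 = 1. Proof. by []. Qed.

Lemma newton_polyS s k :
  newton_poly s k.+1 = (newton_coef s k.+1)%:P + s *: ('X * newton_poly s k).
Proof. by []. Qed.

Lemma newton_coefS s k :
  k.+1%:R * newton_coef s k.+1 = tau ('X * newton_poly s k).
Proof. by rewrite /newton_coef mulrC divfK // pnatr_eq0. Qed.

Lemma size_newton_poly s k : (size (newton_poly s k) <= k.+1)%N.
Proof.
elim: k => [|k IH]; first by rewrite size_poly1.
rewrite newton_polyS (leq_trans (size_polyD _ _)) // geq_max.
rewrite (leq_trans (size_polyC_leq1 _)) //= (leq_trans (size_scale_leq _ _)) //.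
by rewrite mulrC (leq_trans (size_polyMleq _ _)) // size_polyX addn2.
Qed.

Lemma coef_newton_poly s k i :
  (newton_poly s k)`_i = if (i <= k)%N then s ^+ i * newton_coef s (k - i) else 0.
Proof.
elim: k i => [|k IH] [|i].
- by rewrite coef1 mul1r.
- by rewrite coef1.
- by rewrite newton_polyS coefD coefC coefZ coefXM /= mulr0 addr0 mul1r.
- rewrite newton_polyS coefD coefC coefZ coefXM /= IH add0r ltnS subSS.
  by case: ifP => _; rewrite ?mulr0 // mulrA -exprS.
Qed.

Lemma tau_newton_poly s k (j : nat) (N : nat) : (k < N)%N ->
  tau ('X^j * newton_poly s k) = \sum_(i < N) (newton_poly s k)`_i * p (j + i).
Proof.
move=> kN; have sN := leq_trans (size_newton_poly s k) kN.
rewrite -{1}[newton_poly s k]coefK.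
rewrite poly_def (big_ord_widen N (fun i => (newton_poly s k)`_i *: 'X^i)) //.
rewrite mulr_sumr linear_sum /=.
rewrite [RHS](bigID (fun i : 'I_N => (i < size (newton_poly s k))%N)) /=.
rewrite [X in _ = _ + X]big1 ?addr0; last first.
  by move=> i; rewrite -leqNgt => /(nth_default 0) ->; rewrite mul0r.
by apply: eq_bigr => i _; rewrite -scalerAr linearZ /= exprD.
Qed.

(** Newton's identity for [newton_coef s (k - q)], since the coefficient of degree q is
    [s ^+ q * newton_coef s (k - q)]; s^2 = 1 moves the powers of s across. *)
Lemma newton_coef_identity s k q : s * s = 1 ->
  (k%:R - q%:R) * (newton_poly s k)`_q =
  s * \sum_(r < k.+1 | (q < r)%N) p (r - q) * (newton_poly s k)`_r.
Proof.
move=> s2; have [kq|qk] := leqP k q.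
  rewrite big_pred0 ?mulr0 => [|r]; last first.
    by apply/negbTE; rewrite -leqNgt (leq_trans _ kq) // -ltnS.
  rewrite coef_newton_poly; case: leqP => // qk; last by rewrite mulr0.
  by have -> : k = q; [apply/eqP; rewrite eqn_leq kq qk|rewrite subrr mul0r].
rewrite -natrB ?(ltnW qk) // coef_newton_poly (ltnW qk).
have -> : (k - q = (k - q.+1).+1)%N by rewrite -subSn // subSS.
rewrite mulrCA newton_coefS -['X]expr1 (@tau_newton_poly s _ 1 (k - q)); last first.
  by rewrite -[X in (_ < X)%N]/(k - q)%N ltn_sub2l.
rewrite -[X in _ = s * X](big_mkord (fun r => (q < r)%N)
  (fun r => p (r - q) * (newton_poly s k)`_r)).
rewrite (@big_cat_nat _ _ _ q.+1) //= ?ltnS ?(ltnW qk) //.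
rewrite [X in s * (X + _)]big_nat_cond [X in s * (X + _)]big_pred0 ?add0r; last first.
  by move=> r; rewrite ltnS leq0n /=; case: ltnP.
have -> (G : nat -> F) : \sum_(q.+1 <= i < k.+1 | (q < i)%N) G i =
    \sum_(i < k - q | (q < i + q.+1)%N) G (i + q.+1)%N.
  by rewrite -{1}[q.+1]add0n big_addn subSS big_mkord.
rewrite !big_distrr /=.
rewrite [RHS]big_mkcond /=; apply: eq_bigr => i _.
have iq : (i < k - q)%N by [].
have ki : (i <= k - q.+1)%N by rewrite subnS -ltnS prednK // (leq_ltn_trans _ iq).
have ik : (i + q.+1 <= k)%N by rewrite addnC addSn -ltn_subRL.
rewrite addnS ltnS leq_addl subSn ?leq_addl // addnK.
rewrite !coef_newton_poly ki -addnS ik -subnDA [(q.+1 + i)%N]addnC add1n.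
rewrite exprS exprD exprS; ring: s2.
Qed.

Local Notation e := (newton_coef (-1)).
Local Notation h := (newton_coef 1).
Local Notation K := (newton_poly (-1)).
Local Notation L := (newton_poly 1).

(* [q = f_i g_j] runs over the coefficients of K_b L_a, and the last two terms
   come from differentiating f_i and g_j. *)
Lemma hook_divergence a b :
  \sum_(i < b.+1) \sum_(q < a.+1)
    ((K b)`_i * (L a)`_q * (\sum_(l < (i + q).+1) p l * p ((i + q).+1 - l))
     + (K b)`_i * (\sum_(r < a.+1 | (q < r)%N) (L a)`_r * p (i + r).+1)
     - (L a)`_q * (\sum_(r < b.+1 | (i < r)%N) (K b)`_r * p (r + q).+1))
  = (p 0 + a%:R - b%:R) * tau ('X * K b * L a).
Proof.
have -> : tau ('X * K b * L a) =
    \sum_(i < b.+1) \sum_(q < a.+1) (K b)`_i * (L a)`_q * p (i + q).+1.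
  have KE : K b = \sum_(i < b.+1) (K b)`_i *: 'X^i.
    rewrite -[LHS]coefK poly_def
      (big_ord_widen b.+1 (fun i => (K b)`_i *: 'X^i)) ?size_newton_poly //.
    rewrite [RHS](bigID (fun i : 'I_b.+1 => (i < size (K b))%N)) /=.
    rewrite [X in _ = _ + X]big1 ?addr0 //.
    by move=> i; rewrite -leqNgt => /(nth_default 0) ->; rewrite scale0r.
  rewrite [X in 'X * X]KE mulr_sumr mulr_suml linear_sum /=.
  apply: eq_bigr => i _; rewrite -scalerAr -scalerAl linearZ /= -exprS.
  rewrite (@tau_newton_poly 1 a i.+1 a.+1) // big_distrr /=.
  by apply: eq_bigr => q _; rewrite mulrA addSn.
under eq_bigr => i _ do rewrite !big_split /= sumrN.
rewrite !big_split /= sumrN.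
have -> : \sum_(i < b.+1) \sum_(q < a.+1)
    (K b)`_i * (\sum_(r < a.+1 | (q < r)%N) (L a)`_r * p (i + r).+1) =
    \sum_(i < b.+1) \sum_(q < a.+1) q%:R * ((K b)`_i * (L a)`_q * p (i + q).+1).
  apply: eq_bigr => i _; rewrite -big_distrr /=.
  rewrite (exchange_big_ord_lt _ (fun q r => (L a)`_r * p (i + r).+1)) big_distrr /=.
  apply: eq_bigr => q _; rewrite sumr_const card_ord -mulr_natl; ring.
have -> : \sum_(i < b.+1) \sum_(q < a.+1)
    (L a)`_q * (\sum_(r < b.+1 | (i < r)%N) (K b)`_r * p (r + q).+1) =
    \sum_(i < b.+1) \sum_(q < a.+1) i%:R * ((K b)`_i * (L a)`_q * p (i + q).+1).
  rewrite exchange_big [RHS]exchange_big; apply: eq_bigr => q _ /=.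
  rewrite -big_distrr /=.
  rewrite (exchange_big_ord_lt _ (fun i r => (K b)`_r * p (r + q).+1)) big_distrr /=.
  apply: eq_bigr => i _; rewrite sumr_const card_ord -mulr_natl; ring.
(* The summand l = 0 gives [p 0]. The next q summands, read backwards, have the shape of Newton's
   identity for [L a], and the last i ones that for [K b]. *)
have -> : \sum_(i < b.+1) \sum_(q < a.+1)
     (K b)`_i * (L a)`_q * (\sum_(l < (i + q).+1) p l * p ((i + q).+1 - l)) =
   \sum_(i < b.+1) \sum_(q < a.+1) p 0 * ((K b)`_i * (L a)`_q * p (i + q).+1) +
   (\sum_(i < b.+1) \sum_(q < a.+1)
     (K b)`_i * (L a)`_q * (\sum_(l < q) p (q - l) * p (i + l).+1) +
   \sum_(i < b.+1) \sum_(q < a.+1)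
     (K b)`_i * (L a)`_q * (\sum_(l < i) p (i - l) * p (l + q).+1)).
  rewrite -!big_split /=; apply: eq_bigr => i _.
  rewrite -!big_split /=; apply: eq_bigr => q _.
  have -> : \sum_(l < (i + q).+1) p l * p ((i + q).+1 - l) =
     p 0 * p (i + q).+1 + (\sum_(l < q) p (q - l) * p (i + l).+1 +
       \sum_(l < i) p (i - l) * p (l + q).+1).
    rewrite big_ord_recl subn0; congr (_ + _).
    rewrite -(big_mkord xpredT (fun l => p (bump 0 l) * p ((i + q).+1 - bump 0 l)%N)).
    rewrite (@big_cat_nat _ _ _ q) ?leq_addl //=; congr (_ + _).
      rewrite big_mkord (reindex_inj rev_ord_inj) /=; apply: eq_bigr => l _.
      by rewrite /bump; congr (tau 'X^_ * tau 'X^_); have := ltn_ord l; lia.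
    rewrite -{1}[q : nat]add0n big_addn addnK big_mkord; apply: eq_bigr => l _.
    by rewrite mulrC /bump; congr (tau 'X^_ * tau 'X^_); have := ltn_ord l; lia.
  by rewrite !mulrDr; congr (_ + _); ring.
have N1 : (1 : F) * 1 = 1 by rewrite mulr1.
have Nm : (- 1 : F) * (- 1) = 1 by rewrite mulrNN mulr1.
have -> : \sum_(i < b.+1) \sum_(q < a.+1)
     (K b)`_i * (L a)`_q * (\sum_(l < q) p (q - l) * p (i + l).+1) =
   \sum_(i < b.+1) \sum_(q < a.+1)
     (a%:R - q%:R) * ((K b)`_i * (L a)`_q * p (i + q).+1).
  apply: eq_bigr => i _.
  transitivity (\sum_(q < a.+1) \sum_(r < a.+1 | (q < r)%N)
     (K b)`_i * (L a)`_r * (p (r - q) * p (i + q).+1)).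
    rewrite (exchange_big_ord_lt _
      (fun q r => (K b)`_i * (L a)`_r * (p (r - q) * p (i + q).+1))).
    by apply: eq_bigr => q _; rewrite big_distrr.
  apply: eq_bigr => q _.
  transitivity ((K b)`_i * p (i + q).+1 * ((a%:R - q%:R) * (L a)`_q)); last by ring.
  rewrite newton_coef_identity // mul1r big_distrr /=; apply: eq_bigr => r _; ring.
have -> : \sum_(i < b.+1) \sum_(q < a.+1)
     (K b)`_i * (L a)`_q * (\sum_(l < i) p (i - l) * p (l + q).+1) =
   \sum_(i < b.+1) \sum_(q < a.+1)
     (i%:R - b%:R) * ((K b)`_i * (L a)`_q * p (i + q).+1).
  rewrite exchange_big [RHS]exchange_big /=; apply: eq_bigr => q _.
  transitivity (\sum_(i < b.+1) \sum_(r < b.+1 | (i < r)%N)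
     (L a)`_q * (K b)`_r * (p (r - i) * p (i + q).+1)).
    rewrite (exchange_big_ord_lt _
      (fun i r => (L a)`_q * (K b)`_r * (p (r - i) * p (i + q).+1))).
    by apply: eq_bigr => i _; rewrite big_distrr /= [(K b)`_i * _]mulrC.
  apply: eq_bigr => i _.
  transitivity (- ((L a)`_q * p (i + q).+1 * ((b%:R - i%:R) * (K b)`_i))); last by ring.
  rewrite newton_coef_identity // mulN1r mulrN opprK big_distrr /=.
  by apply: eq_bigr => r _; ring.
(* The weights of the term (i, q) add up: [p 0] + (a - q) + (i - b) + q - i = [p 0] + a - b. *)
rewrite big_distrr /= -sumrN -!big_split /=; apply: eq_bigr => i _.
rewrite big_distrr /= -sumrN -!big_split /=; apply: eq_bigr => q _.
by ring.
Qed.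

(** In the mixed terms of the product, e_{b+1} is replaced by K_{b+1} + X K_b and h_{a+1} by L_{a+1}
    - X L_a. Paired with a power of M, this becomes the recursion for [Y] in [hook_recursion]. *)
Lemma newton_poly_mul a b :
  K b.+1 * L a.+1 = (e b.+1 * h a.+1)%:P - 'X * K b * L a.+1 + 'X * K b.+1 * L a
                    + 'X ^+ 2 * K b * L a.
Proof.
rewrite !newton_polyS; move: (e b.+1) (h a.+1) => x y; rewrite polyCM scaleN1r scale1r.
ring.
Qed.

(** Pieri's rule multiplied by the degree: e_{b+1} h_{a+1} is the sum of the Schur functions of the
    hooks (a + 2, 1^b) and (a + 1, 1^(b+1)). *)
Lemma newton_coef_mul a b :
  (a.+1 + b.+1)%:R * (e b.+1 * h a.+1) =
  tau ('X * K b * L a.+1) + tau ('X * K b.+1 * L a).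
Proof.
have E1 : b.+1%:R * e b.+1 * h a.+1 = tau ('X * K b * L a.+1 - 'X ^+ 2 * K b * L a).
  rewrite newton_coefS mulrC -linearZ /=; congr (tau _).
  by rewrite [L a.+1]newton_polyS -mul_polyC scale1r; ring.
have E2 : a.+1%:R * h a.+1 * e b.+1 = tau ('X * K b.+1 * L a + 'X ^+ 2 * K b * L a).
  rewrite newton_coefS mulrC -linearZ /=; congr (tau _).
  by rewrite [K b.+1]newton_polyS -mul_polyC scaleN1r; ring.
rewrite natrD mulrDl -[RHS]linearD /=.
transitivity (b.+1%:R * e b.+1 * h a.+1 + a.+1%:R * h a.+1 * e b.+1); first by ring.
by rewrite E1 E2 -linearD /=; congr (tau _); ring.
Qed.

Lemma alternating_newton_coef_mul m :
  \sum_(b < m.+2) (-1) ^+ b * (e b * h (m.+1 - b)) = 0.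
Proof.
apply: (mulfI (x := m.+1%:R)); first by rewrite pnatr_eq0.
rewrite mulr0 big_distrr /=.
(* By Pieri's rule the summands are differences of consecutive signed hooks; [c] is extended by 0 at
   both ends so that the sum telescopes to 0. *)
pose c b : F := if b is b'.+1 then
  if (b' <= m)%N then (-1) ^+ b' * tau ('X * K b' * L (m - b')) else 0 else 0.
rewrite (eq_bigr (fun b : 'I_m.+2 => c b.+1 - c b)).
  rewrite -(big_mkord xpredT (fun b => c b.+1 - c b)) telescope_sumr //=.
  by rewrite ltnn subr0.
move=> [[|b] bm] _ /=.
  by rewrite newton_coef0 !subn0 subr0 !expr0 !mul1r newton_coefS newton_poly0 mulr1.
have bm1 : (b <= m)%N by rewrite -ltnS.
rewrite bm1 subSS.
have [mb|bm'] := leqP m b.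
  have -> : b = m by apply/eqP; rewrite eqn_leq mb bm1.
  rewrite subnn newton_coef0 newton_poly0 mulr1 mulrCA newton_coefS sub0r exprS mulN1r mulNr; congr (- (_ * tau _)).
  by rewrite mulr1.
rewrite mulrCA (_ : m - b = (m - b.+1).+1)%N; last by rewrite -subSn // subSS.
rewrite -{1}[m](subnK bm') -addSn addnC addnC newton_coef_mul exprS; ring.
Qed.

(** Coefficientwise form of E(u) H(-u) = 1: the generating function of the K_b is E(u) / (1 + u X),
    so multiplication by H(-u) leaves 1 / (1 + u X). *)
Lemma alternating_newton_poly_coef_mul m :
  \sum_(b < m.+1) ((-1) ^+ b * h (m - b)) *: K b = 'X^m.
Proof.
elim: m => [|m IH].
  by rewrite big_ord_recl big_ord0 /= newton_coef0 newton_poly0 expr0 mul1r scale1r addr0.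
have <- : (\sum_(b < m.+2) ((-1) ^+ b * h (m.+1 - b) * e b)%:P) +
   'X * (\sum_(b < m.+1) ((-1) ^+ b * h (m - b)) *: K b) = 'X^(m.+1).
  rewrite IH -exprS -(rmorph_sum (@polyC F)) /= (eq_bigr (fun b : 'I_m.+2 =>
    (-1) ^+ b * (e b * h (m.+1 - b)))) => [|b _].
    by rewrite alternating_newton_coef_mul polyC0 add0r.
  by rewrite -mulrA [h _ * _]mulrC.
rewrite big_ord_recl [in RHS]big_ord_recl -addrA; congr (_ + _).
  by rewrite newton_coef0 newton_poly0 /= mulr1 alg_polyC.
rewrite mulr_sumr -big_split /=; apply: eq_bigr => b _.
rewrite /bump add1n subSS newton_polyS -!mul_polyC !polyCM exprS polyCM polyCN polyC1.
ring.
Qed.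

(** The generating functions of the K_b at u and of the L_a at -u multiply to 1 / (1 + u X)^2. After
    multiplication by X and [tau], this writes (m + 1) p_{m+1} as the alternating sum of hooks. *)
Lemma alternating_newton_poly_mul m :
  \sum_(b < m.+1) (-1) ^+ b *: (K b * L (m - b)) = m.+1%:R *: 'X^m.
Proof.
elim: m => [|m IH].
  by rewrite big_ord_recl big_ord0 newton_poly0 mulr1 addr0 !scale1r.
have -> : m.+2%:R *: 'X^(m.+1) = (\sum_(b < m.+2) ((-1) ^+ b * h (m.+1 - b)) *: K b)
   + 'X * (\sum_(b < m.+1) (-1) ^+ b *: (K b * L (m - b))).
  rewrite alternating_newton_poly_coef_mul IH -scalerAr -exprS.
  by rewrite -natr1 scalerDl scale1r addrC.
rewrite big_ord_recr [in RHS]big_ord_recr /= !subnn newton_poly0 newton_coef0 !mulr1 -addrA [_ + 'X * _]addrC.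
rewrite addrA; congr (_ + _).
rewrite mulr_sumr -big_split /=; apply: eq_bigr => b _.
rewrite subSn; last by rewrite -ltnS.
rewrite newton_polyS -!mul_polyC !polyCM polyC1; ring.
Qed.

(** Evaluated at M, this polynomial is the gradient of [newton_coef s k]; see
    [has_gradient_newton_coef]. *)
Definition newton_gradient (s : F) (k : nat) : {poly F} :=
  if k is k'.+1 then 'X * newton_poly s k' else 0.

(** The left side is the gradient of the coefficient of degree i of [newton_poly s b]. The right
    side has the form that [hook_divergence] expects. *)
Lemma newton_gradient_coef s b i : s * s = 1 -> (i <= b)%N ->
  s ^+ i *: newton_gradient s (b - i) =
  s *: \sum_(r < b.+1 | (i < r)%N) (newton_poly s b)`_r *: 'X^(r - i).
Proof.
move=> s2 ib; apply/polyP => -[|c]; rewrite !coefZ coef_sum.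
  rewrite big1 ?mulr0 => [|r ir].
    by rewrite /newton_gradient; case: (b - i)%N => [|m]; rewrite ?coef0 ?coefXM mulr0.
  by rewrite coefZ coefXn eq_sym subn_eq0 leqNgt ir mulr0.
have [cb|cb] := ltnP (c + i) b; last first.
  rewrite big1 ?mulr0 => [|r ir]; last first.
    rewrite coefZ coefXn; case: eqP => [e|]; rewrite ?mulr0 //.
    by have := ltn_ord r; move: ir cb e; lia.
  rewrite /newton_gradient; case E : (b - i)%N => [|m]; rewrite ?coef0 ?mulr0 //.
  rewrite coefXM /= coef_newton_poly; case: leqP => //; rewrite ?mulr0 //; lia.
have cb' : ((c + i).+1 < b.+1)%N by [].
rewrite (bigD1 (Ordinal cb')) /=; last by lia.
rewrite big1 ?addr0 => [|r /andP[ir rc]]; last first.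
  rewrite coefZ coefXn; case: eqP => [e|]; rewrite ?mulr0 //.
  by case/eqP: rc; apply: val_inj => /=; lia.
rewrite coefZ coefXn -addSn addnK eqxx mulr1 coef_newton_poly addSn cb.
rewrite /newton_gradient; case E : (b - i)%N => [|m]; first by lia.
rewrite coefXM /= coef_newton_poly (_ : (c <= m)%N); last by lia.
have -> : (b - (c + i).+1 = m - c)%N by lia.
by rewrite exprS exprD; ring: s2.
Qed.

(** The gradient of Newton's identity (k + 1) x_{k+1} = sum of s^i p_{i+1} x_{k-i}, where p_{i+1}
    has gradient (i + 1) X^(i+1). *)
Lemma newton_gradient_identity s k : s * s = 1 ->
  \sum_(i < k.+1) ((i.+1%:R * (newton_poly s k)`_i) *: 'X^(i.+1) +
                   (p i.+1 * s ^+ i) *: newton_gradient s (k - i)) =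
  k.+1%:R *: ('X * newton_poly s k).
Proof.
move=> s2; rewrite big_split /=.
have -> : \sum_(i < k.+1) (p i.+1 * s ^+ i) *: newton_gradient s (k - i) =
   \sum_(r < k.+1) ((k%:R - r%:R) * (newton_poly s k)`_r) *: 'X^(r.+1).
  transitivity (s *: \sum_(i < k.+1) \sum_(r < k.+1 | (i < r)%N)
      (p i.+1 * (newton_poly s k)`_r) *: 'X^(r - i)).
    rewrite scaler_sumr; apply: eq_bigr => i _.
    have ik : (i <= k)%N by rewrite -ltnS.
    rewrite -scalerA newton_gradient_coef // scalerA mulrC -scalerA.
    by rewrite scaler_sumr; congr (_ *: _); apply: eq_bigr => r _; rewrite scalerA.
  rewrite (exchange_big_ord_lt _
    (fun i r => (p i.+1 * (newton_poly s k)`_r) *: 'X^(r - i))).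
  transitivity (s *: \sum_(r < k.+1) \sum_(i < r)
      (p (r - i) * (newton_poly s k)`_r) *: 'X^(i.+1)).
    congr (_ *: _); apply: eq_bigr => r _.
    rewrite (reindex_inj rev_ord_inj) /=; apply: eq_bigr => i _.
    by rewrite -subSn // subSS subKn // ltnW.
  rewrite -(exchange_big_ord_lt _
    (fun i r => (p (r - i) * (newton_poly s k)`_r) *: 'X^(i.+1))).
  rewrite scaler_sumr; apply: eq_bigr => i _.
  by rewrite -scaler_suml scalerA newton_coef_identity.
rewrite -big_split /=.
have XE : newton_poly s k = \sum_(i < k.+1) (newton_poly s k)`_i *: 'X^i.
  rewrite -[LHS]coefK poly_def.
  rewrite (big_ord_widen k.+1 (fun i => (newton_poly s k)`_i *: 'X^i));
    last exact: size_newton_poly.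
  rewrite big_mkcond; apply: eq_bigr => i _.
  by case: ltnP => // /(nth_default 0) ->; rewrite scale0r.
rewrite [X in _ = _ *: ('X * X)]XE mulr_sumr scaler_sumr; apply: eq_bigr => i _.
rewrite -scalerDl -mulrDl -scalerAr -exprS scalerA; congr (_ * _ *: _).
by rewrite -!natr1; ring.
Qed.

End NewtonPolynomials.

(** Induction on a + b gives Y a b = (-1)^b (n + a - b). The values of [t] in lower degree give [Q],
    which is 0 away from the two axes, and [Q] gives the next [Y]. The condition b < n makes n + a -
    b nonzero, so that [t] can be recovered from [Y]. *)
Lemma hook_recursion (F : numFieldType) (n : nat) (t Y Q : nat -> nat -> F) :
  (forall a b, (n%:R + a%:R - b%:R) * t a b = (a + b).+1%:R * Y a b) ->
  Y 0 0 = n%:R ->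
  (forall a, Y a.+1 0 = Q a.+1 0 + Y a 0) ->
  (forall b, Y 0 b.+1 = Q 0 b.+1 - Y 0 b) ->
  (forall a b, Y a.+1 b.+1 = Q a.+1 b.+1 - Y a.+1 b + Y a b.+1 + Y a b) ->
  (forall a, a.+1%:R * Q a.+1 0 = t a 0) ->
  (forall b, b.+1%:R * Q 0 b.+1 = t 0 b) ->
  (forall a b, (a.+1 + b.+1)%:R * Q a.+1 b.+1 = t a.+1 b + t a b.+1) ->
  forall a b, (b < n)%N -> t a b = (a + b).+1%:R * (-1) ^+ b.
Proof.
move=> tY Y00 Ya0 Y0b Yab Qa0 Q0b Qab.
have tE a b : (b < n)%N -> Y a b = (-1) ^+ b * (n%:R + a%:R - b%:R) ->
    t a b = (a + b).+1%:R * (-1) ^+ b.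
  move=> bn YE; apply: (mulfI (x := n%:R + a%:R - b%:R)); last first.
    by rewrite tY YE; ring.
  rewrite -natrD -natrB ?pnatr_eq0 ?subn_eq0 -?ltnNge.
    by rewrite (leq_trans bn) // leq_addr.
  by rewrite (leq_trans (ltnW bn)) // leq_addr.
have nz k : k.+1%:R != 0 :> F by rewrite pnatr_eq0.
have main k a b : (a + b = k)%N -> (b < n)%N ->
    Y a b = (-1) ^+ b * (n%:R + a%:R - b%:R).
  elim/ltn_ind: k a b => k IH [|a] [|b] abk bn.
  - by rewrite Y00 expr0 mul1r addr0 subr0.
  - have := IH b; rewrite -abk add0n ltnSn => /(_ isT 0 b erefl (ltnW bn)) YE.
    have Q1 : Q 0 b.+1 = (-1) ^+ b.
      apply: (mulfI (nz b)); rewrite Q0b tE // ltnW //.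
    by rewrite Y0b Q1 YE exprS -natr1; ring.
  - have := IH a; rewrite -abk addn0 ltnSn => /(_ isT a 0 (addn0 a) bn) YE.
    have Q1 : Q a.+1 0 = 1.
      by apply: (mulfI (nz a)); rewrite Qa0 tE // addn0 expr0.
    by rewrite Ya0 Q1 YE expr0 -natr1; ring.
  - have l1 : (a.+1 + b < k)%N by rewrite -abk addnS.
    have l2 : (a + b.+1 < k)%N by rewrite -abk addSn.
    have l3 : (a + b < k)%N by rewrite (ltn_trans _ l1).
    have Y1 := IH _ l1 _ _ erefl (ltnW bn).
    have Y2 := IH _ l2 _ _ erefl bn.
    have Y3 := IH _ l3 _ _ erefl (ltnW bn).
    have Q1 : Q a.+1 b.+1 = 0.
      apply: (mulfI (nz (a + b.+1)%N)).
      rewrite -addSn Qab !tE // ?(ltnW bn) // exprS addSnnS; ring.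
    by rewrite Yab Q1 Y1 Y2 Y3 exprS -!natr1; ring.
by move=> a b bn; apply: tE => //; apply: (main _ _ _ erefl).
Qed.

Lemma deriv_prod_ord (F : comNzRingType) (n : nat) (P : 'I_n -> {poly F}) :
  (\prod_(j < n) P j)^`() = \sum_(i < n) (P i)^`() * \prod_(j < n | j != i) P j.
Proof.
elim: n P => [|n IH] P; first by rewrite !big_ord0 derivC.
rewrite big_ord_recl derivM IH [RHS]big_ord_recl; congr (_ * _ + _).
  by rewrite [RHS]big_mkcond big_ord_recl /= mul1r.
rewrite mulr_sumr; apply: eq_bigr => i _.
rewrite mulrCA; congr (_ * _); rewrite [RHS]big_mkcond big_ord_recl /=.
by rewrite big_mkcond.
Qed.

(** At the eigenvalue z_i, K_b is e_b of the other eigenvalues. With E the product of the 1 + z_j X,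
    the derivative E' is the sum of the z_i E / (1 + z_i X), which is Newton's identity; dividing E
    by its factor 1 + z_i X gives the recursion defining K_b. *)
Lemma newton_poly_eigenvalue (F : numFieldType) (tau : {scalar {poly F}})
    (n : nat) (z : 'I_n -> F) : (forall q, tau q = \sum_(i < n) q.[z i]) ->
  forall b i, (newton_poly tau (-1) b).[z i] =
    (\prod_(j < n | j != i) (1 + z j *: 'X))`_b.
Proof.
move=> tauE; elim=> [|b IH] i.
  rewrite newton_poly0 hornerC -horner_coef0 horner_prod big1 // => j _.
  by rewrite hornerD hornerC hornerZ hornerX mulr0 addr0.
pose E := \prod_(j < n) (1 + z j *: 'X).
have EE : E = (1 + z i *: 'X) * \prod_(j < n | j != i) (1 + z j *: 'X).
  by rewrite /E (bigD1 i).
suff Nw : newton_coef tau (-1) b.+1 = E`_b.+1.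
  rewrite newton_polyS hornerD hornerC hornerZ hornerM hornerX IH Nw EE.
  by rewrite mulrDl mul1r coefD -scalerAl coefZ coefXM /=; ring.
apply: (mulfI (x := b.+1%:R)); first by rewrite pnatr_eq0.
rewrite newton_coefS tauE.
transitivity (E^`()`_b); last by rewrite coef_deriv mulr_natl.
rewrite /E deriv_prod_ord coef_sum; apply: eq_bigr => j _.
by rewrite derivD derivC derivZ derivX add0r -scalerAl mul1r coefZ hornerM hornerX IH.
Qed.

(** Only n - 1 other eigenvalues remain, and they have no elementary symmetric function of degree b
    >= n. *)
Lemma newton_poly_eigenvalue_eq0 (F : numFieldType) (tau : {scalar {poly F}})
    (n : nat) (z : 'I_n -> F) : (forall q, tau q = \sum_(i < n) q.[z i]) ->
  forall b i, (n <= b)%N -> (newton_poly tau (-1) b).[z i] = 0.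
Proof.
move=> tauE b i nb; rewrite (newton_poly_eigenvalue tauE) nth_default //.
apply: leq_trans (size_poly_prod_leq _ _) _.
have s2 j : (size (1 + z j *: 'X)%R <= 2)%N.
  rewrite (leq_trans (size_polyD _ _)) // geq_max size_poly1 /=.
  by rewrite (leq_trans (size_scale_leq _ _)) ?size_polyX.
have n0 : (0 < n)%N := leq_trans (ltn0Sn _) (ltn_ord i).
have card1 : #|[pred j : 'I_n | j != i]| = n.-1.
  by rewrite -[n in RHS]card_ord -(cardC1 i); apply: eq_card.
have : (\sum_(j < n | j != i) size (1 + z j *: 'X)%R <= 2 * n.-1)%N.
  apply: (leq_trans (n := \sum_(j < n | j != i) 2)); first exact: leq_sum.
  by rewrite sum_nat_const card1 mulnC.
move=> S; rewrite leq_subLR card1 (leq_trans (_ : _ <= (2 * n.-1).+1)%N) //.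
by move: nb n0; lia.
Qed.

Local Open Scope classical_set_scope.
Local Open Scope ring_scope.
Local Open Scope complex_scope.
Local Open Scope sesquilinear_scope.

(** * The Borel structure of the unitary group *)

Lemma Im_le_norm (R : realType) (x : R[i]) : `|complex.Im x|%:C <= `|x|.
Proof.
by rewrite normc_def lecR -sqrtr_sqr ler_wsqrtr // lerDr sqr_ge0.
Qed.

Section borel_unitary.
Variables (R : realType) (n : nat).
Local Notation C := R[i].

Lemma continuous_entry (i j : 'I_n) :
  continuous (fun M : unitary_matrix R n => (val M : 'M[R[i]^o]_n) i j).
Proof.
move=> M; apply: (@continuous_comp _ _ _ (fun M : unitary_matrix R n => val M : 'M[R[i]^o]_n)
  (fun A : 'M[R[i]^o]_n => A i j)).
  exact: initial_continuous.
exact: coord_continuous.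
Qed.

Lemma continuous_Re : continuous (fun x : R[i]^o => complex.Re x).
Proof.
move=> x A /nbhs_ballP[e /= e0 eA]; apply/nbhs_ballP; exists (e%:C); first by rewrite /= ltcR.
move=> y xy; apply: eA; rewrite /ball /= -raddfB -ltcR.
exact: le_lt_trans (normc_ge_Re _) xy.
Qed.

Lemma continuous_Im : continuous (fun x : R[i]^o => complex.Im x).
Proof.
move=> x A /nbhs_ballP[e /= e0 eA]; apply/nbhs_ballP; exists (e%:C); first by rewrite /= ltcR.
move=> y xy; apply: eA; rewrite /ball /= -raddfB -ltcR.
exact: le_lt_trans (Im_le_norm _) xy.
Qed.

Lemma continuous_unitary_measurable (g : unitary_matrix R n -> R) : continuous g ->
  measurable_fun [set: unitary R n] (g : unitary R n -> R).
Proof.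
move=> cg; apply: (measurability _ (RGenOpens.measurableE R)).
move=> _ [_ [a [b ->]] <-]; rewrite setTI; apply: sub_sigma_algebra.
by move/continuousP: cg; apply; exact: interval_open.
Qed.

Lemma measurable_Re_entry (i j : 'I_n) :
  measurable_fun [set: unitary R n] (fun M : unitary R n => complex.Re (unitary_val M i j)).
Proof.
apply: continuous_unitary_measurable => M.
exact: (continuous_comp (@continuous_entry i j M) (@continuous_Re _)).
Qed.

Lemma measurable_Im_entry (i j : 'I_n) :
  measurable_fun [set: unitary R n] (fun M : unitary R n => complex.Im (unitary_val M i j)).
Proof.
apply: continuous_unitary_measurable => M.
exact: (continuous_comp (@continuous_entry i j M) (@continuous_Im _)).
Qed.

Lemma continuous_unitaryM (U : unitary_matrix R n) :
  continuous (unitaryM U : unitary_matrix R n -> unitary_matrix R n).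
Proof.
apply: continuous_comp_initial => M A [P MP PA].
have cf i j : continuous (fun M : unitary_matrix R n =>
    \sum_k ((val U : 'M[R[i]^o]_n) i k * (val M : 'M[R[i]^o]_n) k j : R[i]^o)).
  apply: continuous_big => [|k _]; first exact: add_continuous.
  move=> N; apply: (@cvgM _ _ _ (nbhs_filter N)); first exact: cvg_cst.
  exact: continuous_entry.
suff : \forall N \near M, forall i j, P i j ((val (unitaryM U N) : 'M[R[i]^o]_n) i j).
  by apply: (@filterS _ (nbhs M) (nbhs_filter M)) => N PN; apply: PA.
apply: (@filter_forall _ _ _ _ (nbhs_filter M)) => i.
apply: (@filter_forall _ _ _ _ (nbhs_filter M)) => j.
have := MP i j; rewrite /= mxE => /cf cfP.
by apply: (@filterS _ (nbhs M) (nbhs_filter M) _ _ _ cfP) => N /=; rewrite mxE.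
Qed.

Definition ltrans (U : unitary R n) : unitary R n -> unitary R n := unitaryM U.

Lemma measurable_ltrans (U : unitary R n) : measurable_fun setT (ltrans U).
Proof.
apply: (@measurability _ _ (unitary R n) (unitary R n) setT _ (@open (unitary_matrix R n)) erefl).
move=> _ [A oA <-]; rewrite setTI; apply: sub_sigma_algebra.
by have /continuousP := @continuous_unitaryM U; apply.
Qed.

Lemma unitary_trC (U : unitary R n) :
  ((unitary_val U)^t* : 'M[R[i]^o]_n)
    \in [set U : 'M[R[i]^o]_n | (U : 'M[R[i]]_n) \is unitarymx].
Proof.
by apply/mem_set; rewrite /= trmxC_unitary; exact: set_mem (valP U).
Qed.

Definition unitaryV (U : unitary R n) : unitary R n :=
  exist _ ((unitary_val U)^t* : 'M[R[i]^o]_n) (unitary_trC U).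

Lemma unitary_valM (U V : unitary R n) :
  unitary_val (ltrans U V) = unitary_val U *m unitary_val V.
Proof. by []. Qed.

Lemma unitary_val_inj : injective (@unitary_val R n : unitary R n -> 'M[R[i]]_n).
Proof. exact: val_inj. Qed.

Lemma unitary_mulmxV (U : unitary R n) : unitary_val U *m (unitary_val U)^t* = 1%:M.
Proof. by apply/unitarymxP; exact: set_mem (valP U). Qed.

Lemma unitary_mulVmx (U : unitary R n) : (unitary_val U)^t* *m unitary_val U = 1%:M.
Proof. by apply: mulmx1C; exact: unitary_mulmxV. Qed.

(** [is_haar] speaks of images, and the preimage under translation by U is the image under
    translation by [unitaryV U]. *)
Lemma haar_preimage (mu : probability (unitary R n) R) (U : unitary R n)
    (A : set (unitary R n)) : is_haar mu -> measurable A ->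
  mu (ltrans U @^-1` A) = mu A.
Proof.
move=> hmu mA; rewrite -[RHS](hmu (unitaryV U)) //; congr (mu _).
apply/seteqP; split=> [M AM|_ [M AM <-]].
  exists (ltrans U M) => //; apply: unitary_val_inj.
  by rewrite !unitary_valM mulmxA unitary_mulVmx mul1mx.
rewrite /preimage /=; set V := ltrans _ _; suff -> : V = M by [].
apply: unitary_val_inj.
by rewrite !unitary_valM mulmxA unitary_mulmxV mul1mx.
Qed.

Lemma haar_integral (mu : probability (unitary R n) R) (U : unitary R n)
    (f : unitary R n -> R) : is_haar mu -> measurable_fun setT f ->
  mu.-integrable setT (EFin \o f) ->
  \int[mu]_M f (ltrans U M) = \int[mu]_M f M.
Proof.
move=> hmu mf intf; rewrite /Rintegral; congr fine.
have /measurable_EFinP mfE := mf.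
have mU := @measurable_ltrans U.
have mE (A : set (unitary R n)) : measurable A -> A `<=` setT ->
    mu A = pushforward mu (ltrans U) A.
  by move=> mA _; rewrite /pushforward haar_preimage.
rewrite [RHS](eq_measure_integral (pushforward mu (ltrans U)) mE).
rewrite integral_pushforward //.
rewrite preimage_setT.
apply/integrableP; split.
  by apply: measurableT_comp.
have /integrableP[_] := intf; apply: le_lt_trans.
rewrite [leRHS](eq_measure_integral (pushforward mu (ltrans U)) mE).
rewrite ge0_integral_pushforward //.
exact: measurableT_comp.
Qed.
End borel_unitary.

(** * Bounded random variables *)

Section bounded_real.
Context d (T : measurableType d) (R : realType) (mu : probability T R).
Implicit Types f g : T -> R.

(** Boundedness, unlike integrability, is stable under products, and all functions integrated over
    the group are bounded. It thus serves as the only integrability condition there. *)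
Definition bounded_measurable f :=
  measurable_fun setT f /\ exists B : R, forall x, `|f x| <= B.

Lemma bounded_measurable_integrable f :
  bounded_measurable f -> mu.-integrable setT (EFin \o f).
Proof.
move=> [mf [B fB]].
apply: (@le_integrable _ _ _ mu setT measurableT _ (EFin \o cst B)).
- exact/measurable_EFinP.
- by move=> x _ /=; rewrite lee_fin (le_trans (fB x)) // ler_norm.
- exact: (finite_measure_integrable_cst mu B measurableT).
Qed.

Lemma bounded_measurable_cst (c : R) : bounded_measurable (fun=> c).
Proof. by split; [exact: measurable_cst | exists `|c|]. Qed.

Lemma bounded_measurableD f g : bounded_measurable f -> bounded_measurable g ->
  bounded_measurable (fun x => f x + g x).
Proof.
move=> [mf [B fB]] [mg [B' gB]]; split; first exact: measurable_funD.
by exists (B + B') => x; rewrite (le_trans (ler_normD _ _)) // lerD.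
Qed.

Lemma bounded_measurableM f g : bounded_measurable f -> bounded_measurable g ->
  bounded_measurable (fun x => f x * g x).
Proof.
move=> [mf [B fB]] [mg [B' gB]]; split; first exact: measurable_funM.
by exists (B * B') => x; rewrite normrM ler_pM.
Qed.

Lemma bounded_measurableN f : bounded_measurable f ->
  bounded_measurable (fun x => - f x).
Proof.
move=> [mf [B fB]]; split; last by exists B => x; rewrite normrN.
exact: measurableT_comp.
Qed.

Lemma bounded_measurableB f g : bounded_measurable f -> bounded_measurable g ->
  bounded_measurable (fun x => f x - g x).
Proof. by move=> bf bg; apply: bounded_measurableD => //; exact: bounded_measurableN. Qed.

Lemma bounded_measurable_norm f : bounded_measurable f ->
  bounded_measurable (fun x => `|f x|).
Proof.
move=> [mf [B fB]]; split; last by exists B => x; rewrite normr_id.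
exact: measurableT_comp.
Qed.

Lemma Rintegral_probability_cst (c : R) : \int[mu]_x c = c.
Proof.
have m1 : mu setT = 1%E := probability_setT mu.
by rewrite Rintegral_cst // -[RHS]mulr1; congr (_ * _); exact: (congr1 fine m1).
Qed.

Lemma bounded_Rintegral_le f (B : R) : bounded_measurable f ->
  (forall x, `|f x| <= B) -> `|\int[mu]_x f x| <= B.
Proof.
move=> bf fB; have intf := bounded_measurable_integrable bf.
apply: (le_trans (le_normr_Rintegral measurableT intf)).
rewrite -[leRHS]Rintegral_probability_cst; apply: le_Rintegral => //.
- by apply: bounded_measurable_integrable; exact: bounded_measurable_norm.
- exact: (finite_measure_integrable_cst mu B measurableT).
Qed.
End bounded_real.

Section bounded_complex.
Context d (T : measurableType d) (R : realType) (mu : probability T R).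
Local Notation C := R[i].
Implicit Types f g : T -> C.

Definition bounded_cmeasurable f :=
  [/\ measurable_fun setT (fun x => complex.Re (f x)),
      measurable_fun setT (fun x => complex.Im (f x)) &
      exists B : R, forall x, `|f x| <= B%:C].

Definition cexp f : C :=
  (\int[mu]_x complex.Re (f x)) +i* (\int[mu]_x complex.Im (f x)).

Lemma bounded_cmeasurable_Re f : bounded_cmeasurable f ->
  bounded_measurable (fun x => complex.Re (f x)).
Proof.
move=> [mr mi [B fB]]; split=> //; exists B => x.
by rewrite -lecR (le_trans (normc_ge_Re _)).
Qed.

Lemma bounded_cmeasurable_Im f : bounded_cmeasurable f ->
  bounded_measurable (fun x => complex.Im (f x)).
Proof.
move=> [mr mi [B fB]]; split=> //; exists B => x.
by rewrite -lecR (le_trans (Im_le_norm _)).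
Qed.

Lemma bounded_cmeasurable_cst (c : C) : bounded_cmeasurable (fun=> c).
Proof.
split; [exact: measurable_cst|exact: measurable_cst|].
by exists (Normc.normc c) => x; rewrite normc_def; case: c.
Qed.

Lemma Re_mul (x y : C) :
  complex.Re (x * y) = complex.Re x * complex.Re y - complex.Im x * complex.Im y.
Proof. by case: x => a b; case: y => c e. Qed.

Lemma Im_mul (x y : C) :
  complex.Im (x * y) = complex.Re x * complex.Im y + complex.Im x * complex.Re y.
Proof. by case: x => a b; case: y => c e. Qed.

Lemma Re_conj (x : C) : complex.Re (Num.conj x) = complex.Re x.
Proof. by case: x. Qed.

Lemma Im_conj (x : C) : complex.Im (Num.conj x) = - complex.Im x.
Proof. by case: x. Qed.

Lemma bounded_cmeasurableD f g : bounded_cmeasurable f -> bounded_cmeasurable g ->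
  bounded_cmeasurable (fun x => f x + g x).
Proof.
move=> [mr mi [B fB]] [mr' mi' [B' gB]]; split.
- under eq_fun do rewrite raddfD; exact: measurable_funD.
- under eq_fun do rewrite raddfD; exact: measurable_funD.
- by exists (B + B') => x; rewrite (le_trans (ler_normD _ _)) // rmorphD lerD.
Qed.

Lemma bounded_cmeasurableM f g : bounded_cmeasurable f -> bounded_cmeasurable g ->
  bounded_cmeasurable (fun x => f x * g x).
Proof.
move=> [mr mi [B fB]] [mr' mi' [B' gB]]; split.
- under eq_fun do rewrite Re_mul; apply: measurable_funB; exact: measurable_funM.
- under eq_fun do rewrite Im_mul; apply: measurable_funD; exact: measurable_funM.
- by exists (B * B') => x; rewrite normrM rmorphM ler_pM.
Qed.

Lemma bounded_cmeasurableZ (c : C) f : bounded_cmeasurable f ->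
  bounded_cmeasurable (fun x => c * f x).
Proof. by apply: bounded_cmeasurableM; exact: bounded_cmeasurable_cst. Qed.

Lemma bounded_cmeasurableN f : bounded_cmeasurable f ->
  bounded_cmeasurable (fun x => - f x).
Proof.
move=> /(bounded_cmeasurableZ (-1)); congr bounded_cmeasurable.
by apply/funext => x; rewrite mulN1r.
Qed.

Lemma bounded_cmeasurable_sum I (r : seq I) (P : pred I) (f : I -> T -> C) :
  (forall i, P i -> bounded_cmeasurable (f i)) ->
  bounded_cmeasurable (fun x => \sum_(i <- r | P i) f i x).
Proof.
move=> bf; elim: r => [|i r IH].
  under eq_fun do rewrite big_nil; exact: bounded_cmeasurable_cst.
under eq_fun do rewrite big_cons.
case Pi : (P i) => //.
by apply: bounded_cmeasurableD => //; exact: bf.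
Qed.

Lemma bounded_cmeasurable_conj f : bounded_cmeasurable f ->
  bounded_cmeasurable (fun x => Num.conj (f x)).
Proof.
move=> [mr mi [B fB]]; split.
- by under eq_fun do rewrite Re_conj.
- under eq_fun do rewrite Im_conj.
  exact: measurableT_comp.
- by exists B => x; rewrite norm_conjC.
Qed.

Lemma bounded_cmeasurable_real (f : T -> R) : bounded_measurable f ->
  bounded_cmeasurable (fun x => (f x)%:C).
Proof.
move=> [mf [B fB]]; split; [exact: mf | exact: (measurable_cst (0 : R)) |].
by exists B => x; rewrite normc_def /= expr0n addr0 sqrtr_sqr lecR.
Qed.

Lemma bounded_cmeasurableB f g : bounded_cmeasurable f -> bounded_cmeasurable g ->
  bounded_cmeasurable (fun x => f x - g x).
Proof. by move=> bf bg; apply: bounded_cmeasurableD => //; exact: bounded_cmeasurableN. Qed.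

Lemma eq_cexp f g : (forall x, f x = g x) -> cexp f = cexp g.
Proof. by move=> fg; congr cexp; apply/funext. Qed.

Lemma cexpD f g : bounded_cmeasurable f -> bounded_cmeasurable g ->
  cexp (fun x => f x + g x) = cexp f + cexp g.
Proof.
move=> bf bg; rewrite /cexp.
rewrite -[X in _ = X]/(_ +i* _); congr (_ +i* _).
  by under eq_Rintegral do rewrite raddfD; rewrite RintegralD //;
    apply: bounded_measurable_integrable; exact: bounded_cmeasurable_Re.
by under eq_Rintegral do rewrite raddfD; rewrite RintegralD //;
    apply: bounded_measurable_integrable; exact: bounded_cmeasurable_Im.
Qed.

Lemma cexpZ (c : C) f : bounded_cmeasurable f ->
  cexp (fun x => c * f x) = c * cexp f.
Proof.
move=> bf; rewrite /cexp; case: c => a b.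
have br := bounded_cmeasurable_Re bf; have bi := bounded_cmeasurable_Im bf.
have intr := bounded_measurable_integrable mu br.
have inti := bounded_measurable_integrable mu bi.
have intZ (g : T -> R) (c : R) : bounded_measurable g ->
    mu.-integrable setT (EFin \o (fun x => c * g x)).
  move=> bg; apply: bounded_measurable_integrable.
  by apply: bounded_measurableM => //; exact: bounded_measurable_cst.
rewrite -[X in _ = X]/(_ +i* _); congr (_ +i* _).
  under eq_Rintegral do rewrite Re_mul.
  by rewrite RintegralB // ?RintegralZl //=; exact: intZ.
under eq_Rintegral do rewrite Im_mul.
by rewrite RintegralD // ?RintegralZl //=; exact: intZ.
Qed.

Lemma cexpN f : bounded_cmeasurable f -> cexp (fun x => - f x) = - cexp f.
Proof.
move=> bf; rewrite -mulN1r -cexpZ //; apply: eq_cexp => x; by rewrite mulN1r.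
Qed.

Lemma cexpB f g : bounded_cmeasurable f -> bounded_cmeasurable g ->
  cexp (fun x => f x - g x) = cexp f - cexp g.
Proof. by move=> bf bg; rewrite cexpD ?cexpN //; exact: bounded_cmeasurableN. Qed.

Lemma cexp_cst (c : C) : cexp (fun=> c) = c.
Proof. by rewrite /cexp !Rintegral_probability_cst; case: c. Qed.

Lemma cexp_sum I (r : seq I) (P : pred I) (f : I -> T -> C) :
  (forall i, P i -> bounded_cmeasurable (f i)) ->
  cexp (fun x => \sum_(i <- r | P i) f i x) = \sum_(i <- r | P i) cexp (f i).
Proof.
move=> bf; elim: r => [|i r IH].
  by rewrite big_nil -[RHS](cexp_cst 0); apply: eq_cexp => x; rewrite big_nil.
rewrite big_cons -IH; case Pi : (P i); last first.
  by apply: eq_cexp => x; rewrite big_cons Pi.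
rewrite -cexpD; [|exact: bf|exact: bounded_cmeasurable_sum].
by apply: eq_cexp => x; rewrite big_cons Pi.
Qed.

Lemma cexp_conj f : bounded_cmeasurable f ->
  cexp (fun x => Num.conj (f x)) = Num.conj (cexp f).
Proof.
move=> bf; rewrite /cexp -[X in _ = X]/(_ +i* _); congr (_ +i* _).
  by apply: eq_Rintegral => x _; rewrite Re_conj.
rewrite -mulN1r -RintegralZl //; last first.
  by apply: bounded_measurable_integrable; exact: bounded_cmeasurable_Im.
by apply: eq_Rintegral => x _; rewrite Im_conj mulN1r.
Qed.

Lemma cexp_real (f : T -> R) : cexp (fun x => (f x)%:C) = (\int[mu]_x f x)%:C.
Proof. by rewrite /cexp /= Rintegral_probability_cst. Qed.

Lemma cexp_ge0 f : (forall x, 0 <= f x) -> 0 <= cexp f.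
Proof.
move=> f0; rewrite lecE /=; apply/andP; split.
  rewrite (@eq_Rintegral _ _ _ mu setT (cst 0)) ?Rintegral_probability_cst // => x _.
  by have := f0 x; rewrite lecE => /andP[/eqP].
apply: Rintegral_ge0 => x _; by have := f0 x; rewrite lecE => /andP[].
Qed.

(** Real and imaginary parts are bounded separately, which costs a factor 2 that is harmless
    below. *)
Lemma cexp_bound f (B : R) : bounded_cmeasurable f ->
  (forall x, `|f x| <= B%:C) -> `|cexp f| <= (2 * B)%:C.
Proof.
move=> bf fB; rewrite [cexp f]complexE.
rewrite (le_trans (ler_normD _ _)) // normrM.
have -> : `|'i%C| = 1 :> C by rewrite normc_def /= expr0n expr1n add0r sqrtr1.
rewrite mul1r mulrDl mul1r rmorphD lerD //= normc_def /= expr0n addr0 sqrtr_sqr lecR.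
  apply: bounded_Rintegral_le (bounded_cmeasurable_Re bf) _ => x.
  by rewrite -lecR (le_trans (normc_ge_Re _)).
apply: bounded_Rintegral_le (bounded_cmeasurable_Im bf) _ => x.
by rewrite -lecR (le_trans (Im_le_norm _)).
Qed.

(** A substitute for the Cauchy-Schwarz inequality: expand 0 <= E |w f - conj g|^2, where w has
    modulus 1 and turns E [f g] into its modulus. *)
Lemma cexp_amgm f g : bounded_cmeasurable f -> bounded_cmeasurable g ->
  `|cexp (fun x => f x * g x)| * 2 <=
  cexp (fun x => f x * Num.conj (f x)) + cexp (fun x => g x * Num.conj (g x)).
Proof.
move=> bf bg; set c := cexp (fun x => _ * g x).
have [w w1 wc] : exists2 w : C, w * Num.conj w = 1 & w * c = `|c|.
  have [->|c0] := eqVneq c 0; first by exists 1; rewrite ?mulr0 ?normr0 // conjC1 mulr1.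
  exists (Num.conj c / `|c|).
    rewrite rmorphM fmorphV /= conjCK (CrealP (normr_real c)) mulrACA -invfM -normCKC.
    by rewrite -expr2 mulfV // expf_neq0 // normr_eq0.
  by rewrite mulrAC -normCKC expr2 mulfK // normr_eq0.
have bcf := bounded_cmeasurable_conj bf; have bcg := bounded_cmeasurable_conj bg.
have bff := bounded_cmeasurableM bf bcf; have bgg := bounded_cmeasurableM bg bcg.
have bfg := bounded_cmeasurableM bf bg; have bcfg := bounded_cmeasurable_conj bfg.
have : 0 <= cexp (fun x => (f x * Num.conj (f x) + g x * Num.conj (g x)) -
    (w * (f x * g x) + Num.conj w * Num.conj (f x * g x))).
  apply: cexp_ge0 => x.
  suff -> : f x * Num.conj (f x) + g x * Num.conj (g x) -
    (w * (f x * g x) + Num.conj w * Num.conj (f x * g x)) =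
    `|w * f x - Num.conj (g x)| ^+ 2 by rewrite exprn_ge0.
  rewrite normCK rmorphB !rmorphM /= conjCK; ring: w1.
rewrite cexpB; [|exact: bounded_cmeasurableD|by apply: bounded_cmeasurableD; exact: bounded_cmeasurableZ].
rewrite !cexpD ?cexpZ //; try exact: bounded_cmeasurableZ.
rewrite cexp_conj // -/c -[Num.conj w * _]rmorphM wc /= conj_normC.
by rewrite subr_ge0 mulrDr mulr1.
Qed.
End bounded_complex.

(** * Gradients and integration by parts *)

Section gradients.
Variables (R : realType) (n : nat).
Local Notation C := R[i].
Local Notation UR := (unitary R n).

(* (1 + (w - 1) P) with |w| = 1 runs over a one-parameter group of unitary
   matrices; [infinitesimal P k F] says that F = O(|w - 1| ^ k) along it. *)
Definition infinitesimal (P : 'M[C]_n) (k : nat) (F : C -> UR -> UR -> C) : Prop :=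
  exists B : R, forall w (M M' : UR), `|w| = 1 ->
    unitary_val M' = (1%:M + (w - 1) *: P) *m unitary_val M ->
    `|F w M M'| <= B%:C * `|w - 1| ^+ k.

Section infinitesimal.
Variable P : 'M[C]_n.
Implicit Types F G : C -> UR -> UR -> C.

Lemma infinitesimal_ge0 k F : infinitesimal P k F ->
  exists2 B : R, 0 <= B & forall w (M M' : UR), `|w| = 1 ->
    unitary_val M' = (1%:M + (w - 1) *: P) *m unitary_val M ->
    `|F w M M'| <= B%:C * `|w - 1| ^+ k.
Proof.
move=> [B FB]; exists `|B| => // w M M' w1 MM'; apply: le_trans (FB w M M' w1 MM') _.
by rewrite ler_wpM2r ?exprn_ge0 // lecR ler_norm.
Qed.

Lemma infinitesimalD k F G : infinitesimal P k F -> infinitesimal P k G ->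
  infinitesimal P k (fun w M M' => F w M M' + G w M M').
Proof.
move=> [B FB] [B' GB]; exists (B + B') => w M M' w1 MM'.
by rewrite (le_trans (ler_normD _ _)) // rmorphD mulrDl lerD ?FB ?GB.
Qed.

Lemma infinitesimalM j k F G : infinitesimal P j F -> infinitesimal P k G ->
  infinitesimal P (j + k) (fun w M M' => F w M M' * G w M M').
Proof.
move=> [B FB] [B' GB]; exists (B * B') => w M M' w1 MM'.
by rewrite normrM rmorphM exprD mulrACA ler_pM ?FB ?GB.
Qed.

Lemma infinitesimal_dist k : infinitesimal P k (fun w _ _ => (w - 1) ^+ k).
Proof. by exists 1 => w M M' _ _; rewrite normrX mul1r. Qed.

Lemma infinitesimal_le j k F : (j <= k)%N -> infinitesimal P k F ->
  infinitesimal P j F.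
Proof.
move=> jk /infinitesimal_ge0[B B0 FB]; exists (B * 2 ^+ (k - j)) => w M M' w1 MM'.
apply: le_trans (FB w M M' w1 MM') _.
rewrite -(subnK jk) exprD mulrA addnK rmorphM ler_wpM2r ?exprn_ge0 //.
rewrite ler_wpM2l ?ler0c // rmorphXn rmorph_nat lerXn2r ?nnegrE // ?ler0n //.
by rewrite (le_trans (ler_normB _ _)) // w1 normr1.
Qed.

Lemma infinitesimal0l (f : UR -> C) : bounded_cmeasurable f ->
  infinitesimal P 0 (fun _ M _ => f M).
Proof. by move=> [_ _ [B fB]]; exists B => w M M' _ _; rewrite mulr1. Qed.

Lemma infinitesimal0r (f : UR -> C) : bounded_cmeasurable f ->
  infinitesimal P 0 (fun _ _ M' => f M').
Proof. by move=> [_ _ [B fB]]; exists B => w M M' _ _; rewrite mulr1. Qed.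

Lemma eq_infinitesimal k F G : infinitesimal P k F ->
  (forall w M M', `|w| = 1 -> F w M M' = G w M M') -> infinitesimal P k G.
Proof.
move=> [B FB] FG; exists B => w M M' w1 MM'; rewrite -FG //; exact: FB.
Qed.

Lemma infinitesimalZ k (c : C) F : infinitesimal P k F ->
  infinitesimal P k (fun w M M' => c * F w M M').
Proof.
move=> FB; have := infinitesimalM (infinitesimal0l (bounded_cmeasurable_cst _ c)) FB.
by rewrite add0n.
Qed.
End infinitesimal.

Definition hermitian_projection (P : 'M[C]_n) := P^t* = P /\ P *m P = P.

(* [Phi] is the gradient of [f]: the derivative of [f] at [M] along [A M] is
   the trace of [A *m Phi M], for every matrix [A]. *)
Definition has_gradient (f : UR -> C) (Phi : UR -> 'M[C]_n) : Prop :=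
  [/\ bounded_cmeasurable f, forall i j, bounded_cmeasurable (fun M => Phi M i j) &
      forall P, hermitian_projection P -> infinitesimal P 2
        (fun w M M' => f M' - f M - (w - 1) * \tr (P *m Phi M))].

Lemma bounded_cmeasurable_trmul (A : 'M[C]_n) (Phi : UR -> 'M[C]_n) :
  (forall i j, bounded_cmeasurable (fun M => Phi M i j)) ->
  bounded_cmeasurable (fun M => \tr (A *m Phi M)).
Proof.
move=> bP; apply: bounded_cmeasurable_sum => i _.
under eq_fun do rewrite mxE.
by apply: bounded_cmeasurable_sum => j _; exact: bounded_cmeasurableZ.
Qed.

Lemma has_gradient_lipschitz f Phi P : has_gradient f Phi ->
  hermitian_projection P -> infinitesimal P 1 (fun _ M M' => f M' - f M).
Proof.
move=> [bf bP fP] hP.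
have h1 := infinitesimal_le (leqnSn 1) (fP P hP).
have h2 := infinitesimalM (infinitesimal_dist P 1)
  (infinitesimal0l P (bounded_cmeasurable_trmul P bP)).
apply: (eq_infinitesimal (infinitesimalD h1 h2)) => w M M' _.
by rewrite expr1 subrK.
Qed.

Lemma has_gradient_cst c : has_gradient (fun=> c) (fun=> 0).
Proof.
split; [exact: bounded_cmeasurable_cst| |].
  by move=> i j; under eq_fun do rewrite mxE; exact: bounded_cmeasurable_cst.
move=> P _; exists 0 => w M M' _ _.
by rewrite mulmx0 mxtrace0 mulr0 subr0 subrr normr0 mul0r.
Qed.

Lemma has_gradientD f g Phi Psi : has_gradient f Phi -> has_gradient g Psi ->
  has_gradient (fun M => f M + g M) (fun M => Phi M + Psi M).
Proof.
move=> [bf bP fP] [bg bQ gQ]; split; [exact: bounded_cmeasurableD| |].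
  by move=> i j; under eq_fun do rewrite mxE; exact: bounded_cmeasurableD.
move=> P hP; apply: (eq_infinitesimal (infinitesimalD (fP P hP) (gQ P hP))) => w M M' _.
by rewrite mulmxDr mxtraceD; ring.
Qed.

Lemma has_gradientM f g Phi Psi : has_gradient f Phi -> has_gradient g Psi ->
  has_gradient (fun M => f M * g M) (fun M => g M *: Phi M + f M *: Psi M).
Proof.
move=> Hf Hg; have [bf bP fP] := Hf; have [bg bQ gQ] := Hg.
split; [exact: bounded_cmeasurableM| |].
  move=> i j; under eq_fun do rewrite !mxE.
  by apply: bounded_cmeasurableD; exact: bounded_cmeasurableM.
move=> P hP.
(* f' g' - f g = (f' - f) g' + f (g' - g), primes denoting values at M'. [h3] accounts for replacing
   g' by g in the first-order term, an error of second order. *)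
have h1 := infinitesimalM (fP P hP) (infinitesimal0r P bg).
have h2 := infinitesimalM (infinitesimal0l P bf) (gQ P hP).
have h3 := infinitesimalM (infinitesimalM (infinitesimal_dist P 1)
  (infinitesimal0l P (bounded_cmeasurable_trmul P bP))) (has_gradient_lipschitz Hg hP).
apply: (eq_infinitesimal (infinitesimalD (infinitesimalD h1 h2) h3)) => w M M' _.
rewrite mulmxDr mxtraceD -!scalemxAr !mxtraceZ expr1; ring.
Qed.

Lemma has_gradientZ c f Phi : has_gradient f Phi ->
  has_gradient (fun M => c * f M) (fun M => c *: Phi M).
Proof.
move=> hf; have := has_gradientM (has_gradient_cst c) hf.
by under [X in has_gradient _ X]eq_fun do rewrite scaler0 add0r.
Qed.

Lemma has_gradient_sum I (r : seq I) (f : I -> UR -> C) Phi :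
  (forall i, has_gradient (f i) (Phi i)) ->
  has_gradient (fun M => \sum_(i <- r) f i M) (fun M => \sum_(i <- r) Phi i M).
Proof.
move=> fP; elim: r => [|i r IH].
  under eq_fun do rewrite big_nil.
  by under [X in has_gradient _ X]eq_fun do rewrite big_nil; exact: has_gradient_cst.
under eq_fun do rewrite big_cons.
by under [X in has_gradient _ X]eq_fun do rewrite big_cons; exact: has_gradientD.
Qed.

Lemma mxtrace_trC (A : 'M[C]_n) : \tr (A^t*) = Num.conj (\tr A).
Proof. by rewrite /mxtrace rmorph_sum; apply: eq_bigr => i _; rewrite !mxE. Qed.

Lemma trC_mul (A B : 'M[C]_n) : (A *m B)^t* = B^t* *m A^t*.
Proof. by rewrite trmx_mul map_mxM. Qed.

(** The sign comes from the circle: for |w| = 1, conj (w - 1) = -(w - 1) + conj w (w - 1)^2, and the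
    last term is of second order. *)
Lemma has_gradient_conj f Phi : has_gradient f Phi ->
  has_gradient (fun M => Num.conj (f M)) (fun M => - (Phi M)^t*).
Proof.
move=> [bf bP fP]; split; [exact: bounded_cmeasurable_conj| |].
  move=> i j; under eq_fun do rewrite !mxE.
  by apply: bounded_cmeasurableN; exact: bounded_cmeasurable_conj.
move=> P hP.
have [B FB] := fP P hP.
have h1 : infinitesimal P 2 (fun w M M' =>
    Num.conj (f M' - f M - (w - 1) * \tr (P *m Phi M))).
  by exists B => w M M' w1 MM'; rewrite norm_conjC FB.
have h2 := infinitesimalM (infinitesimal_dist P 2)
  (infinitesimal0l P (bounded_cmeasurable_conj (bounded_cmeasurable_trmul P bP))).
have h3 : infinitesimal P 0 (fun w _ _ => Num.conj w).
  by exists 1 => w M M' w1 _; rewrite norm_conjC w1 mulr1.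
have h4 := infinitesimalM h3 h2.
apply: (eq_infinitesimal (infinitesimalD h1 h4)) => w M M' w1 /=.
have -> : \tr (P *m - (Phi M)^t*) = - Num.conj (\tr (P *m Phi M)).
  by rewrite mulmxN raddfN /= -mxtrace_trC trC_mul (proj1 hP) mxtrace_mulC.
have ww : w * Num.conj w = 1 by rewrite -normCK w1 expr1n.
rewrite !rmorphB rmorphM rmorphB rmorph1 /=; ring: ww.
Qed.

Lemma bounded_cmeasurable_entry i j :
  bounded_cmeasurable (fun M : UR => unitary_val M i j).
Proof.
split; [exact: measurable_Re_entry|exact: measurable_Im_entry|].
exists 1 => M; have /matrixP/(_ i i) := unitary_mulmxV M.
rewrite !mxE eqxx (bigD1 j) //= !mxE -normCK => E.
rewrite -(@ler_pXn2r _ 2) ?nnegrE // expr1n -[leRHS]E lerDl.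
by apply: sumr_ge0 => k _; rewrite !mxE mul_conjC_ge0.
Qed.

Lemma has_gradient_entry i j : has_gradient (fun M : UR => unitary_val M i j)
  (fun M => unitary_val M *m delta_mx j i).
Proof.
split; [exact: bounded_cmeasurable_entry| |].
  move=> k l; under eq_fun do rewrite mxE.
  apply: bounded_cmeasurable_sum => m _; under eq_fun do rewrite mulrC.
  by apply: bounded_cmeasurableZ; exact: bounded_cmeasurable_entry.
move=> P _; exists 0 => w M M' _ ->.
rewrite mulmxDl mul1mx -scalemxAl !mxE mulmxA.
have -> : \tr (P *m unitary_val M *m delta_mx j i) = (P *m unitary_val M) i j.
  rewrite mxtrace_mulC /mxtrace (bigD1 j) //= big1 ?addr0 => [|k kj].
    rewrite mxE (bigD1 i) //= big1 ?addr0 => [|k ki].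
      by rewrite mxE !eqxx mul1r.
    by rewrite mxE (negbTE ki) andbF mul0r.
  by rewrite mxE big1 // => l _; rewrite mxE (negbTE kj) mul0r.
rewrite mxE (_ : _ - _ = 0) ?normr0 ?mul0r //; set s := \sum__ _; ring.
Qed.

Section haar.
Variable mu : probability UR R.
Hypothesis hmu : is_haar mu.

Lemma haar_cexp (U : UR) (f : UR -> C) : bounded_cmeasurable f ->
  cexp mu (fun M => f (ltrans U M)) = cexp mu f.
Proof.
move=> bf; rewrite /cexp; congr (_ +i* _).
- have br := bounded_cmeasurable_Re bf.
  exact: (haar_integral U hmu (proj1 br) (bounded_measurable_integrable mu br)).
- have bi := bounded_cmeasurable_Im bf.
  exact: (haar_integral U hmu (proj1 bi) (bounded_measurable_integrable mu bi)).
Qed.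

Lemma hermitian_projection_unitary (P : 'M[C]_n) (w : C) :
  hermitian_projection P -> `|w| = 1 ->
  (1%:M + (w - 1) *: P : 'M[R[i]^o]_n)
    \in [set U : 'M[R[i]^o]_n | (U : 'M[R[i]]_n) \is unitarymx].
Proof.
move=> [Ph PP] w1; apply/mem_set => /=; apply/unitarymxP.
have ww : w * Num.conj w = 1 by rewrite -normCK w1 expr1n.
rewrite linearD linearZ /= map_mxD map_mxZ trmx1 map_mx1 Ph.
rewrite mulmxDl mul1mx mulmxDr mulmx1 -scalemxAl -scalemxAr PP scalerA -addrA.
rewrite -[RHS]addr0; congr (_ + _); rewrite addrA -!scalerDl.
rewrite rmorphB rmorph1 /=.
have key (x : C) : x - 1 + (w - 1) + (w - 1) * (x - 1) = w * x - 1 by ring.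
by rewrite [X in X *: _](key (Num.conj w)) ww subrr scale0r.
Qed.

Lemma small_eq0 (x B : R) : 0 <= x -> (forall k : R, 1 <= k -> x * k <= B) -> x = 0.
Proof.
move=> x0 xB; apply/eqP; rewrite eq_le x0 andbT leNgt; apply/negP => xp.
have := xB (1 + `|B| / x); rewrite lerDl divr_ge0 // => /(_ isT).
rewrite mulrDr mulr1 mulrCA mulfV ?mulr1 ?gt_eqF // => h.
have := ler_norm B; lra.
Qed.

(** By invariance the means of f at M and at (1 + (w - 1) P) M agree, so (w - 1) E [tr (P Phi)] =
    O(|w - 1|^2). Dividing by w - 1 and letting w tend to 1 gives 0. *)
Lemma haar_gradient_projection f Phi P : has_gradient f Phi ->
  hermitian_projection P -> cexp mu (fun M => \tr (P *m Phi M)) = 0.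
Proof.
move=> [bf bP fP] hP; have [B FB] := fP P hP.
have btr := bounded_cmeasurable_trmul P bP.
set c := cexp _ _; apply/eqP; rewrite -normr_eq0; apply/eqP.
have cE : `|c| = (Normc.normc c)%:C by rewrite normc_def; case: (c).
rewrite cE; congr (_%:C).
apply: (@small_eq0 _ (4 * B)); first by rewrite -ler0c -cE normr_ge0.
move=> k k1.
(* Rational points of the circle tending to 1: w - 1 = 2i / conj z, so |w - 1| |z| = 2, and |z| >= k
   is arbitrarily large. *)
pose z : C := k +i* 1; pose w := z / Num.conj z.
have z0 : z != 0 by rewrite eq_complex negb_and oner_neq0 orbT.
have zc0 : Num.conj z != 0 by rewrite conjC_eq0.
have w1 : `|w| = 1 by rewrite normrM normfV norm_conjC mulfV // normr_eq0.
have wE : w - 1 = (2%:R * 'i%C) / Num.conj z.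
  by rewrite /w -[X in _ - X](mulfV zc0) -mulrBl; congr (_ / _); apply/eqP;
    rewrite eq_complex /=; apply/andP; split; apply/eqP; ring.
pose d := `|w - 1|.
have dn : d = (Normc.normc (w - 1))%:C by rewrite /d normc_def; case: (w - 1).
have dE : d * `|z| = 2.
  rewrite /d wE normrM normfV norm_conjC divfK ?normr_eq0 //.
  by rewrite normrM normr_nat [ `|'i%C|]normc_def /= expr0n expr1n add0r sqrtr1 mulr1.
have d0 : 0 < d.
  rewrite lt0r normr_ge0 andbT; apply/eqP => d0; move: dE; rewrite d0 mul0r => /eqP.
  by rewrite eq_sym pnatr_eq0.
pose U : UR := exist _ (1%:M + (w - 1) *: P : 'M[R[i]^o]_n)
  (hermitian_projection_unitary hP w1).
have bU : bounded_cmeasurable (fun M => f (ltrans U M)).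
  have mU := @measurable_ltrans R n U; case: bf => mr mi [b fb]; split.
  - exact: (measurableT_comp mr mU).
  - exact: (measurableT_comp mi mU).
  - by exists b.
have : `|cexp mu (fun M => f (ltrans U M) - f M - (w - 1) * \tr (P *m Phi M))| <=
    (2 * (B * Normc.normc (w - 1) ^+ 2))%:C.
  apply: cexp_bound.
    apply: bounded_cmeasurableB; first exact: bounded_cmeasurableB.
    exact: bounded_cmeasurableZ.
  move=> M; apply: le_trans (FB w M (ltrans U M) w1 _) _ => //.
  by rewrite rmorphM rmorphXn /= -dn.
rewrite cexpB ?cexpB ?haar_cexp ?subrr ?sub0r //; first last.
- exact: bounded_cmeasurableZ.
- exact: bounded_cmeasurableB.
rewrite cexpZ // normrN normrM -/c -/d rmorphM rmorphM rmorphXn /= -dn => h.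
have {}h : `|c| * `|z| <= 4%:R * B%:C.
  rewrite -(ler_pM2l d0) (le_trans (_ : _ <= (d * `|c|) * `|z|)) ?mulrA //.
  apply: le_trans (ler_wpM2r (normr_ge0 z) h) _.
  rewrite le_eqVlt; apply/orP; left; apply/eqP; rewrite rmorph_nat.
  by rewrite -[LHS]mulr1 -[RHS]mulr1; ring: dE.
rewrite -lecR !rmorphM /= -cE rmorph_nat; apply: le_trans h.
apply: ler_wpM2l => //; rewrite (le_trans _ (normc_ge_Re z)) //= lecR ler_norm //.
Qed.

Lemma hermitian_projection_outer (c : C) (u : 'cV[C]_n) : c != 0 -> Num.conj c = c ->
  u^t* *m u = c%:M -> hermitian_projection (c^-1 *: (u *m u^t*)).
Proof.
move=> c0 cr uc; split.
  by rewrite linearZ /= map_mxZ trmx_mul map_mxM trmxCK /= fmorphV /= cr.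
rewrite -scalemxAl -scalemxAr mulmxA -[X in X *m _]mulmxA uc scalerA.
by rewrite mul_mx_scalar -scalemxAl scalerA mulfVK // mulrC.
Qed.

Lemma trC_delta m (i : 'I_n) (j : 'I_m) : (delta_mx i j : 'M[C]_(n, m))^t* = delta_mx j i.
Proof. by rewrite trmx_delta map_delta_mx. Qed.

Lemma mxtrace_delta_mul (i j : 'I_n) (A : 'M[C]_n) : \tr (delta_mx i j *m A) = A j i.
Proof.
rewrite /mxtrace (bigD1 i) //= big1 ?addr0 => [|k ki].
  rewrite mxE (bigD1 j) //= big1 ?addr0 => [|k kj]; first by rewrite mxE !eqxx mul1r.
  by rewrite mxE (negbTE kj) andbF mul0r.
by rewrite mxE big1 // => l _; rewrite mxE (negbTE ki) mul0r.
Qed.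

(** Polarization of [haar_gradient_projection]: projections onto basis vectors kill the diagonal of
    the mean gradient N, and those onto e_i + w e_j give w N_ij + conj w N_ji = 0. The choices w = 1
    and w = i separate the two entries. *)
Lemma haar_gradient f Phi i j : has_gradient f Phi ->
  cexp mu (fun M => Phi M i j) = 0.
Proof.
move=> hf; have [bf bP fP] := hf.
pose N k l := cexp mu (fun M => Phi M k l); rewrite -/(N i j).
have diag k : N k k = 0.
  pose u : 'cV[C]_n := delta_mx k ord0.
  have hP : hermitian_projection (1^-1 *: (u *m u^t*)).
    apply: hermitian_projection_outer; rewrite ?oner_eq0 ?conjC1 // trC_delta mul_delta_mx.
    by apply/matrixP => a b; rewrite !ord1 !mxE !eqxx.
  rewrite -(haar_gradient_projection hf hP); apply: eq_cexp => M.
  by rewrite invr1 scale1r trC_delta mul_delta_mx mxtrace_delta_mul.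
have [->|ij] := eqVneq i j; first exact: diag.
have polar w : `|w| = 1 -> w * N i j + Num.conj w * N j i = 0.
  move=> w1; have ww : Num.conj w * w = 1 by rewrite -normCKC w1 expr1n.
  pose u : 'cV[C]_n := delta_mx i ord0 + w *: delta_mx j ord0.
  have uC : u^t* = delta_mx ord0 i + Num.conj w *: delta_mx ord0 j.
    by rewrite /u linearD linearZ /= map_mxD map_mxZ !trC_delta.
  have hP : hermitian_projection (2%:R^-1 *: (u *m u^t*)).
    apply: hermitian_projection_outer; rewrite ?pnatr_eq0 ?conjC_nat //.
    rewrite uC /u mulmxDl !mulmxDr -!scalemxAl -!scalemxAr !mul_delta_mx_cond scalerA ww.
    rewrite (eq_sym j) (negbTE ij) !eqxx !mulr0n !scaler0 addr0 add0r mulr1n scale1r.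
    by apply/matrixP => a b; rewrite !ord1 !mxE !eqxx.
  have := haar_gradient_projection hf hP.
  rewrite (@eq_cexp _ _ _ _ _ (fun M => 2^-1 * (Phi M i i + Phi M j j) +
      (2^-1 * w * Phi M i j + 2^-1 * Num.conj w * Phi M j i))); last first.
    move=> M; rewrite uC /u mulmxDl !mulmxDr -!scalemxAl -!scalemxAr !mul_delta_mx.
    rewrite scalerA [w * _]mulrC ww scale1r scalemxAl -scalemxAl mxtraceZ !mulmxDl.
    by rewrite -!scalemxAl !mxtraceD !mxtraceZ !mxtrace_delta_mul; ring.
  rewrite cexpD; last first.
  - by apply: bounded_cmeasurableD; exact: bounded_cmeasurableZ.
  - by apply: bounded_cmeasurableZ; exact: bounded_cmeasurableD.
  rewrite cexpZ; last exact: bounded_cmeasurableD.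
  rewrite cexpD // -/(N i i) -/(N j j) !diag addr0 mulr0 add0r.
  rewrite cexpD ?cexpZ; try exact: bounded_cmeasurableZ; try exact: bP.
  rewrite -/(N i j) -/(N j i) -!mulrA -mulrDr => /eqP.
  by rewrite mulf_eq0 invr_eq0 pnatr_eq0 /= => /eqP.
have i1 : `|'i%C| = 1 :> C by rewrite normc_def /= expr0n expr1n add0r sqrtr1.
have h1 : N i j + N j i = 0.
  by have := polar 1 (normr1 _); rewrite conjC1 !mul1r.
have h2 : N i j - N j i = 0.
  have := polar _ i1; have -> : Num.conj 'i%C = - 'i%C :> C.
    by apply/eqP; rewrite eq_complex /= oppr0 !eqxx.
  rewrite mulNr -mulrBr => /eqP; rewrite mulf_eq0 => /orP[/eqP i0|/eqP //].
  by move: i1; rewrite i0 normr0 => /eqP; rewrite eq_sym oner_eq0.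
have : N i j * 2 = 0.
  by rewrite mulr_natr mulr2n -[RHS]addr0 -{1}h1 -h2; ring.
by move/eqP; rewrite mulf_eq0 pnatr_eq0 orbF => /eqP.
Qed.

Lemma delta_mul_row (j i : 'I_n) (A : 'M[C]_n) :
  delta_mx j i *m A = \sum_r A i r *: delta_mx j r.
Proof.
apply/matrixP => a b; rewrite mxE (bigD1 i) //= big1 ?addr0 => [|k ki]; last first.
  by rewrite mxE (negbTE ki) andbF mul0r.
rewrite summxE (bigD1 b) //= big1 ?addr0 => [|k kb]; last first.
  by rewrite !mxE (eq_sym b) (negbTE kb) andbF mulr0.
by rewrite !mxE !eqxx mulrC.
Qed.

Lemma mul_delta_col (j i : 'I_n) (A : 'M[C]_n) :
  A *m delta_mx j i = \sum_r A r j *: delta_mx r i.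
Proof.
apply/matrixP => a b; rewrite mxE (bigD1 j) //= big1 ?addr0 => [|k kj]; last first.
  by rewrite mxE (negbTE kj) mulr0.
rewrite summxE (bigD1 a) //= big1 ?addr0 => [|k ka]; last first.
  by rewrite !mxE (eq_sym a) (negbTE ka) mulr0.
by rewrite !mxE !eqxx.
Qed.

(** Along A M, the derivative of M^k is the sum of the M^l A M^(k-l); its entry (i, j) is brought to
    the form tr (A Phi) by cyclicity of the trace. *)
Lemma has_gradient_pow k i j : has_gradient (fun M : UR => (unitary_val M ^+ k) i j)
  (fun M => \sum_(l < k) unitary_val M ^+ (k - l) *m delta_mx j i *m unitary_val M ^+ l).
Proof.
elim: k i j => [|k IH] i j.
  under [X in has_gradient _ X]eq_fun do rewrite big_ord0.
  by apply: has_gradient_cst.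
have := has_gradient_sum (index_enum 'I_n) (fun r =>
  has_gradientM (has_gradient_entry i r) (IH r j)).
under eq_fun => M.
  rewrite (_ : \sum_(_ <- _) _ = (unitary_val M ^+ k.+1) i j); last first.
    by rewrite exprS -mulmxE mxE.
  over.
move=> h; congr (has_gradient _ _): h; apply/funext => M.
rewrite big_split /= big_ord_recl subn0 expr0 mulmx1; congr (_ + _).
  by under eq_bigr do rewrite scalemxAr; rewrite -mulmx_sumr -mul_delta_col mulmxA exprS -mulmxE.
under eq_bigr do rewrite scaler_sumr.
rewrite exchange_big; apply: eq_bigr => l _ /=.
rewrite /bump add1n subSS exprS -mulmxE mulmxA -[X in X *m _]mulmxA.
rewrite delta_mul_row mulmx_sumr mulmx_suml; apply: eq_bigr => r _.
by rewrite -scalemxAr -scalemxAl.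
Qed.

End haar.
End gradients.

(** * Moments of power traces *)

Section trace_moments.
Variables (R : realType) (n : nat).
Local Notation C := R[i].
Local Notation UR := (unitary R n).

Definition power_trace (k : nat) (M : UR) : C := \tr (unitary_val M ^+ k).

Lemma power_trace0 M : power_trace 0 M = n%:R.
Proof. by rewrite /power_trace expr0 mxtrace1. Qed.

Lemma has_gradient_power_trace k :
  has_gradient (power_trace k) (fun M => k%:R *: unitary_val M ^+ k).
Proof.
have := has_gradient_sum (index_enum 'I_n) (fun i => has_gradient_pow R k i i).
congr has_gradient; apply/funext => M /=.
rewrite exchange_big /= -[RHS](_ : \sum_(l < k) unitary_val M ^+ k = _); last first.
  by rewrite sumr_const card_ord scaler_nat.
apply: eq_bigr => l _; rewrite -mulmx_suml -mulmx_sumr.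
have -> : \sum_(i < n) delta_mx i i = 1%:M :> 'M[C]_n.
  by rewrite scalar_mx_sum_delta; apply: eq_bigr => i _; rewrite scale1r.
by rewrite mulmx1 mulmxE -exprD subnK // ltnW.
Qed.

Lemma unitary_pow (M : UR) k :
  unitary_val M ^+ k *m (unitary_val M ^+ k)^t* = 1%:M.
Proof.
elim: k => [|k IH]; first by rewrite expr0 trmx1 map_mx1 mulmx1.
rewrite exprSr -mulmxE trC_mul mulmxA -[X in X *m _]mulmxA.
by rewrite unitary_mulmxV mulmx1.
Qed.

Lemma unitary_powJ (M : UR) j k : (k <= j)%N ->
  unitary_val M ^+ j *m (unitary_val M ^+ k)^t* = unitary_val M ^+ (j - k).
Proof.
move=> kj; rewrite -{1}(subnK kj) exprD -mulmxE -mulmxA unitary_pow.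
by rewrite mulmx1.
Qed.

Lemma trace_unitary_powJ (M : UR) j k :
  \tr (unitary_val M ^+ j *m (unitary_val M ^+ k)^t*) =
  if (k <= j)%N then power_trace (j - k) M else Num.conj (power_trace (k - j) M).
Proof.
case: leqP => [kj|/ltnW jk]; first by rewrite unitary_powJ.
by rewrite -mxtrace_trC -(unitary_powJ _ jk) [in RHS]trC_mul trmxCK.
Qed.

Lemma bounded_power_trace k : bounded_cmeasurable (power_trace k).
Proof. by have [] := has_gradient_power_trace k. Qed.

Section haar.
Variable mu : probability UR R.
Hypothesis hmu : is_haar mu.

Lemma schwinger_dyson k (h : UR -> C) Phi : has_gradient h Phi ->
  cexp mu (fun M => h M * \sum_(l < k) power_trace l M * power_trace (k - l) M) +
  cexp mu (fun M => \tr (unitary_val M ^+ k *m Phi M)) = 0.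
Proof.
move=> hh; have [bh bP _] := hh.
have bpow i j : bounded_cmeasurable (fun M : UR => (unitary_val M ^+ k) i j).
  by have [] := has_gradient_pow R k i j.
rewrite -cexpD; first last.
- apply: bounded_cmeasurable_sum => i _; under eq_fun do rewrite mxE.
  by apply: bounded_cmeasurable_sum => j _; exact: bounded_cmeasurableM.
- apply: bounded_cmeasurableM => //; apply: bounded_cmeasurable_sum => l _.
  by apply: bounded_cmeasurableM; exact: bounded_power_trace.
have G i j := has_gradientM (has_gradient_pow R k i j) hh.
(* [D M i j] is the gradient of (M^k)_ij h. Summing its (j, i) entry over i and j turns the first
   part into products of traces, because [delta_mx j i] decouples the two powers, and the second
   into tr (M^k Phi). *)
pose D M i j := h M *: (\sum_(l < k)
    unitary_val M ^+ (k - l) *m delta_mx j i *m unitary_val M ^+ l)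
     + (unitary_val M ^+ k) i j *: Phi M.
have bG i j : bounded_cmeasurable (fun M => D M i j j i) by have [_ + _] := G i j; apply.
have Z : cexp mu (fun M => \sum_i \sum_j D M i j j i) = 0.
  rewrite cexp_sum; last first.
    by move=> i _; apply: bounded_cmeasurable_sum => j _; exact: bG.
  apply: big1 => i _; rewrite cexp_sum; last by move=> j _; exact: bG.
  by apply: big1 => j _; exact: (haar_gradient hmu j i (G i j)).
rewrite -[RHS]Z; apply: eq_cexp => M /=; rewrite /D.
under [RHS]eq_bigr => i _.
  under eq_bigr => j _ do rewrite 3!mxE.
  rewrite big_split /= -mulr_sumr; over.
rewrite big_split /= -mulr_sumr; congr (_ * _ + _); last first.
  by apply: eq_bigr => i _; rewrite mxE.
under [RHS]eq_bigr => i _ do under eq_bigr => j _ do rewrite summxE.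
under [RHS]eq_bigr => i _ do rewrite exchange_big /=.
rewrite exchange_big /=; apply: eq_bigr => l _.
rewrite /power_trace /mxtrace mulr_suml; apply: eq_bigr => i _.
rewrite mulr_sumr; apply: eq_bigr => j _.
rewrite mul_delta_col mulmx_suml summxE (bigD1 j) //= big1 ?addr0 => [|r rj].
  rewrite -scalemxAl delta_mul_row mxE summxE (bigD1 i) //= big1 ?addr0 => [|r ri].
    by rewrite !mxE !eqxx mulr1 mulrC.
  by rewrite !mxE (eq_sym i) (negbTE ri) andbF mulr0.
rewrite -scalemxAl delta_mul_row mxE summxE big1 ?mulr0 // => q _.
by rewrite !mxE (eq_sym j) (negbTE rj) mulr0.
Qed.

(** The trace of the gradient is the derivative along M -> w M, for which p_j conj p_k has weight j
    - k; this nonzero multiple has mean 0. *)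
Lemma haar_power_trace_orthogonal j k : j != k ->
  cexp mu (fun M => power_trace j M * Num.conj (power_trace k M)) = 0.
Proof.
move=> jk; have G := has_gradientM (has_gradient_power_trace j)
  (has_gradient_conj (has_gradient_power_trace k)).
have [_ bG _] := G.
have Z := haar_gradient hmu.
have : cexp mu (fun M => \sum_i (Num.conj (power_trace k M) *:
    (j%:R *: unitary_val M ^+ j) + power_trace j M *:
    - (k%:R *: unitary_val M ^+ k)^t*) i i) = 0.
  rewrite cexp_sum => [|i _]; last exact: bG.
  by apply: big1 => i _; exact: (Z _ _ i i G).
rewrite (@eq_cexp _ _ _ _ _ (fun M => (j%:R - k%:R) *
    (power_trace j M * Num.conj (power_trace k M)))); last first.
  move=> M; rewrite -/(\tr _) mxtraceD !mxtraceZ raddfN /= mxtrace_trC mxtraceZ.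
  by rewrite rmorphM /= conjC_nat -!/(power_trace _ _); ring.
rewrite cexpZ; last first.
  apply: bounded_cmeasurableM; first exact: bounded_power_trace.
  by apply: bounded_cmeasurable_conj; exact: bounded_power_trace.
move=> /eqP; rewrite mulf_eq0 => /orP[|/eqP //].
by rewrite subr_eq0 eqr_nat (negbTE jk).
Qed.

Lemma haar_power_trace_mean j : (0 < j)%N -> cexp mu (power_trace j) = 0.
Proof.
move=> j0; have [n0|n0] := posnP n.
  rewrite -[RHS](cexp_cst mu 0); apply: eq_cexp => M.
  by rewrite /power_trace /mxtrace big1 // => i; have := ltn_ord i; rewrite {2}n0.
have := @haar_power_trace_orthogonal j 0; rewrite -lt0n => /(_ j0).
rewrite (@eq_cexp _ _ _ _ _ (fun M => n%:R * power_trace j M)); last first.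
  by move=> M; rewrite power_trace0 conjC_nat mulrC.
rewrite cexpZ; last exact: bounded_power_trace.
by move/eqP; rewrite mulf_eq0 pnatr_eq0 gtn_eqF //= => /eqP.
Qed.

End haar.
End trace_moments.

(** * Gradients of the elementary and complete symmetric functions of the eigenvalues *)

Section hook_characters.
Variables (R : realType) (n' : nat).
Local Notation n := n'.+1.
Local Notation C := R[i].
Local Notation UR := (unitary R n).

Definition trace_horner (A : 'M[C]_n) (q : {poly C}) : C := \tr (horner_mx A q).

Lemma trace_horner_is_scalar A : scalar (trace_horner A).
Proof. by move=> c p q; rewrite /trace_horner !linearP. Qed.

HB.instance Definition _ A :=
  GRing.isLinear.Build C {poly C} C *%R (trace_horner A) (trace_horner_is_scalar A).

Definition trace_eval (M : UR) : {scalar {poly C}} := trace_horner (unitary_val M).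

Local Notation tau M := (trace_eval M).

Lemma trace_evalE M q : tau M q = \tr (horner_mx (unitary_val M) q).
Proof. by []. Qed.

Lemma horner_mxXn (A : 'M[C]_n) k : horner_mx A 'X^k = A ^+ k.
Proof. by rewrite rmorphXn /= horner_mx_X. Qed.

Lemma trace_evalXn (M : UR) k : tau M 'X^k = power_trace k M.
Proof. by rewrite trace_evalE horner_mxXn. Qed.

Lemma horner_mx_sum_le (A : 'M[C]_n) (q : {poly C}) N : (size q <= N)%N ->
  horner_mx A q = \sum_(i < N) q`_i *: A ^+ i.
Proof.
move=> qN; rewrite -{1}[q]coefK poly_def.
rewrite (big_ord_widen N (fun i => q`_i *: 'X^i)) // [in LHS]big_mkcond linear_sum /=.
apply: eq_bigr => i _; case: ltnP => [_|/(nth_default 0) ->].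
  by rewrite linearZ /= horner_mxXn.
by rewrite linear0 scale0r.
Qed.

Variable s : C.
Hypothesis s2 : s * s = 1.
Local Notation x k := (fun M : UR => newton_coef (tau M) s k).
Local Notation X k := (fun M : UR => newton_poly (tau M) s k).

Lemma bounded_pow_entry k i j : bounded_cmeasurable (fun M : UR => (unitary_val M ^+ k) i j).
Proof. by have [] := has_gradient_pow R k i j. Qed.

(** Strong induction along Newton's identity, which expresses (k + 1) x_{k+1} through power traces
    and lower coefficients; [newton_gradient_identity] sums the resulting gradients. *)
Lemma has_gradient_newton_coef k :
  has_gradient (x k) (fun M => horner_mx (unitary_val M) (newton_gradient (tau M) s k)).
Proof.
elim/ltn_ind: k => -[_|k IH].
  rewrite [Y in has_gradient Y](_ : _ = fun=> 1) //.
  by under [Y in has_gradient _ Y]eq_fun do rewrite linear0; exact: has_gradient_cst.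
have H : has_gradient (fun M => \sum_(i < k.+1)
    s ^+ i * (power_trace i.+1 M * newton_coef (tau M) s (k - i)))
  (fun M => \sum_(i < k.+1) s ^+ i *:
    (newton_coef (tau M) s (k - i) *: (i.+1%:R *: unitary_val M ^+ i.+1) +
     power_trace i.+1 M *: horner_mx (unitary_val M) (newton_gradient (tau M) s (k - i)))).
  apply: (@has_gradient_sum _ _ _ _
    (fun (i : 'I_k.+1) M => s ^+ i * (power_trace i.+1 M * newton_coef (tau M) s (k - i)))).
  move=> i; apply: has_gradientZ; apply: has_gradientM.
    exact: has_gradient_power_trace.
  by apply: IH; rewrite ltnS leq_subr.
have := has_gradientZ k.+1%:R^-1 H.
have k0 : k.+1%:R != 0 :> C by rewrite pnatr_eq0.
rewrite (_ : (fun M => _ * _) = x k.+1); last first.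
  apply/funext => M; apply: (mulfI k0); rewrite newton_coefS mulrA mulfV // mul1r.
  rewrite -['X]expr1 (@tau_newton_poly _ _ s k 1 k.+1) //.
  apply: eq_bigr => i _; rewrite coef_newton_poly -ltnS ltn_ord trace_evalXn add1n.
  by rewrite -mulrA [power_trace _ _ * _]mulrC.
congr has_gradient; apply/funext => M; apply: (scalerI k0).
rewrite scalerA mulfV // scale1r -linearZ /= -newton_gradient_identity // linear_sum /=.
apply: eq_bigr => i _.
rewrite scalerDr !scalerA linearD !linearZ /= horner_mxXn trace_evalXn.
rewrite coef_newton_poly -ltnS ltn_ord; congr (_ *: _ + _ *: _); first by ring.
by rewrite mulrC.
Qed.

Lemma has_gradient_newton_poly_coef b i : (i <= b)%N ->
  has_gradient (fun M => (newton_poly (tau M) s b)`_i)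
    (fun M => s *: \sum_(r < b.+1 | (i < r)%N)
       (newton_poly (tau M) s b)`_r *: unitary_val M ^+ (r - i)).
Proof.
move=> ib; have := has_gradientZ (s ^+ i) (has_gradient_newton_coef (b - i)).
under eq_fun => M.
  rewrite (_ : s ^+ i * _ = (newton_poly (tau M) s b)`_i); last first.
    by rewrite coef_newton_poly ib.
  over.
congr has_gradient; apply/funext => M.
rewrite -linearZ /= newton_gradient_coef // linearZ linear_sum /=; congr (_ *: _).
by apply: eq_bigr => r _; rewrite linearZ /= horner_mxXn.
Qed.

End hook_characters.

(** * Moments of hook functions against power traces *)

Section second_moment.
Variables (R : realType) (n' : nat).
Local Notation n := n'.+1.
Local Notation C := R[i].
Local Notation UR := (unitary R n).
Local Notation tau M := (trace_eval M).
Local Notation K b M := (newton_poly (tau M) (-1) b).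
Local Notation L a M := (newton_poly (tau M) 1 a).

Lemma sqrN1 : (-1 : C) * -1 = 1. Proof. by rewrite mulrNN mulr1. Qed.
Lemma sqr1 : (1 : C) * 1 = 1. Proof. exact: mulr1. Qed.

Definition bounded_poly (q : UR -> {poly C}) :=
  (exists N, forall M, (size (q M) <= N)%N) /\
  forall i, bounded_cmeasurable (fun M => (q M)`_i).

Lemma bounded_polyM p q : bounded_poly p -> bounded_poly q ->
  bounded_poly (fun M => p M * q M).
Proof.
move=> [[N pN] bp] [[N' qN] bq]; split.
  exists (N + N')%N => M; rewrite (leq_trans (size_polyMleq _ _)) //.
  by rewrite (leq_trans (leq_pred _)) // leq_add.
move=> i; under eq_fun do rewrite coefM.
by apply: bounded_cmeasurable_sum => j _; exact: bounded_cmeasurableM.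
Qed.

Lemma bounded_polyX : bounded_poly (fun=> 'X).
Proof.
split; first by exists 2%N => M; rewrite size_polyX.
by move=> i; exact: bounded_cmeasurable_cst.
Qed.

Lemma bounded_newton_coef s k : s * s = 1 ->
  bounded_cmeasurable (fun M : UR => newton_coef (tau M) s k).
Proof. by move=> s2; have [] := has_gradient_newton_coef n' s2 k. Qed.

Lemma bounded_newton_poly s k : s * s = 1 ->
  bounded_poly (fun M => newton_poly (tau M) s k).
Proof.
move=> s2; split; first by exists k.+1 => M; exact: size_newton_poly.
move=> i; under eq_fun do rewrite coef_newton_poly.
case: (i <= k)%N; last exact: bounded_cmeasurable_cst.
by apply: bounded_cmeasurableZ; exact: bounded_newton_coef.
Qed.

(* The pairing of q(M) with M^k, which is \tr (q(M) M^-k). *)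
Definition trace_pairing k (q : {poly C}) (M : UR) : C :=
  \tr (horner_mx (unitary_val M) q *m (unitary_val M ^+ k)^t*).

Lemma trace_pairingD k p q M :
  trace_pairing k (p + q) M = trace_pairing k p M + trace_pairing k q M.
Proof. by rewrite /trace_pairing linearD mulmxDl mxtraceD. Qed.

Lemma trace_pairingZ k c q M :
  trace_pairing k (c *: q) M = c * trace_pairing k q M.
Proof. by rewrite /trace_pairing linearZ /= -scalemxAl mxtraceZ. Qed.

Lemma trace_pairingN k q M : trace_pairing k (- q) M = - trace_pairing k q M.
Proof. by rewrite -scaleN1r trace_pairingZ mulN1r. Qed.

Lemma trace_pairingC k c M :
  trace_pairing k c%:P M = c * Num.conj (power_trace k M).
Proof.
by rewrite /trace_pairing horner_mx_C mul_scalar_mx mxtraceZ mxtrace_trC.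
Qed.

Lemma trace_pairingX k q M : trace_pairing k.+1 ('X * q) M = trace_pairing k q M.
Proof.
rewrite /trace_pairing mulrC rmorphM /= horner_mx_X exprSr -!mulmxE trC_mul.
by rewrite mulmxA -[X in \tr (X *m _)]mulmxA unitary_mulmxV mulmx1.
Qed.

Lemma trace_pairing_sum k (q : {poly C}) M N : (size q <= N)%N -> trace_pairing k q M =
  \sum_(i < N) q`_i * \tr (unitary_val M ^+ i *m (unitary_val M ^+ k)^t*).
Proof.
move=> qN; rewrite /trace_pairing (horner_mx_sum_le _ qN) mulmx_suml linear_sum /=.
by apply: eq_bigr => i _; rewrite -scalemxAl mxtraceZ.
Qed.

Lemma trace_pairing_XM k (p q : {poly C}) M N N' : (size p <= N)%N ->
  (size q <= N')%N -> trace_pairing k ('X * p * q) M =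
  \sum_(i < N) \sum_(j < N') p`_i * q`_j *
    \tr (unitary_val M ^+ (i + j).+1 *m (unitary_val M ^+ k)^t*).
Proof.
move=> pN qN; rewrite /trace_pairing !rmorphM /= horner_mx_X.
rewrite (horner_mx_sum_le _ pN) (horner_mx_sum_le _ qN) mulr_sumr mulmx_suml.
rewrite linear_sum [RHS]exchange_big /=; apply: eq_bigr => j _.
rewrite mulr_sumr mulr_suml mulmx_suml linear_sum /=; apply: eq_bigr => i _.
rewrite -!scalerAr -!scalerAl !scalerA -exprS -exprD addSn.
by rewrite -scalemxAl mxtraceZ [q`_j * _]mulrC.
Qed.

Lemma bounded_trace_pow j k :
  bounded_cmeasurable (fun M : UR => \tr (unitary_val M ^+ j *m (unitary_val M ^+ k)^t*)).
Proof.
under eq_fun do rewrite trace_unitary_powJ.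
case: leqP => _; first exact: bounded_power_trace.
by apply: bounded_cmeasurable_conj; exact: bounded_power_trace.
Qed.

Lemma bounded_trace_pairing k q : bounded_poly q ->
  bounded_cmeasurable (fun M => trace_pairing k (q M) M).
Proof.
move=> [[N qN] bq]; under eq_fun do rewrite (trace_pairing_sum _ _ (qN _)).
apply: bounded_cmeasurable_sum => i _.
by apply: bounded_cmeasurableM => //; exact: bounded_trace_pow.
Qed.

Lemma trace_eval_sum (q : {poly C}) (M : UR) N : (size q <= N)%N ->
  tau M q = \sum_(i < N) q`_i * power_trace i M.
Proof.
move=> qN; rewrite trace_evalE (horner_mx_sum_le _ qN) linear_sum /=.
by apply: eq_bigr => i _; rewrite mxtraceZ.
Qed.

Lemma bounded_trace_eval q : bounded_poly q ->
  bounded_cmeasurable (fun M : UR => tau M (q M)).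
Proof.
move=> [[N qN] bq]; under eq_fun do rewrite (trace_eval_sum _ (qN _)).
apply: bounded_cmeasurable_sum => i _.
by apply: bounded_cmeasurableM => //; exact: bounded_power_trace.
Qed.

Lemma mxtrace_gradient (c x y z u v : C) (m : nat) (N A B D : 'M[C]_n) :
  \tr (N *m A) = u -> \tr (N *m B) = v ->
  \tr (N *m (c *: (x *: A + y *: B) + z *: - (m%:R *: D)^t*)) =
  c * (x * u + y * v) - m%:R * (z * \tr (N *m D^t*)).
Proof.
move=> <- <-.
have -> : (m%:R *: D)^t* = m%:R *: D^t*.
  by apply/matrixP => i j; rewrite !mxE rmorphM rmorph_nat.
rewrite mulmxDr -scalemxAr mulmxDr -!scalemxAr mulmxN -scalemxAr.
by rewrite mxtraceD !mxtraceZ mxtraceD !mxtraceZ raddfN /= mxtraceZ; ring.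
Qed.

Section haar.
Variable mu : probability UR R.
Hypothesis hmu : is_haar mu.

(** The three unknowns of [hook_recursion]: [t] is the moment of the hook function times its degree,
    [Q] that of e_b h_a, and [Y] is what the gradient of the conjugate power trace contributes. *)
Let t a b := cexp mu (fun M : UR =>
  tau M ('X * K b M * L a M) * Num.conj (power_trace (a + b).+1 M)).
Let Y a b := cexp mu (fun M : UR => trace_pairing (a + b) (K b M * L a M) M).
Let Q a b := cexp mu (fun M : UR => newton_coef (tau M) (-1) b * newton_coef (tau M) 1 a *
  Num.conj (power_trace (a + b) M)).

(** The Schwinger-Dyson equations for the products of the i-th coefficient of K_b, the q-th of L_a
    and conj p_m, taken at the power i + q + 1, are summed over i and q. The terms free of the
    gradient of conj p_m collapse by [hook_divergence]. *)
Lemma hook_schwinger_dyson a b :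
  (n%:R + a%:R - b%:R) * t a b = (a + b).+1%:R * Y a b.
Proof.
set m := (a + b).+1.
pose g (M : UR) := Num.conj (power_trace m M).
have gg : has_gradient g (fun M => - (m%:R *: unitary_val M ^+ m)^t*).
  by apply: has_gradient_conj; exact: has_gradient_power_trace.
have bg : bounded_cmeasurable g by case: gg.
pose f i q (M : UR) := (K b M)`_i * (L a M)`_q * g M.
pose GK i (M : UR) := (-1) *: \sum_(r < b.+1 | (i < r)%N) (K b M)`_r *: unitary_val M ^+ (r - i).
pose GL q (M : UR) := 1 *: \sum_(r < a.+1 | (q < r)%N) (L a M)`_r *: unitary_val M ^+ (r - q).
pose Gf i q (M : UR) := g M *: ((L a M)`_q *: GK i M + (K b M)`_i *: GL q M) +
  ((K b M)`_i * (L a M)`_q) *: - (m%:R *: unitary_val M ^+ m)^t*.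
have fG i q : (i <= b)%N -> (q <= a)%N -> has_gradient (f i q) (Gf i q).
  move=> ib qa; apply: has_gradientM gg; apply: has_gradientM.
    exact: (has_gradient_newton_poly_coef n' sqrN1 ib).
  exact: (has_gradient_newton_poly_coef n' sqr1 qa).
have SD i q : (i <= b)%N -> (q <= a)%N -> cexp mu (fun M : UR =>
    f i q M * (\sum_(l < (i + q).+1) power_trace l M * power_trace ((i + q).+1 - l) M) +
    \tr (unitary_val M ^+ (i + q).+1 *m Gf i q M)) = 0.
  move=> ib qa; have [bf bG _] := fG i q ib qa.
  rewrite cexpD ?(schwinger_dyson hmu _ (fG i q ib qa)) //.
  - apply: bounded_cmeasurableM => //; apply: bounded_cmeasurable_sum => l _.
    by apply: bounded_cmeasurableM; exact: bounded_power_trace.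
  - apply: bounded_cmeasurable_sum => k _; under eq_fun do rewrite mxE.
    apply: bounded_cmeasurable_sum => l _; apply: bounded_cmeasurableM => //.
    exact: bounded_pow_entry.
have bSD i q : (i <= b)%N -> (q <= a)%N -> bounded_cmeasurable (fun M : UR =>
    f i q M * (\sum_(l < (i + q).+1) power_trace l M * power_trace ((i + q).+1 - l) M) +
    \tr (unitary_val M ^+ (i + q).+1 *m Gf i q M)).
  move=> ib qa; have [bf bG _] := fG i q ib qa; apply: bounded_cmeasurableD.
  - apply: bounded_cmeasurableM => //; apply: bounded_cmeasurable_sum => l _.
    by apply: bounded_cmeasurableM; exact: bounded_power_trace.
  - apply: bounded_cmeasurable_sum => k _; under eq_fun do rewrite mxE.
    apply: bounded_cmeasurable_sum => l _; apply: bounded_cmeasurableM => //.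
    exact: bounded_pow_entry.
have ordle k (i : 'I_k.+1) : (i <= k)%N by rewrite -ltnS.
have : cexp mu (fun M : UR => \sum_(i < b.+1) \sum_(q < a.+1)
    (f i q M * (\sum_(l < (i + q).+1) power_trace l M * power_trace ((i + q).+1 - l) M) +
    \tr (unitary_val M ^+ (i + q).+1 *m Gf i q M))) = 0.
  rewrite cexp_sum => [|i _]; last first.
    by apply: bounded_cmeasurable_sum => q _; exact: bSD.
  apply: big1 => i _; rewrite cexp_sum => [|q _]; last exact: bSD.
  by apply: big1 => q _; exact: SD.
have bKL : bounded_poly (fun M : UR => K b M * L a M).
  by apply: bounded_polyM; apply: bounded_newton_poly; [exact: sqrN1|exact: sqr1].
rewrite (@eq_cexp _ _ _ _ _ (fun M : UR => (n%:R + a%:R - b%:R) *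
    (tau M ('X * K b M * L a M) * Num.conj (power_trace m M)) -
    m%:R * trace_pairing (a + b) (K b M * L a M) M)); last first.
  move=> M.
  have := hook_divergence (tau M) a b.
  rewrite !trace_evalXn power_trace0 => HD.
  transitivity (g M * ((n%:R + a%:R - b%:R) * tau M ('X * K b M * L a M)) -
    m%:R * trace_pairing m ('X * K b M * L a M) M); last first.
    by rewrite -mulrA trace_pairingX /g; ring.
  rewrite -HD (trace_pairing_XM _ _ (size_newton_poly _ _ _) (size_newton_poly _ _ _)).
  rewrite !mulr_sumr -sumrB; apply: eq_bigr => i _.
  rewrite !mulr_sumr -sumrB; apply: eq_bigr => q _.
  have E1 : \tr (unitary_val M ^+ (i + q).+1 *m GK i M) =
      - \sum_(r < b.+1 | (i < r)%N) (K b M)`_r * power_trace (r + q).+1 M.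
    rewrite /GK scaleN1r mulmxN raddfN /=; congr (- _); rewrite mulmx_sumr linear_sum /=.
    apply: eq_bigr => r ir; rewrite -scalemxAr mxtraceZ.
    rewrite mulmxE -exprD; congr (_ * power_trace _ _); lia.
  have E2 : \tr (unitary_val M ^+ (i + q).+1 *m GL q M) =
      \sum_(r < a.+1 | (q < r)%N) (L a M)`_r * power_trace (i + r).+1 M.
    rewrite /GL scale1r mulmx_sumr linear_sum /=.
    apply: eq_bigr => r ir; rewrite -scalemxAr mxtraceZ.
    rewrite mulmxE -exprD; congr (_ * power_trace _ _); lia.
  rewrite /Gf (mxtrace_gradient _ _ _ _ _ _ E1 E2).
  under [X in _ = g M * (_ * X + _ - _) - _]eq_bigr do rewrite !trace_evalXn.
  under [X in _ = g M * (_ + _ * X - _) - _]eq_bigr do rewrite trace_evalXn.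
  under [X in _ = g M * (_ - _ * X) - _]eq_bigr do rewrite trace_evalXn.
  by rewrite /f; ring.
have bt : bounded_cmeasurable (fun M : UR =>
    tau M ('X * K b M * L a M) * Num.conj (power_trace m M)).
  apply: bounded_cmeasurableM => //; under eq_fun do rewrite -mulrA.
  by apply: bounded_trace_eval; apply: bounded_polyM => //; exact: bounded_polyX.
have bY := bounded_trace_pairing (a + b) bKL.
rewrite cexpB ?cexpZ //; try exact: bounded_cmeasurableZ.
by move/eqP; rewrite subr_eq0 => /eqP.
Qed.

(** The character of the hook (a + 1, 1^b) at a full cycle is (-1)^b; the hook has b + 1 rows, hence
    b < n. The recursion rests on the product formulas above. *)
Lemma hook_moment a b : (b < n)%N -> t a b = (a + b).+1%:R * (-1) ^+ b.
Proof.
have bK k : bounded_poly (fun M : UR => K k M) by apply: bounded_newton_poly; exact: sqrN1.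
have bL k : bounded_poly (fun M : UR => L k M) by apply: bounded_newton_poly; exact: sqr1.
have bKL a' b' : bounded_poly (fun M : UR => K b' M * L a' M) by apply: bounded_polyM.
have bY k a' b' := bounded_trace_pairing k (bKL a' b').
have bQ k a' b' : bounded_cmeasurable (fun M : UR => newton_coef (tau M) (-1) b' *
    newton_coef (tau M) 1 a' * Num.conj (power_trace k M)).
  apply: bounded_cmeasurableM; last first.
    by apply: bounded_cmeasurable_conj; exact: bounded_power_trace.
  by apply: bounded_cmeasurableM; apply: bounded_newton_coef; [exact: sqrN1|exact: sqr1].
have bt k a' b' : bounded_cmeasurable (fun M : UR =>
    tau M ('X * K b' M * L a' M) * Num.conj (power_trace k M)).
  apply: bounded_cmeasurableM; last first.
    by apply: bounded_cmeasurable_conj; exact: bounded_power_trace.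
  under eq_fun do rewrite -mulrA.
  by apply: bounded_trace_eval; apply: bounded_polyM => //; exact: bounded_polyX.
apply: (@hook_recursion _ n t Y Q) => {a b}.
- exact: hook_schwinger_dyson.
- rewrite /Y -[RHS](cexp_cst mu); apply: eq_cexp => M.
  by rewrite mulr1 (trace_pairingC _ 1) mul1r power_trace0 conjC_nat.
- move=> a; rewrite /Y /Q -cexpD //; apply: eq_cexp => M.
  rewrite newton_coef0 newton_poly0 !mul1r newton_polyS scale1r !addn0.
  by rewrite trace_pairingD trace_pairingC trace_pairingX.
- move=> b; rewrite /Y /Q -cexpB //; apply: eq_cexp => M.
  rewrite newton_coef0 newton_poly0 !mulr1 newton_polyS scaleN1r !add0n.
  by rewrite trace_pairingD trace_pairingC trace_pairingN trace_pairingX.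
- move=> a b; rewrite /Y /Q -cexpB // -!cexpD //; last first.
  - by apply: bounded_cmeasurableB.
  - by apply: bounded_cmeasurableD => //; exact: bounded_cmeasurableB.
  apply: eq_cexp => M; rewrite newton_poly_mul !trace_pairingD trace_pairingN trace_pairingC.
  rewrite addSn addnS expr2 -!mulrA !trace_pairingX !addSn -!addnS.
  by rewrite !mulrA.
- move=> a; rewrite /Q /t -cexpZ //; apply: eq_cexp => M.
  by rewrite newton_coef0 newton_poly0 mul1r mulr1 mulrA newton_coefS !addn0.
- move=> b; rewrite /Q /t -cexpZ //; apply: eq_cexp => M.
  by rewrite newton_coef0 newton_poly0 !mulr1 mulrA newton_coefS !add0n.
- move=> a b; rewrite /Q /t -cexpZ // -cexpD //; apply: eq_cexp => M.
  by rewrite mulrA newton_coef_mul mulrDl !addSn !addnS.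
Qed.

End haar.
End second_moment.

(** * Eigenvalues of a unitary matrix *)

Section eigenvalues.
Variables (R : realType) (n' : nat).
Local Notation n := n'.+1.
Local Notation C := R[i].
Local Notation UR := (unitary R n).

Definition eigen (M : UR) (i : 'I_n) : C := spectral_diag (unitary_val M) 0 i.

Lemma unitary_spectral (M : UR) : unitary_val M =
  invmx (spectralmx (unitary_val M)) *m diag_mx (spectral_diag (unitary_val M)) *m
  spectralmx (unitary_val M).
Proof.
by apply/orthomx_spectralP; apply/normalmxP; rewrite unitary_mulmxV unitary_mulVmx.
Qed.

Lemma trace_eval_eigen (M : UR) q : trace_eval M q = \sum_i q.[eigen M i].
Proof.
rewrite trace_evalE {1}unitary_spectral horner_mx_uconjC ?spectral_unit //.
rewrite mxtrace_mulC mulmxA mulmxV ?spectral_unit // mul1mx horner_mx_diag mxtrace_diag.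
by apply: eq_bigr => i _; rewrite mxE.
Qed.

Lemma power_trace_eigen k (M : UR) : power_trace k M = \sum_i eigen M i ^+ k.
Proof.
by rewrite -trace_evalXn trace_eval_eigen; apply: eq_bigr => i _; rewrite hornerXn.
Qed.

Lemma norm_eigen (M : UR) i : `|eigen M i| = 1.
Proof.
pose P := spectralmx (unitary_val M); pose D := diag_mx (spectral_diag (unitary_val M)).
have Pu : P \is unitarymx := spectral_unitarymx _.
have DE : D = P *m unitary_val M *m invmx P.
  rewrite [unitary_val M]unitary_spectral -/P -/D !mulmxA mulmxV ?spectral_unit //.
  by rewrite mul1mx mulmxK ?spectral_unit.
have Du : D \is unitarymx.
  rewrite DE invmx_unitary //; apply: mul_unitarymx; last by rewrite trmxC_unitary.
  by apply: mul_unitarymx => //; apply/unitarymxP; exact: unitary_mulmxV.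
have /unitarymxP/matrixP/(_ i i) := Du.
rewrite mxE (bigD1 i) //= big1 ?addr0 => [|k ki]; last first.
  by rewrite mxE eq_sym (negbTE ki) mulr0n mul0r.
rewrite !mxE eqxx !mulr1n -normCK => /eqP.
by rewrite sqrp_eq1 // => /eqP.
Qed.

(** The roots of the characteristic polynomial and the diagonal given by the spectral theorem factor
    the same monic polynomial, so they agree up to order. *)
Lemma eigenvalues_sum (M : UR) (V : zmodType) (F : C -> V) :
  \sum_(z <- eigenvalues (unitary_val M)) F z = \sum_i F (eigen M i).
Proof.
have cE : char_poly (unitary_val M) = \prod_i ('X - (eigen M i)%:P).
  pose P := spectralmx (unitary_val M); pose sp := spectral_diag (unitary_val M).
  have Pu : P \in unitmx := spectral_unit _.
  have -> : char_poly (unitary_val M) = char_poly (diag_mx sp).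
    have PP : map_mx polyC (invmx P) *m map_mx polyC P = 1%:M.
      by rewrite -map_mxM mulVmx // map_mx1.
    have E : char_poly_mx (unitary_val M) =
        map_mx polyC (invmx P) *m char_poly_mx (diag_mx sp) *m map_mx polyC P.
      rewrite /char_poly_mx mulmxBr mulmxBl -!map_mxM -unitary_spectral.
      by rewrite scalar_mxC -mulmxA PP mulmx1.
    rewrite /char_poly E !det_mulmx mulrAC -det_mulmx PP det1 mul1r.
    by [].
  rewrite char_poly_trig ?diag_mx_is_trig //.
  by apply: eq_bigr => i _; rewrite mxE eqxx mulr1n.
have : perm_eq (eigenvalues (unitary_val M)) [seq eigen M i | i <- index_enum 'I_n].
  apply/prod_XsubC_eq.
  rewrite big_map -cE /eigenvalues; case: closed_field_poly_normal => s /= {1}->.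
  by rewrite (monicP (char_poly_monic _)) scale1r.
by move=> /(perm_big _) -> /=; rewrite big_map.
Qed.

End eigenvalues.

Section second_moment_value.
Variables (R : realType) (n' : nat).
Local Notation n := n'.+1.
Variable mu : probability (unitary R n) R.
Hypothesis hmu : is_haar mu.

Lemma hook_moment_eq0 a b : (n <= b)%N -> cexp mu (fun M : unitary R n =>
  trace_eval M ('X * newton_poly (trace_eval M) (-1) b * newton_poly (trace_eval M) 1 a) *
  Num.conj (power_trace (a + b).+1 M)) = 0.
Proof.
move=> nb; rewrite -[RHS](cexp_cst mu); apply: eq_cexp => M.
rewrite trace_eval_eigen big1 ?mul0r // => i _.
by rewrite !hornerM (newton_poly_eigenvalue_eq0 (trace_eval_eigen M)) // mulr0 mul0r.
Qed.

(** In the hook expansion of m p_m, each hook with b < n contributes m, the sign of the expansion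
    cancelling that of the character, and the others vanish. There are min (m, n) of the former. *)
Lemma haar_power_trace_second_moment m : (0 < m)%N ->
  cexp mu (fun M => power_trace m M * Num.conj (power_trace m M)) = (minn m n)%:R.
Proof.
case: m => // m _; apply: (mulfI (x := m.+1%:R)); first by rewrite pnatr_eq0.
have bp k : bounded_cmeasurable (fun M : unitary R n => Num.conj (power_trace k M)).
  by apply: bounded_cmeasurable_conj; exact: bounded_power_trace.
have bt a b k : bounded_cmeasurable (fun M : unitary R n =>
    trace_eval M ('X * newton_poly (trace_eval M) (-1) b * newton_poly (trace_eval M) 1 a) *
    Num.conj (power_trace k M)).
  apply: bounded_cmeasurableM => //; apply: bounded_trace_eval.
  apply: bounded_polyM; first apply: bounded_polyM.
  - exact: bounded_polyX.
  - by apply: bounded_newton_poly; exact: sqrN1.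
  - by apply: bounded_newton_poly; exact: sqr1.
rewrite -cexpZ; last by apply: bounded_cmeasurableM => //; exact: bounded_power_trace.
transitivity (cexp mu (fun M : unitary R n => \sum_(b < m.+1) (-1) ^+ b *
    (trace_eval M ('X * newton_poly (trace_eval M) (-1) b *
       newton_poly (trace_eval M) 1 (m - b)) * Num.conj (power_trace m.+1 M)))).
  apply: eq_cexp => M; rewrite mulrA.
  have -> : m.+1%:R * power_trace m.+1 M = \sum_(b < m.+1) (-1) ^+ b *
      trace_eval M ('X * newton_poly (trace_eval M) (-1) b *
        newton_poly (trace_eval M) 1 (m - b)).
    rewrite -trace_evalXn -[LHS]linearZ exprS scalerAr.
    rewrite -(alternating_newton_poly_mul (trace_eval M)) mulr_sumr linear_sum.
    by apply: eq_bigr => b _; rewrite -scalerAr mulrA; exact: linearZ.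
  by rewrite mulr_suml; apply: eq_bigr => b _; rewrite mulrA.
rewrite cexp_sum => [|b _]; last exact: bounded_cmeasurableZ.
transitivity (\sum_(b < m.+1) if (b < n)%N then m.+1%:R else 0 : R[i]).
  apply: eq_bigr => b _; rewrite cexpZ //.
  have bm : (m - b + b = m)%N by rewrite subnK // -ltnS.
  case: ltnP => bn.
    have := hook_moment hmu (m - b) bn; rewrite bm => ->.
    by rewrite mulrCA -exprD addnn -mul2n exprM sqrrN expr1n expr1n mulr1.
  by have := hook_moment_eq0 (m - b) bn; rewrite bm => ->; rewrite mulr0.
rewrite -big_mkcond /=.
transitivity (\sum_(b < minn m.+1 n) m.+1%:R : R[i]).
  rewrite (big_ord_widen m.+1 (fun=> m.+1%:R : R[i])) ?geq_minl //.
  by apply: eq_bigl => b; rewrite leq_min ltn_ord.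
by rewrite sumr_const card_ord mulr_natr.
Qed.
End second_moment_value.

(** * Stein's method for linear statistics *)

Section stein_haar.
Variables (R : realType) (n' : nat).
Local Notation n := n'.+1.
Local Notation C := R[i].
Local Notation UR := (unitary R n).
Variable mu : probability UR R.
Hypothesis hmu : is_haar mu.

Lemma normc_real (x : R) : `|x%:C| = `|x|%:C.
Proof. by rewrite normc_def /= expr0n addr0 sqrtr_sqr. Qed.

Lemma complex_taylor_split (a b e x y : R) (w t : C) :
  (a - b - e * (x - y))%:C + e%:C * (x%:C - y%:C - w * t) =
  a%:C - b%:C - w * (e%:C * t).
Proof. by rewrite !(rmorphB (real_complex R)) rmorphM (rmorphB (real_complex R)) /=; ring. Qed.

Lemma cexp_le (f g : UR -> C) : bounded_cmeasurable f -> bounded_cmeasurable g ->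
  (forall M, f M <= g M) -> cexp mu f <= cexp mu g.
Proof.
move=> bf bg fg; rewrite -subr_ge0 -cexpB //; apply: cexp_ge0 => M.
by rewrite subr_ge0.
Qed.

(** The bound B^2 + m comes from [cexp_amgm] and E |p_m|^2 <= m. It does not depend on n, as do
    neither of the next two. *)
Lemma cexp_real_power_trace (g : UR -> R) (B : R) m : bounded_measurable g ->
  (forall M, `|g M| <= B) -> (0 < m)%N ->
  `|cexp mu (fun M => (g M)%:C * power_trace m M)| * 2 <= (B ^+ 2 + m%:R)%:C.
Proof.
move=> bg gB m0; have bgc := bounded_cmeasurable_real bg.
have bp := @bounded_power_trace R n m.
apply: le_trans (cexp_amgm mu bgc bp) _; rewrite rmorphD lerD //; last first.
  by rewrite haar_power_trace_second_moment // rmorph_nat ler_nat geq_minl.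
rewrite -[leRHS](cexp_cst mu); apply: cexp_le.
- by apply: bounded_cmeasurableM => //; exact: bounded_cmeasurable_conj.
- exact: bounded_cmeasurable_cst.
- move=> M; rewrite -normCK normc_def /= expr0n addr0 sqrtr_sqr -rmorphXn lecR.
  by rewrite lerXn2r ?nnegrE // (le_trans _ (gB M)).
Qed.

Lemma cexp_real_power_trace_conj (g : UR -> R) (B : R) m : bounded_measurable g ->
  (forall M, `|g M| <= B) -> (0 < m)%N ->
  `|cexp mu (fun M => (g M)%:C * Num.conj (power_trace m M))| * 2 <= (B ^+ 2 + m%:R)%:C.
Proof.
move=> bg gB m0; apply: le_trans (cexp_real_power_trace bg gB m0).
rewrite -[X in _ <= X * _]norm_conjC -cexp_conj; last first.
  apply: bounded_cmeasurableM; first exact: bounded_cmeasurable_real.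
  exact: bounded_power_trace.
rewrite le_eqVlt; apply/orP; left; apply/eqP; congr (`| _ | * _).
apply: eq_cexp => M; rewrite rmorphM; congr (_ * _).
by apply/eqP; rewrite eq_complex /= oppr0 !eqxx.
Qed.

Lemma cexp_real_power_trace2 (g : UR -> R) (B : R) l m : bounded_measurable g ->
  (forall M, `|g M| <= B) -> (0 < l)%N -> (0 < m)%N ->
  `|cexp mu (fun M => (g M)%:C * power_trace l M * power_trace m M)| * 2 <=
  (B ^+ 2 * l%:R + m%:R)%:C.
Proof.
move=> bg gB l0 m0; have bgc := bounded_cmeasurable_real bg.
have bl := @bounded_power_trace R n l; have bm := @bounded_power_trace R n m.
have bgl := bounded_cmeasurableM bgc bl.
have bll := bounded_cmeasurableM bl (bounded_cmeasurable_conj bl).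
have B0 : 0 <= B := le_trans (normr_ge0 _) (gB (unitary1 R n)).
apply: le_trans (cexp_amgm mu bgl bm) _; rewrite rmorphD lerD //; last first.
  by rewrite haar_power_trace_second_moment // rmorph_nat ler_nat geq_minl.
apply: (@le_trans _ _ (cexp mu (fun M => (B ^+ 2)%:C *
    (power_trace l M * Num.conj (power_trace l M))))).
  apply: cexp_le.
  - by apply: bounded_cmeasurableM => //; exact: bounded_cmeasurable_conj.
  - exact: bounded_cmeasurableZ.
  - move=> M; rewrite -!normCK normrM exprMn ler_wpM2r ?exprn_ge0 //.
    rewrite normc_def /= expr0n addr0 sqrtr_sqr -rmorphXn lecR.
    by rewrite lerXn2r ?nnegrE // (le_trans _ (gB M)).
rewrite cexpZ // haar_power_trace_second_moment // [leRHS]rmorphM ler_wpM2l ?ler0c ?exprn_ge0 //.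
by rewrite rmorph_nat ler_nat geq_minl.
Qed.

Variables (c : nat -> C) (d : nat).

Definition linear_statistic (M : UR) : R :=
  \sum_(j < d) 2 * complex.Re (c j.+1 * power_trace j.+1 M).

Local Notation S := linear_statistic.

Definition linear_statistic_gradient (M : UR) : 'M[C]_n :=
  \sum_(j < d) ((j.+1%:R * c j.+1) *: unitary_val M ^+ j.+1 -
     (j.+1%:R * Num.conj (c j.+1)) *: (unitary_val M ^+ j.+1)^t*).

Lemma linear_statisticE M : (S M)%:C = \sum_(j < d)
  (c j.+1 * power_trace j.+1 M + Num.conj (c j.+1 * power_trace j.+1 M)).
Proof.
rewrite rmorph_sum; apply: eq_bigr => j _; set z := _ * power_trace _ _.
by rewrite rmorphM rmorph_nat -addcJ.
Qed.

Lemma has_gradient_linear_statistic :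
  has_gradient (fun M => (S M)%:C) linear_statistic_gradient.
Proof.
have H (j : 'I_d) : has_gradient (fun M : UR => c j.+1 * power_trace j.+1 M +
     Num.conj (c j.+1 * power_trace j.+1 M))
   (fun M : UR => (c j.+1 *: (j.+1%:R *: unitary_val M ^+ j.+1) +
     - (c j.+1 *: (j.+1%:R *: unitary_val M ^+ j.+1))^t*)).
  have G := has_gradientZ (c j.+1) (has_gradient_power_trace R n j.+1).
  exact: has_gradientD G (has_gradient_conj G).
have := has_gradient_sum (index_enum 'I_d) H.
rewrite (_ : (fun M => \sum_(_ <- _) _) = (fun M => (S M)%:C)); last first.
  by apply/funext => M; rewrite linear_statisticE.
congr has_gradient; apply/funext => M; apply: eq_bigr => j _.
rewrite scalerA mulrC; congr (_ - _).
by apply/matrixP => k l; rewrite !mxE !rmorphM rmorph_nat /=; ring.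
Qed.

Lemma bounded_linear_statistic : bounded_measurable S.
Proof.
have [/bounded_cmeasurable_Re b _ _] := has_gradient_linear_statistic; exact: b.
Qed.

Variables (h dh : R -> R).
Hypothesis ch : continuous h.
Hypothesis cdh : continuous dh.
Hypothesis taylor : forall A : R, exists K : R, forall x y, `|x| <= A -> `|y| <= A ->
  `|h y - h x - dh x * (y - x)| <= K * (y - x) ^+ 2.
Variables (B0 B1 : R).
Hypothesis hB : forall x, `|h x| <= B0.
Hypothesis dhB : forall x, `|dh x| <= B1.

Lemma bounded_measurable_h : bounded_measurable (fun M => h (S M)).
Proof.
split; last by exists B0 => M; exact: hB.
apply: measurableT_comp; first exact: continuous_measurable_fun.
by case: bounded_linear_statistic.
Qed.

Lemma bounded_measurable_dh : bounded_measurable (fun M => dh (S M)).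
Proof.
split; last by exists B1 => M; exact: dhB.
apply: measurableT_comp; first exact: continuous_measurable_fun.
by case: bounded_linear_statistic.
Qed.

(** Chain rule. The statistic is bounded by some A on the whole group, so a Taylor bound on [-A, A]
    is enough; its remainder is quadratic in an increment of first order. *)
Lemma has_gradient_comp : has_gradient (fun M => (h (S M))%:C)
  (fun M => (dh (S M))%:C *: linear_statistic_gradient M).
Proof.
have G := has_gradient_linear_statistic; have [bS bG GT] := G.
have bdh := bounded_cmeasurable_real bounded_measurable_dh.
split; first exact: bounded_cmeasurable_real bounded_measurable_h.
  move=> i j; under eq_fun do rewrite mxE.
  exact: bounded_cmeasurableM.
move=> P hP; have [_ [A SA]] := bounded_linear_statistic.
have [K KA] := taylor A.
have h1 := infinitesimalM (infinitesimal0l P bdh) (GT P hP).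
have lip := has_gradient_lipschitz G hP.
have h2 := infinitesimalM lip lip.
have [B FB] := infinitesimalZ `|K|%:C h2.
have h3 : infinitesimal P 2 (fun _ M M' =>
    (h (S M') - h (S M) - dh (S M) * (S M' - S M))%:C).
  exists B => w M M' w1 MM'; apply: le_trans (FB w M M' w1 MM').
  rewrite -!rmorphB -!rmorphM /= !normc_real lecR (le_trans (KA _ _ (SA M) (SA M'))) //.
  rewrite -expr2 normrM normr_id [X in _ <= _ * X]ger0_norm ?sqr_ge0 //.
  by rewrite ler_wpM2r ?sqr_ge0 // ler_norm.
apply: (eq_infinitesimal (infinitesimalD h3 h1)) => w M M' _.
by rewrite -scalemxAr mxtraceZ; exact: complex_taylor_split.
Qed.

Lemma bounded_trace_unitary_pow j k : bounded_cmeasurable (fun M : UR =>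
  \tr (unitary_val M ^+ j *m (unitary_val M ^+ k)^t*)).
Proof. exact: bounded_trace_pow. Qed.

Let Eh j := cexp mu (fun M => (h (S M))%:C * power_trace j M).
Let Edh := cexp mu (fun M => (dh (S M))%:C).
Let cross j k := cexp mu (fun M =>
  (dh (S M))%:C * \tr (unitary_val M ^+ j *m (unitary_val M ^+ k)^t*)).
Let sumE j := cexp mu (fun M => (dh (S M))%:C * power_trace j M).
Let prodE l m := cexp mu (fun M => (h (S M))%:C * power_trace l M * power_trace m M).

(** The Schwinger-Dyson equation for h(S) at the power j + 1, with the summand l = 0 set apart
    because p_0 = n. [sumE] comes from the powers in the gradient of S and [cross] from their
    adjoints. *)
Lemma stein_schwinger_dyson j :
  n%:R * Eh j.+1 + \sum_(l < j) prodE l.+1 (j - l) +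
  \sum_(k < d) (k.+1%:R * c k.+1 * sumE (j.+1 + k.+1) -
    k.+1%:R * Num.conj (c k.+1) * cross j.+1 k.+1) = 0.
Proof.
have bh := bounded_cmeasurable_real bounded_measurable_h.
have bdh := bounded_cmeasurable_real bounded_measurable_dh.
have bp k := @bounded_power_trace R n k.
have bt k l := bounded_trace_unitary_pow k l.
have bhp k := bounded_cmeasurableM bh (bp k).
rewrite -[RHS](schwinger_dyson hmu j.+1 has_gradient_comp); congr (_ + _).
  rewrite /Eh /prodE -cexpZ // -cexp_sum => [|l _]; last exact: bounded_cmeasurableM.
  rewrite -cexpD; [|exact: bounded_cmeasurableZ|by apply: bounded_cmeasurable_sum => l _; exact: bounded_cmeasurableM].
  apply: eq_cexp => M; rewrite big_ord_recl subn0 power_trace0 mulrDr.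
  congr (_ + _); first by rewrite mulrCA.
  rewrite big_distrr /=.
  by apply: eq_bigr => l _; rewrite mulrA /bump add1n subSS.
transitivity (cexp mu (fun M => \sum_(k < d) (k.+1%:R * c k.+1 *
    ((dh (S M))%:C * power_trace (j.+1 + k.+1) M) -
    k.+1%:R * Num.conj (c k.+1) * ((dh (S M))%:C *
      \tr (unitary_val M ^+ j.+1 *m (unitary_val M ^+ k.+1)^t*))))).
  rewrite cexp_sum => [|k _]; last first.
    by apply: bounded_cmeasurableB; apply: bounded_cmeasurableZ; exact: bounded_cmeasurableM.
  apply: eq_bigr => k _; have b1 := bounded_cmeasurableM bdh (bp (j.+1 + k.+1)%N).
  have b2 := bounded_cmeasurableM bdh (bt j.+1 k.+1).
  by rewrite /sumE /cross cexpB ?cexpZ //; exact: bounded_cmeasurableZ.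
apply: eq_cexp => M; rewrite -scalemxAr mxtraceZ mulmx_sumr linear_sum /= mulr_sumr.
apply: eq_bigr => k _; rewrite mulmxBr raddfB /= -!scalemxAr !mxtraceZ mulmxE -exprD.
by rewrite -/(power_trace _ _); ring.
Qed.

Variable A : R.
Hypothesis cA : \sum_(j < d) `|c j.+1| <= A%:C.
(** B0^2 + 1 comes from the products p_l p_m. The rest comes from the two gradient sums, bounded by
    d A (B1^2 + 2 d) and d A (B1^2 + d), where d <= d^2. *)
Let W := B0 ^+ 2 + 1 + A * (2 * B1 ^+ 2 + 3).

Lemma stein_schwinger_dyson_bound j : (j < d)%N ->
  `|n%:R * Eh j.+1 - n%:R * (j.+1%:R * Num.conj (c j.+1)) * Edh| * 2 <=
  (d%:R ^+ 2 * W)%:C.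
Proof.
move=> jd.
have bdh := bounded_measurable_dh; have bh := bounded_measurable_h.
have dhS M : `|dh (S M)| <= B1 by [].
have hS M : `|h (S M)| <= B0 by [].
(* The diagonal term k = j equals n E [dh(S)], since M^(j+1) is unitary; it is the main term and is
   removed from the error. *)
pose other (k : nat) := if k == j then 0 else cross j.+1 k.+1.
have -> : n%:R * Eh j.+1 - n%:R * (j.+1%:R * Num.conj (c j.+1)) * Edh =
   - (\sum_(l < j) prodE l.+1 (j - l)) - \sum_(k < d) k.+1%:R * c k.+1 * sumE (j.+1 + k.+1)
   + \sum_(k < d) k.+1%:R * Num.conj (c k.+1) * other k.
  have crossd : cross j.+1 j.+1 = n%:R * Edh.
    rewrite -cexpZ; last exact: bounded_cmeasurable_real.
    by apply: eq_cexp => M; rewrite unitary_pow mxtrace1 mulrC.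
  have := stein_schwinger_dyson j; rewrite sumrB.
  have -> : \sum_(k < d) k.+1%:R * Num.conj (c k.+1) * cross j.+1 k.+1 =
      j.+1%:R * Num.conj (c j.+1) * (n%:R * Edh) +
      \sum_(k < d) k.+1%:R * Num.conj (c k.+1) * other k.
    rewrite (bigD1 (Ordinal jd)) //= crossd; congr (_ + _).
    rewrite [RHS](bigD1 (Ordinal jd)) //= /other eqxx mulr0 add0r.
    by apply: eq_bigr => k /eqP kj; rewrite ifN //; apply/eqP => e; case: kj; exact: val_inj.
  have key (X P Q a O : C) : X + P + (Q - (a + O)) = 0 -> X - a = - P - Q + O.
    move=> E; transitivity (X + P + (Q - (a + O)) - P - Q + O); first by ring.
    by rewrite E sub0r.
  by move=> /key <-; rewrite [X in _ = _ - X]mulrCA [X in _ = _ - X]mulrA.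
have nat_le (a b : nat) : (a <= b)%N -> a%:R <= b%:R :> R by rewrite ler_nat.
have B12 : 0 <= B1 ^+ 2 by exact: sqr_ge0.
have B02 : 0 <= B0 ^+ 2 by exact: sqr_ge0.
have d0 : 0 <= d%:R :> R by [].
have jR : j.+1%:R <= d%:R :> R by exact: nat_le.
have N1 : `|\sum_(l < j) prodE l.+1 (j - l)| * 2 <= (d%:R ^+ 2 * (B0 ^+ 2 + 1))%:C.
  apply: le_trans (ler_wpM2r _ (ler_norm_sum _ _ _)) _ => //; rewrite mulr_suml.
  apply: (@le_trans _ _ (\sum_(l < d) (d%:R * (B0 ^+ 2 + 1))%:C)); last first.
    by rewrite sumr_const card_ord -rmorphMn /= -[_ *+ d]mulr_natl expr2 mulrA.
  rewrite (big_ord_widen d (fun l => `|prodE l.+1 (j - l)| * 2)); last exact: ltnW.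
  rewrite big_mkcond; apply: ler_sum => l _; case: ifP => lj; last first.
    by rewrite ler0c mulr_ge0 // addr_ge0.
  have jl : (0 < j - l)%N by rewrite subn_gt0.
  apply: le_trans (cexp_real_power_trace2 bh hS (ltn0Sn l) jl) _; rewrite lecR.
  have l1 : l.+1%:R <= d%:R :> R by exact: nat_le.
  have l2 : (j - l)%:R <= d%:R :> R.
    by apply: nat_le; rewrite (leq_trans (leq_subr _ _)) // ltnW.
  by rewrite mulrDr mulr1 lerD // mulrC ler_wpM2r.
have bound (x : nat -> C) (v : nat -> C) (T : R) : (forall k, (k < d)%N -> `|x k| = `|c k.+1|) ->
    0 <= T -> (forall k, (k < d)%N -> `|v k| * 2 <= T%:C) ->
    `|\sum_(k < d) k.+1%:R * x k * v k| * 2 <= (d%:R * A * T)%:C.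
  move=> xc T0 vT; apply: le_trans (ler_wpM2r _ (ler_norm_sum _ _ _)) _ => //.
  rewrite mulr_suml -mulrA rmorphM rmorphM /=.
  apply: (@le_trans _ _ (d%:R%:C * ((\sum_(k < d) `|c k.+1|) * T%:C))); last first.
    by rewrite ler_wpM2l ?ler0c // ler_wpM2r ?ler0c.
  rewrite mulr_suml mulr_sumr; apply: ler_sum => k _.
  rewrite !normrM xc // -!mulrA rmorph_nat normr_nat.
  by rewrite ler_pM ?mulr_ge0 ?ler_nat // ler_wpM2l // vT.
have N2 : `|\sum_(k < d) k.+1%:R * c k.+1 * sumE (j.+1 + k.+1)| * 2 <=
    (d%:R * A * (B1 ^+ 2 + 2 * d%:R))%:C.
  apply: (bound (fun k => c k.+1) (fun k => sumE (j.+1 + k.+1))) => //.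
    by rewrite addr_ge0 // mulr_ge0.
  move=> k kd; apply: le_trans (cexp_real_power_trace bdh dhS _) _ => //.
  rewrite lecR lerD2l natrD mulrDl mul1r lerD //; exact: nat_le.
have N3 : `|\sum_(k < d) k.+1%:R * Num.conj (c k.+1) * other k| * 2 <=
    (d%:R * A * (B1 ^+ 2 + d%:R))%:C.
  apply: (bound (fun k => Num.conj (c k.+1)) other); first by move=> k _; exact: norm_conjC.
    by rewrite addr_ge0.
  move=> k kd; rewrite /other; case: eqP => [_|/eqP kj].
    by rewrite normr0 mul0r ler0c addr_ge0.
  have kR : k.+1%:R <= d%:R :> R by exact: nat_le.
  rewrite /cross; have [kj'|kj'] := leqP k j.
    have jk : (0 < j.+1 - k.+1)%N by rewrite subSS subn_gt0 ltn_neqAle kj kj'.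
    rewrite (@eq_cexp _ _ _ _ _ (fun M => (dh (S M))%:C * power_trace (j.+1 - k.+1) M)); last first.
      by move=> M; rewrite trace_unitary_powJ ltnS kj'.
    apply: le_trans (cexp_real_power_trace bdh dhS jk) _; rewrite lecR lerD2l.
    by apply: nat_le; rewrite (leq_trans (leq_subr _ _)).
  have jk : (0 < k.+1 - j.+1)%N by rewrite subSS subn_gt0.
  rewrite (@eq_cexp _ _ _ _ _ (fun M => (dh (S M))%:C * Num.conj (power_trace (k.+1 - j.+1) M))); last first.
    by move=> M; rewrite trace_unitary_powJ ltnS leqNgt kj'.
  apply: le_trans (cexp_real_power_trace_conj bdh dhS jk) _; rewrite lecR lerD2l.
  by apply: nat_le; rewrite (leq_trans (leq_subr _ _)).
have dd : (0 < d)%N by rewrite (leq_ltn_trans _ jd).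
have d1 : 1 <= d%:R :> R by rewrite ler1n.
have A0 : 0 <= A by rewrite -ler0c (le_trans _ cA) // sumr_ge0.
apply: (@le_trans _ _ ((d%:R ^+ 2 * (B0 ^+ 2 + 1))%:C +
  (d%:R * A * (B1 ^+ 2 + 2 * d%:R))%:C + (d%:R * A * (B1 ^+ 2 + d%:R))%:C)).
  apply: le_trans (ler_wpM2r _ (ler_normD _ _)) _ => //.
  rewrite mulrDl lerD // (le_trans (ler_wpM2r _ (ler_normD _ _))) //.
  by rewrite mulrDl !normrN lerD.
rewrite -!rmorphD lecR /W.
have : d%:R * A * B1 ^+ 2 <= d%:R * d%:R * A * B1 ^+ 2.
  rewrite ler_wpM2r // ler_wpM2r // -[leLHS]mulr1 ler_wpM2l //.
rewrite -subr_ge0 => H; rewrite -subr_ge0.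
have -> : d%:R ^+ 2 * (B0 ^+ 2 + 1 + A * (2 * B1 ^+ 2 + 3)) -
  (d%:R ^+ 2 * (B0 ^+ 2 + 1) + d%:R * A * (B1 ^+ 2 + 2 * d%:R) +
   d%:R * A * (B1 ^+ 2 + d%:R)) =
  2 * (d%:R * d%:R * A * B1 ^+ 2 - d%:R * A * B1 ^+ 2) :> R by ring.
by rewrite mulr_ge0.
Qed.

(** S h(S) is the sum over j of c_j p_j h(S) and its conjugate. Each mean is replaced by j conj c_j
    E [dh(S)] at the cost of the preceding lemma, and 2 j |c_j|^2 adds up to the variance of the
    limit of S. *)
Lemma stein_haar_bound :
  `|\int[mu]_M (S M * h (S M)) -
    (\sum_(j < d) 2 * (j.+1%:R * Normc.normc (c j.+1) ^+ 2)) * \int[mu]_M dh (S M)|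
  <= A * W * d%:R ^+ 2 / n%:R.
Proof.
have bdh := bounded_measurable_dh; have bh := bounded_measurable_h.
have bhc := bounded_cmeasurable_real bh.
have bp k := @bounded_power_trace R n k.
set s := \sum_(j < d) _; set x := _ - _.
have n0 : 0 < n%:R :> R by rewrite ltr0n.
rewrite ler_pdivlMr //.
pose D j := n%:R * Eh j.+1 - n%:R * (j.+1%:R * Num.conj (c j.+1)) * Edh.
have xE : (x * n%:R)%:C = \sum_(j < d) (c j.+1 * D j + Num.conj (c j.+1 * D j)).
  have -> : (x * n%:R)%:C = n%:R * (cexp mu (fun M => (S M * h (S M))%:C) - s%:C * Edh).
    by rewrite /x /Edh !cexp_real rmorphM rmorph_nat mulrC -rmorphM -rmorphB.
  have -> : cexp mu (fun M => (S M * h (S M))%:C) =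
      \sum_(j < d) (c j.+1 * Eh j.+1 + Num.conj (c j.+1 * Eh j.+1)).
    transitivity (cexp mu (fun M => \sum_(j < d)
        (c j.+1 * ((h (S M))%:C * power_trace j.+1 M) +
        Num.conj (c j.+1 * ((h (S M))%:C * power_trace j.+1 M))))).
      apply: eq_cexp => M.
      have -> : (S M * h (S M))%:C = (S M)%:C * (h (S M))%:C by rewrite rmorphM.
      rewrite linear_statisticE mulr_suml.
      apply: eq_bigr => j _; rewrite mulrDl !rmorphM /=.
      have -> : Num.conj (h (S M))%:C = (h (S M))%:C.
        by apply/eqP; rewrite eq_complex /= oppr0 !eqxx.
      by ring.
    have b j : bounded_cmeasurable (fun M => c j * ((h (S M))%:C * power_trace j M)).
      by apply: bounded_cmeasurableZ; exact: bounded_cmeasurableM.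
    rewrite cexp_sum => [|j _]; last first.
      by apply: bounded_cmeasurableD => //; exact: bounded_cmeasurable_conj.
    apply: eq_bigr => j _; rewrite cexpD //; last exact: bounded_cmeasurable_conj.
    by rewrite cexp_conj // cexpZ //; exact: bounded_cmeasurableM.
  have EdhR : Num.conj Edh = Edh.
    by rewrite /Edh cexp_real; apply/eqP; rewrite eq_complex /= oppr0 !eqxx.
  rewrite mulrBr /s rmorph_sum /= mulr_suml !mulr_sumr -sumrB; apply: eq_bigr => j _.
  have -> : (2 * (j.+1%:R * Normc.normc (c j.+1) ^+ 2))%:C =
      2 * j.+1%:R * (c j.+1 * Num.conj (c j.+1)).
    have nE : (Normc.normc (c j.+1) ^+ 2)%:C = c j.+1 * Num.conj (c j.+1).
      by rewrite -normCK normc_def -rmorphXn /=; congr (_ ^+ 2)%:C; case: (c j.+1).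
    rewrite mulrA [LHS](rmorphM (real_complex R)) /= nE; congr (_ * _).
    by rewrite rmorphM !rmorph_nat.
  rewrite /D !rmorphM !rmorphB !rmorphM /= conjCK !conjC_nat EdhR.
  by ring.
rewrite -lecR (le_trans _ (_ : `|(x * n%:R)%:C| <= _)) //.
  by rewrite normc_real normrM [`|n%:R|]gtr0_norm.
rewrite xE; apply: le_trans (ler_norm_sum _ _ _) _.
apply: (@le_trans _ _ (\sum_(j < d) `|c j.+1| * (d%:R ^+ 2 * W)%:C)).
  apply: ler_sum => j _; apply: le_trans (ler_normD _ _) _.
  rewrite norm_conjC -mulr2n -[leLHS]mulr_natr normrM -[leLHS]mulrA ler_wpM2l //.
  exact: stein_schwinger_dyson_bound.
have A0 : 0 <= A by rewrite -ler0c (le_trans _ cA) // sumr_ge0.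
rewrite -mulr_suml (_ : (A * W * _)%:C = A%:C * (d%:R ^+ 2 * W)%:C); last first.
  by rewrite -rmorphM /=; congr (_%:C); ring.
rewrite ler_wpM2r // ler0c mulr_ge0 ?sqr_ge0 //.
by rewrite /W !addr_ge0 ?sqr_ge0 // mulr_ge0 // addr_ge0 // mulr_ge0 // sqr_ge0.
Qed.

End stein_haar.

Local Close Scope sesquilinear_scope.

(** * The Gaussian density and its Stein equation *)

Section real_integrable.
Context d (T : measurableType d) (R : realType).
Variables (mu : {measure set T -> \bar R}) (D : set T) (mD : measurable D).
Implicit Types f g : T -> R.

Lemma integrable_EFinZ (k : R) f : mu.-integrable D (EFin \o f) ->
  mu.-integrable D (EFin \o (fun x => k * f x)).
Proof.
move=> /(integrableZl mD k); apply: eq_integrable => // x _.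
Qed.

Lemma integrable_EFinD f g : mu.-integrable D (EFin \o f) ->
  mu.-integrable D (EFin \o g) -> mu.-integrable D (EFin \o (fun x => f x + g x)).
Proof.
by move=> i1 i2; have := integrableD mD i1 i2; apply: eq_integrable.
Qed.

Lemma integrable_EFinB f g : mu.-integrable D (EFin \o f) ->
  mu.-integrable D (EFin \o g) -> mu.-integrable D (EFin \o (fun x => f x - g x)).
Proof.
by move=> i1 i2; have := integrableB mD i1 i2; apply: eq_integrable.
Qed.

End real_integrable.

Section gaussian_density.
Variables (R : realType) (s : R).
Hypothesis s0 : 0 < s.
Local Notation leb := (@lebesgue_measure R).
Local Notation v := (s ^+ 2).
Local Notation phi := (normal_pdf 0 s).
Local Notation kappa := ((normal_peak s)^-1).

Let sn0 : s != 0. Proof. by rewrite gt_eqF. Qed.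
Let v0 : 0 < v. Proof. by rewrite exprn_gt0. Qed.

Lemma normal_pdf_expR x : phi x = normal_peak s * expR (- (x ^+ 2 / (v *+ 2))).
Proof. by rewrite normal_pdfE // /normal_fun subr0 mulNr. Qed.

Lemma normal_pdf_gt0 x : 0 < phi x.
Proof. by rewrite normal_pdf_expR mulr_gt0 ?expR_gt0 // normal_peak_gt0. Qed.

Lemma normal_pdfN x : phi (- x) = phi x.
Proof. by rewrite !normal_pdf_expR sqrrN. Qed.

Lemma is_derive_normal_pdf (x : R) : is_derive x (1 : R) phi (- (x / v) * phi x).
Proof.
have -> : phi = (fun x => normal_peak s * expR (- (x ^+ 2 / (v *+ 2)))).
  by apply/funext => y; rewrite normal_pdf_expR.
apply: is_derive_eq.
rewrite -[(v *+ 2)]mulr_natr /GRing.scale /=.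
by field; rewrite gt_eqF.
Qed.

Lemma continuous_phi : continuous phi.
Proof. exact: continuous_normal_pdf. Qed.

Lemma measurable_phi (D : set R) : measurable_fun D phi.
Proof. by apply: measurable_funTS; apply: measurable_normal_pdf. Qed.

Lemma cvg_normal_pdf : phi x @[x --> +oo] --> 0.
Proof.
have -> : (phi : R -> R) = (fun x => normal_peak s * gauss_fun (x / (Num.sqrt (v *+ 2)))).
  apply/funext => x; rewrite normal_pdf_expR /gauss_fun exprMn exprVn sqr_sqrtr //.
  by rewrite mulrn_wge0 // ltW.
rewrite -[X in _ --> X](mulr0 (normal_peak s)).
apply: cvgM; first exact: cvg_cst.
apply: (cvg_comp _ _ _ (@cvg_gauss_fun R)).
apply: gt0_cvgMly; last exact: cvg_id.
by rewrite invr_gt0 sqrtr_gt0 pmulrn_lgt0.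
Qed.

Lemma integral_id_normal_pdf (x : R) : 0 <= x ->
  (\int[leb]_(y in `[x, +oo[) (y * phi y)%:E = (v * phi x)%:E)%E.
Proof.
move=> x0; rewrite (@ge0_continuous_FTC2y _ _ (fun y => - (v * phi y)) _ 0).
- by rewrite sub0e EFinN oppeK.
- by move=> y xy; rewrite mulr_ge0 ?normal_pdf_ge0 // (le_trans x0).
- apply: continuous_subspaceT => y; apply: cvgM; first exact: cvg_id.
  exact: continuous_phi.
- rewrite [X in _ --> X](_ : 0 = - (v * 0)); last by rewrite mulr0 oppr0.
  apply: cvgN; apply: cvgM; first exact: cvg_cst.
  exact: cvg_normal_pdf.
- by move=> y _; have := is_derive_normal_pdf y => ?; exact: ex_derive.
- apply: cvg_at_right_filter; apply: cvgN; apply: cvgM; first exact: cvg_cst.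
  exact: continuous_phi.
- move=> y _; have ? := is_derive_normal_pdf y.
  rewrite derive1E derive_val /GRing.scale /=.
  by field; rewrite gt_eqF.
Qed.

Lemma integrable_normal_pdf_itv (D : set R) : measurable D ->
  leb.-integrable D (fun y => (phi y)%:E).
Proof.
move=> mD; apply: (integrableS measurableT) => //.
exact: integrable_normal_pdf.
Qed.

(** For y >= x >= 0 one has y^2 >= x^2 + (y - x)^2, so the density at y is at most [kappa * phi x]
    times the normal density centred at x. Here [kappa] is the inverse peak of the density. *)
Lemma integral_normal_pdf_tail_le x : 0 <= x ->
  (\int[leb]_(y in `[x, +oo[) (phi y)%:E <= (kappa * phi x)%:E)%E.
Proof.
move=> x0.
apply: (@le_trans _ _ (\int[leb]_(y in `[x, +oo[) (kappa * phi x * normal_pdf x s y)%:E)%E).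
  apply: ge0_le_integral => //=.
  - by move=> y _; rewrite lee_fin normal_pdf_ge0.
  - apply/measurable_EFinP; exact: measurable_phi.
  - apply/measurable_EFinP; apply: measurable_funM => //.
    by apply: measurable_funTS; apply: measurable_normal_pdf.
  - move=> y; rewrite in_itv /= andbT => xy; rewrite lee_fin.
    rewrite !normal_pdf_expR normal_pdfE // /normal_fun [kappa * _]mulrA mulVf; last first.
      by rewrite gt_eqF // normal_peak_gt0.
    rewrite mul1r mulrCA ler_wpM2l ?normal_peak_ge0 // -expRD ler_expR.
    rewrite mulNr -opprD lerN2 -mulrDl ler_pM2r ?invr_gt0 ?pmulrn_lgt0 //.
    by nra.
under eq_integral do rewrite EFinM.
rewrite integralZl //=; last first.
  by apply: (integrableS measurableT) => //; exact: integrable_normal_pdf.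
rewrite -[leRHS]mule1 lee_wpmul2l //.
  by rewrite lee_fin mulr_ge0 ?normal_pdf_ge0 // invr_ge0 normal_peak_ge0.
rewrite -(integral_normal_pdf x s); apply: ge0_subset_integral => //=.
  by apply/measurable_EFinP; exact: measurable_normal_pdf.
by move=> y _; rewrite lee_fin normal_pdf_ge0.
Qed.

(** Here y^2 = x^2 + (y - x)^2 + 2 x (y - x), and the cross term pays for the factor x (y - x)
    through t <= exp t with t = x (y - x) / v. *)
Lemma integral_dist_normal_pdf_tail_le x : 0 <= x ->
  (\int[leb]_(y in `[x, +oo[) (x * (y - x) * phi y)%:E <= (v * kappa * phi x)%:E)%E.
Proof.
move=> x0.
apply: (@le_trans _ _ (\int[leb]_(y in `[x, +oo[) (v * kappa * phi x * normal_pdf x s y)%:E)%E).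
  apply: ge0_le_integral => //=.
  - move=> y; rewrite in_itv /= andbT => xy.
    by rewrite lee_fin !mulr_ge0 ?normal_pdf_ge0 // subr_ge0.
  - apply/measurable_EFinP; apply: measurable_funM; last exact: measurable_phi.
    by apply: measurable_funM => //; apply: measurable_funB.
  - apply/measurable_EFinP; apply: measurable_funM => //.
    by apply: measurable_funTS; apply: measurable_normal_pdf.
  - move=> y; rewrite in_itv /= andbT => xy; rewrite lee_fin.
    rewrite !normal_pdf_expR normal_pdfE // /normal_fun.
    have pk : normal_peak s != 0 by rewrite gt_eqF // normal_peak_gt0.
    rewrite -[v * kappa * _ ]mulrA [kappa * _]mulrA mulVf // mul1r.
    rewrite [X in X <= _]mulrCA -[leRHS]mulrA [expR _ * (_ * _)]mulrCA [v * _]mulrCA.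
    rewrite ler_wpM2l ?normal_peak_ge0 // -expRD.
    have -> : - (x ^+ 2 / (v *+ 2)) + - (y - x) ^+ 2 / (v *+ 2) =
        - (y ^+ 2 / (v *+ 2)) + x * (y - x) / v.
      by rewrite -[(v *+ 2)]mulr_natr; field; rewrite gt_eqF.
    rewrite expRD mulrCA [leLHS]mulrC ler_wpM2l ?expR_ge0 //.
    rewrite -ler_pdivrMl // mulrC.
    rewrite (le_trans _ (expR_ge1Dx _)) // lerDr //.
under eq_integral do rewrite EFinM.
rewrite integralZl //=; last first.
  by apply: (integrableS measurableT) => //; exact: integrable_normal_pdf.
rewrite -[leRHS]mule1 lee_wpmul2l //.
  by rewrite lee_fin !mulr_ge0 ?normal_pdf_ge0 ?invr_ge0 ?normal_peak_ge0 // ltW.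
rewrite -(integral_normal_pdf x s); apply: ge0_subset_integral => //=.
  by apply/measurable_EFinP; exact: measurable_normal_pdf.
by move=> y _; rewrite lee_fin normal_pdf_ge0.
Qed.

Local Notation m1 := (2 * (v * phi 0)).

Let m1_ge0 : 0 <= m1.
Proof. by rewrite mulr_ge0 // mulr_ge0 ?normal_pdf_ge0 // ltW. Qed.

(** [m1] is the first absolute moment of the normal law; it measures the distance of g from its
    Gaussian mean in the bounds below. *)
Lemma integral_abs_normal_pdf : (\int[leb]_y (`|y : R| * phi y)%:E = m1%:E)%E.
Proof.
rewrite (@ge0_symfun_integralT _ (fun y => `|y| * phi y)) /=.
- rewrite -set_itvcy.
  have -> : (\int[leb]_(y in `[0%R, +oo[) (`|y| * phi y)%:E =
             \int[leb]_(y in `[0%R, +oo[) (y * phi y)%:E)%E.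
    by apply: eq_integral => y; rewrite inE /= in_itv /= andbT => y0; rewrite ger0_norm.
  by rewrite integral_id_normal_pdf // EFinM.
- by move=> y; rewrite mulr_ge0 ?normal_pdf_ge0.
- move=> y; apply: cvgM; last exact: continuous_phi.
  exact: norm_continuous.
- by move=> y /=; rewrite normrN normal_pdfN.
Qed.

Lemma integrable_abs_normal_pdf : leb.-integrable setT (fun y : R => (`|y| * phi y)%:E).
Proof.
apply/integrableP; split.
  apply/measurable_EFinP; apply: measurable_funM; last exact: measurable_phi.
  exact: measurable_realfun.normr_measurable.
under eq_integral => y _ do rewrite gee0_abs ?lee_fin ?mulr_ge0 ?normal_pdf_ge0 //.
by rewrite integral_abs_normal_pdf ltry.
Qed.

Lemma integrable_normal_pdf_growth (f : R -> R) (a : R) : continuous f ->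
  (forall y, `|f y| <= `|y| + a) -> leb.-integrable setT (fun y => (f y * phi y)%:E).
Proof.
move=> cf fa.
have : leb.-integrable setT (fun y => ((`|y| * phi y)%:E + (a * phi y)%:E)%E).
  apply: integrableD => //; first exact: integrable_abs_normal_pdf.
  under eq_fun do rewrite EFinM.
  by apply: integrableZl => //; exact: integrable_normal_pdf.
apply: le_integrable => //.
  apply/measurable_EFinP; apply: measurable_funM; last exact: measurable_phi.
  exact: continuous_measurable_fun.
move=> y _; rewrite -EFinD -mulrDl !abse_EFin lee_fin !normrM.
by rewrite ler_wpM2r // (le_trans (fa y)) // ler_norm.
Qed.

Section tail.
Variables (g : R -> R) (c : R).
Hypothesis gL : forall x y, `|g x - g y| <= `|x - y|.
Hypothesis gc : forall y, `|g y - c| <= `|y| + m1.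

Let J x := \int[leb]_(y in `[x, +oo[) ((g y - c) * phi y).

Lemma lipschitz1_continuous : continuous g.
Proof.
move=> x; apply/cvgrPdist_lt => e e0; near=> y.
apply: le_lt_trans (gL x y) _; near: y.
exact: cvgr_dist_lt.
Unshelve. all: by end_near. Qed.

Lemma integrable_centered : leb.-integrable setT (fun y => ((g y - c) * phi y)%:E).
Proof.
apply: (@integrable_normal_pdf_growth (fun y => g y - c) m1) => // y.
by apply: cvgB; [exact: lipschitz1_continuous|exact: cvg_cst].
Qed.

Let intD (f : R -> R) (x : R) : leb.-integrable setT (fun y => (f y)%:E) ->
  leb.-integrable `[x, +oo[ (EFin \o f).
Proof. by apply: integrableS. Qed.

(** By [gc] the integrand is at most (y + [m1]) [phi y]. Its two parts are the explicit first moment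
    of the tail and the tail itself. *)
Lemma stein_tail_bound x : 0 <= x -> `|J x| <= (v + m1 * kappa) * phi x.
Proof.
move=> x0; rewrite /J.
have iJ := intD x integrable_centered.
have iid : leb.-integrable `[x, +oo[ (EFin \o (fun y => y * phi y)).
  apply: intD; apply: (@integrable_normal_pdf_growth id 0); first by move=> y; exact: cvg_id.
  by move=> y; rewrite addr0.
have iphi : leb.-integrable `[x, +oo[ (EFin \o (fun y => m1 * phi y)).
  by apply: intD; under eq_fun do rewrite EFinM; apply: integrableZl => //; exact: integrable_normal_pdf.
apply: (le_trans (le_normr_Rintegral _ iJ)) => //.
apply: (@le_trans _ _ (\int[leb]_(y in `[x, +oo[) (y * phi y + m1 * phi y))).
  apply: le_Rintegral => //.
  - exact: (integrable_norm iJ).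
  - have : leb.-integrable `[x, +oo[ (fun y => ((y * phi y)%:E + (m1 * phi y)%:E)%E).
      exact: integrableD.
    by apply: eq_integrable.
  - move=> y /=; rewrite in_itv /= andbT => xy.
    rewrite normrM [`|phi y|]ger0_norm ?normal_pdf_ge0 // -mulrDl.
    by rewrite ler_wpM2r ?normal_pdf_ge0 // (le_trans (gc y)) // ger0_norm // (le_trans x0).
rewrite RintegralD // [leRHS]mulrDl lerD //.
  by rewrite /Rintegral integral_id_normal_pdf.
rewrite RintegralZl //; last exact: integrable_normal_pdf_itv.
rewrite -[leRHS]mulrA ler_wpM2l //.
rewrite /Rintegral -lee_fin fineK; first exact: integral_normal_pdf_tail_le.
exact/integrable_fin_num/integrable_normal_pdf_itv.
Qed.

(** Since v [phi x] is the integral of y [phi y] over the tail, both terms merge into one integral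
    with weight (g x - c) (y - x) - x (g y - g x). The Lipschitz bound makes this O(x (y - x) + y),
    whereas x J(x) alone would carry a factor x too many. *)
Lemma stein_tail_deriv_bound x : 0 <= x ->
  `|v * (g x - c) * phi x - x * J x| <= (2 * (v * kappa) + m1 * v) * phi x.
Proof.
move=> x0.
have iJ := intD x integrable_centered.
have iid : leb.-integrable `[x, +oo[ (EFin \o (fun y => y * phi y)).
  apply: intD; apply: (@integrable_normal_pdf_growth id 0); first by move=> y; exact: cvg_id.
  by move=> y; rewrite addr0.
have iphi : leb.-integrable `[x, +oo[ (EFin \o phi).
  exact: (integrable_normal_pdf_itv (measurable_itv _)).
have idist : leb.-integrable `[x, +oo[ (EFin \o (fun y => x * (y - x) * phi y)).
  have : leb.-integrable `[x, +oo[ (EFin \o (fun y => x * (y * phi y) - x ^+ 2 * phi y)).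
    by apply: integrable_EFinB => //; apply: integrable_EFinZ.
  by apply: eq_integrable => // y _ /=; congr EFin; ring.
have -> : v * (g x - c) * phi x - x * J x =
   \int[leb]_(y in `[x, +oo[) ((g x - c) * (y * phi y) - x * ((g y - c) * phi y)).
  rewrite RintegralB //=; last 2 first.
  - exact: integrable_EFinZ.
  - exact: integrable_EFinZ.
  rewrite !RintegralZl //; congr (_ - _).
  by rewrite [X in _ = _ * X]/Rintegral integral_id_normal_pdf //=; ring.
have iA : leb.-integrable `[x, +oo[ (EFin \o (fun y => (g x - c) * (y * phi y) - x * ((g y - c) * phi y))).
  by apply: integrable_EFinB => //; apply: integrable_EFinZ.
have iB : leb.-integrable `[x, +oo[ (EFin \o (fun y => 2 * (x * (y - x) * phi y) + m1 * (y * phi y))).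
  by apply: integrable_EFinD => //; apply: integrable_EFinZ.
apply: (le_trans (le_normr_Rintegral _ iA)) => //.
have m1p := m1_ge0.
apply: (@le_trans _ _ (\int[leb]_(y in `[x, +oo[) (2 * (x * (y - x) * phi y) + m1 * (y * phi y)))).
  apply: le_Rintegral => //.
  - exact: (integrable_norm iA).
  - move=> y /=; rewrite in_itv /= andbT => xy.
    have -> : (g x - c) * (y * phi y) - x * ((g y - c) * phi y) =
       ((g x - c) * (y - x) - x * (g y - g x)) * phi y by ring.
    rewrite normrM [`|phi y|]ger0_norm ?normal_pdf_ge0 //.
    rewrite !mulrA -mulrDl ler_wpM2r ?normal_pdf_ge0 //.
    rewrite (le_trans (ler_normB _ _)) // !normrM.
    have h1 : `|g y - g x| <= y - x by rewrite (le_trans (gL y x)) // ger0_norm // subr_ge0.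
    have h2 : `|g x - c| <= x + m1 by rewrite (le_trans (gc x)) // ger0_norm.
    have yx : 0 <= y - x by rewrite subr_ge0.
    rewrite (ger0_norm x0) (ger0_norm yx).
    apply: (@le_trans _ _ ((x + m1) * (y - x) + x * (y - x))).
      by rewrite lerD // ?ler_wpM2r // ler_wpM2l.
    rewrite -subr_ge0.
    rewrite (_ : _ - _ = m1 * x); last by ring.
    by rewrite mulr_ge0.
rewrite RintegralD //; last 2 first.
- exact: integrable_EFinZ.
- exact: integrable_EFinZ.
rewrite !RintegralZl // [leRHS]mulrDl lerD //.
  rewrite -mulrA ler_wpM2l // /Rintegral -lee_fin fineK; first exact: integral_dist_normal_pdf_tail_le.
  exact: integrable_fin_num.
by rewrite /Rintegral integral_id_normal_pdf //= -[leRHS]mulrA.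
Qed.

End tail.
End gaussian_density.

Section line_integrals.
Variable R : realType.
Local Notation leb := (@lebesgue_measure R).
Implicit Types (G h dh : R -> R).

Lemma ge0_Rintegral_oppr G a : continuous G -> (forall x, 0 <= G x) ->
  \int[leb]_(x in `]-oo, - a]) G x = \int[leb]_(x in `[a, +oo[) G (- x).
Proof.
move=> cG G0; rewrite /Rintegral ge0_integration_by_substitutionNy //.
by apply: continuous_subspaceT.
Qed.

(** [G] is the difference of the nonnegative functions G + |G| and |G|, to which
    [ge0_Rintegral_oppr] applies. *)
Lemma Rintegral_oppr G a : continuous G -> leb.-integrable setT (EFin \o G) ->
  \int[leb]_(x in `]-oo, - a]) G x = \int[leb]_(x in `[a, +oo[) G (- x).
Proof.
move=> cG iG.
have cN : continuous (fun x => `|G x|).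
  by move=> x; apply: continuous_comp; [exact: cG|exact: norm_continuous].
have GN x : G x = (G x + `|G x|) - `|G x| by ring.
have iN : leb.-integrable setT (EFin \o (fun x => `|G x|)) by exact: integrable_norm.
have iD : leb.-integrable setT (EFin \o (fun x => G x + `|G x|)).
  exact: integrable_EFinD.
have iopp (F : R -> R) : continuous F -> (forall x, 0 <= F x) -> leb.-integrable setT (EFin \o F) ->
    leb.-integrable `[a, +oo[ (EFin \o (fun x => F (- x))).
  move=> cF F0 iF; apply/integrableP; split.
    apply/measurable_EFinP; apply: measurable_funTS; apply: continuous_measurable_fun => x.
    by apply: continuous_comp; [exact: opp_continuous|exact: cF].
  under eq_integral => y _ do rewrite /= ger0_norm //.
  rewrite -ge0_integration_by_substitutionNy //; last by apply: continuous_subspaceT.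
  have : leb.-integrable `]-oo, (- a)] (EFin \o F) by apply: integrableS iF.
  by move=> /integrableP[_]; under eq_integral => y _ do rewrite /= ger0_norm //.
have cD : continuous (fun x => G x + `|G x|).
  by move=> x; apply: cvgD; [exact: cG|exact: cN].
have D0 x : 0 <= G x + `|G x| by rewrite -lerBlDl sub0r -normrN ler_norm.
under eq_Rintegral do rewrite GN.
under [RHS]eq_Rintegral do rewrite GN.
rewrite [RHS](RintegralB _ (iopp _ cD D0 iD)) //; last exact: (iopp _ cN).
rewrite RintegralB //; [|by apply: integrableS iD|by apply: integrableS iN].
by rewrite (ge0_Rintegral_oppr _ cD D0) (ge0_Rintegral_oppr a cN).
Qed.

Lemma mean_value_oriented h dh (x y : R) :
  (forall z, is_derive z (1 : R) h (dh z)) ->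
  exists2 z, `|z - x| <= `|y - x| & h y - h x = dh z * (y - x).
Proof.
move=> hd.
have hc (a b : R) : {within `[a, b], continuous h}.
  apply: continuous_subspaceT => z; apply: differentiable_continuous.
  by apply/derivable1_diffP; exact: ex_derive.
have [xy|yx|->] := ltgtP x y.
- have [z zxy e] := MVT xy (fun z _ => hd z) (hc x y).
  exists z => //; move: zxy; rewrite in_itv /= => /andP[z1 z2].
  by rewrite !gtr0_norm ?subr_gt0 // lerD2r ltW.
- have [z zxy e] := MVT yx (fun z _ => hd z) (hc y x).
  exists z; last by rewrite -opprB e -mulrN opprB.
  move: zxy; rewrite in_itv /= => /andP[z1 z2].
  by rewrite !ltr0_norm ?subr_lt0 // lerN2 lerD2r ltW.
- by exists y => //; rewrite !subrr mulr0.
Qed.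

Lemma Rintegral_derive_periodic (G g : R -> R) a b : a < b ->
  (forall x, is_derive x (1 : R) G (g x)) -> continuous g -> G b = G a ->
  \int[leb]_(x in `[a, b]) g x = 0.
Proof.
move=> ab dG cg Gab; rewrite /Rintegral (@continuous_FTC2 _ _ G) //.
- by rewrite Gab subee.
- exact: continuous_subspaceT.
- have cG x : {for x, continuous G}.
    by apply: differentiable_continuous; apply/derivable1_diffP; exact: ex_derive.
  by split; [move=> x _; exact: ex_derive|apply: cvg_at_right_filter; exact: cG|
    apply: cvg_at_left_filter; exact: cG].
- by move=> x _; rewrite derive1E; exact: derive_val.
Qed.

End line_integrals.

Section stein_equation.
Variables (R : realType) (s : R).
Hypothesis s0 : 0 < s.
Local Notation leb := (@lebesgue_measure R).
Local Notation v := (s ^+ 2).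
Local Notation phi := (normal_pdf 0 s).
Local Notation kappa := ((normal_peak s)^-1).
Local Notation m1 := (2 * (v * phi 0)).

Let v0 : 0 < v. Proof. by rewrite exprn_gt0. Qed.
Let vn0 : v != 0. Proof. by rewrite gt_eqF. Qed.
Let phin0 x : phi x != 0. Proof. by rewrite gt_eqF // normal_pdf_gt0. Qed.

Section solution.
Variable g : R -> R.
Hypothesis gL : forall x y, `|g x - g y| <= `|x - y|.
Let c := \int[leb]_y (g y * phi y).

Lemma integrable_lipschitz_normal_pdf : leb.-integrable setT (EFin \o (fun y => g y * phi y)).
Proof.
apply: (@integrable_normal_pdf_growth _ _ s0 g `|g 0|).
  exact: lipschitz1_continuous.
move=> y; rewrite -[g y](subrK (g 0)) (le_trans (ler_normD _ _)) // lerD2r.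
by rewrite (le_trans (gL y 0)) // subr0.
Qed.

Let iphi : leb.-integrable setT (EFin \o phi).
Proof. exact: integrable_normal_pdf. Qed.

Let intphi : \int[leb]_y phi y = 1.
Proof. by rewrite /Rintegral integral_normal_pdf. Qed.

(** g y - c is the Gaussian mean of g y - g z in the variable z, hence at most the mean of |y| +
    |z|. *)
Let gc y : `|g y - c| <= `|y| + m1.
Proof.
have e : g y - c = \int[leb]_z (g y * phi z - g z * phi z).
  rewrite RintegralB //; last exact: integrable_lipschitz_normal_pdf.
    by rewrite RintegralZl // intphi mulr1.
  exact: integrable_EFinZ.
have i1 : leb.-integrable setT (EFin \o (fun z => g y * phi z - g z * phi z)).
  by apply: integrable_EFinB => //; [exact: integrable_EFinZ|exact: integrable_lipschitz_normal_pdf].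
have iab : leb.-integrable setT (EFin \o (fun z : R => `|z| * phi z)).
  exact: integrable_abs_normal_pdf.
rewrite e (le_trans (le_normr_Rintegral _ i1)) //.
apply: (@le_trans _ _ (\int[leb]_z (`|y| * phi z + `|z| * phi z))).
  apply: le_Rintegral => //.
  - exact: (integrable_norm i1).
  - by apply: integrable_EFinD => //; apply: integrable_EFinZ.
  - move=> z _; rewrite -mulrBl -mulrDl normrM [`|phi z|]ger0_norm ?normal_pdf_ge0 //.
    by rewrite ler_wpM2r ?normal_pdf_ge0 // (le_trans (gL y z)) // ler_normB.
rewrite RintegralD //; last exact: integrable_EFinZ.
rewrite RintegralZl // intphi mulr1 lerD2l.
by rewrite /Rintegral integral_abs_normal_pdf.
Qed.

Let iG := integrable_centered s0 gL gc.

Let cG : continuous (fun y => (g y - c) * phi y).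
Proof.
move=> y; apply: cvgM; last exact: continuous_phi.
by apply: cvgB; [exact: lipschitz1_continuous|exact: cvg_cst].
Qed.

Let I x := \int[leb]_(y in `]-oo, x]) ((g y - c) * phi y).

(** g - c has Gaussian mean 0, so the left tail is minus the right one. This form is used for x >=
    0, and the reflected form [I_left] for x < 0, so that the tail estimates apply on both sides. *)
Let I_right x : I x = - \int[leb]_(y in `[x, +oo[) ((g y - c) * phi y).
Proof.
apply/eqP; rewrite -addr_eq0; apply/eqP.
have -> : \int[leb]_(y in `[x, +oo[) ((g y - c) * phi y) =
    \int[leb]_(y in `]x, +oo[) ((g y - c) * phi y).
  by rewrite Rintegral_itv_obnd_cbnd //; apply: integrableS iG.
rewrite -Rintegral_setU //=.
- have -> : `]-oo, x]%classic `|` `]x, +oo[%classic = [set: R].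
    by apply/seteqP; split => // z _ /=; rewrite !in_itv /= andbT; case: (leP z x); [left|right].
  under eq_Rintegral do rewrite mulrBl.
  rewrite RintegralB //; last exact: integrable_EFinZ.
    by rewrite RintegralZl // intphi mulr1 subrr.
  exact: integrable_lipschitz_normal_pdf.
- by apply: integrableS iG => //; apply: measurableU.
- rewrite disj_set2E; apply/eqP/seteqP; split => // z /= [].
  by rewrite !in_itv /= andbT => zx /lt_geF; rewrite zx.
Qed.

Let I_left x : I (- x) = \int[leb]_(y in `[x, +oo[) ((g (- y) - c) * phi y).
Proof.
by rewrite /I (Rintegral_oppr _ cG iG); apply: eq_Rintegral => y _; rewrite normal_pdfN.
Qed.

(** Variation of constants for v h' - x h = g - c: the function 1 / [phi] solves the homogeneous
    equation. *)
Let h x := I x * (v * phi x)^-1.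
Let dh (x : R) : R := (x * h x + (g x - c)) / v.

Let is_derive_h x : is_derive x (1 : R) h (dh x).
Proof.
have [dI eI] : derivable I x (1 : R) /\ derive1 I x = (g x - c) * phi x.
  apply: (@continuous_FTC1 _ _ -oo%O x (x + 1)) => //; first by rewrite ltrDl.
  - by apply: integrableS iG.
  - by rewrite /= ltNyr.
  - exact: cG.
have iI : is_derive x (1 : R) I ((g x - c) * phi x).
  by rewrite -eI derive1E; apply/derivableP.
have ip := is_derive_normal_pdf s0 x.
have ipv : is_derive x (1 : R) (fun x => (v * phi x)^-1) (x / v * (v * phi x)^-1).
  apply: is_derive_eq.
    by apply: is_deriveV; rewrite mulf_neq0.
  by rewrite /GRing.scale /=; field; rewrite phin0 gt_eqF.
apply: is_derive_eq.
rewrite /dh /h /GRing.scale /=; field.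
by rewrite phin0 gt_eqF.
Qed.

Let gNL x y : `|g (- x) - g (- y)| <= `|x - y|.
Proof. by rewrite (le_trans (gL _ _)) // -opprD normrN. Qed.

Let gNc y : `|g (- y) - c| <= `|y| + m1.
Proof. by rewrite -[in leRHS](normrN y); exact: gc. Qed.

Let B0 := (v + m1 * kappa) / v.
Let B1 := (2 * (v * kappa) + m1 * v) / (v ^+ 2).

Let bound_h x : `|h x| <= B0.
Proof.
have p0 : 0 < v * phi x by rewrite mulr_gt0 ?normal_pdf_gt0.
rewrite /h normrM normfV (gtr0_norm p0) ler_pdivrMr // /B0.
rewrite -[leRHS]mulrA mulKf //.
have [x0|x0] := leP 0 x.
  by rewrite I_right normrN; apply: stein_tail_bound.
rewrite -[x in I x]opprK I_left -(normal_pdfN s0 x).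
by apply: (@stein_tail_bound _ _ s0 (g \o -%R)) => //; rewrite oppr_ge0 ltW.
Qed.

Let bound_dh x : `|dh x| <= B1.
Proof.
have p0 : 0 < v * phi x by rewrite mulr_gt0 ?normal_pdf_gt0.
have -> : dh x = (v * (g x - c) * phi x + x * I x) / (v ^+ 2 * phi x).
  by rewrite /dh /h; field; rewrite phin0 gt_eqF.
have p1 : 0 < v ^+ 2 * phi x by rewrite mulr_gt0 ?normal_pdf_gt0 // exprn_gt0.
rewrite normrM normfV (gtr0_norm p1) ler_pdivrMr // /B1.
rewrite -[leRHS]mulrA mulKf ?expf_neq0 ?(gt_eqF s0) //.
have [x0|x0] := leP 0 x.
  by rewrite I_right mulrN; apply: stein_tail_deriv_bound.
have := @stein_tail_deriv_bound _ _ s0 (g \o -%R) c gNL gNc (- x).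
rewrite oppr_ge0 => /(_ (ltW x0)) /=; rewrite opprK (normal_pdfN s0 x) -I_left opprK.
by rewrite mulNr opprK.
Qed.

Lemma stein_solution : exists hh dhh : R -> R,
  [/\ (forall x, is_derive x (1 : R) hh (dhh x)), (forall x, `|hh x| <= B0),
      (forall x, `|dhh x| <= B1) &
      forall x, v * dhh x - x * hh x = g x - \int[leb]_y (g y * phi y)].
Proof.
exists h, dh; split => // x.
by rewrite /dh mulrC divfK // addrAC subrr add0r.
Qed.

End solution.

(* The Stein equation makes the derivative of its solution Lipschitz on bounded
   sets, which replaces a bound on the second derivative. *)
Lemma stein_equation : exists B0 B1 : R, forall g : R -> R,
  (forall x y, `|g x - g y| <= `|x - y|) ->
  exists h dh : R -> R,
  [/\ continuous h, continuous dh,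
      (forall A : R, exists K : R, forall x y, `|x| <= A -> `|y| <= A ->
        `|h y - h x - dh x * (y - x)| <= K * (y - x) ^+ 2) &
      [/\ (forall x, `|h x| <= B0), (forall x, `|dh x| <= B1) &
      forall x, v * dh x - x * h x = g x - \int[leb]_y (g y * phi y)]].
Proof.
exists ((v + m1 * kappa) / v), ((2 * (v * kappa) + m1 * v) / (v ^+ 2)) => g gL.
have [h [dh [hd bh bdh e]]] := stein_solution gL.
set B0 := _ / v in bh *; set B1 := _ / _ ^+ 2 in bdh *.
exists h, dh.
have ch : continuous h.
  move=> z; apply: differentiable_continuous.
  by apply/derivable1_diffP; exact: ex_derive.
have dhE : dh = (fun x => (x * h x + (g x - \int[leb]_y (g y * phi y))) / v).
  by apply/funext => x; rewrite -e addrC subrK mulrC mulKf.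
split => //.
- rewrite dhE => x; apply: cvgM; last exact: cvg_cst.
  apply: cvgD; first by apply: cvgM; [exact: cvg_id|exact: ch].
  by apply: cvgB; [exact: lipschitz1_continuous|exact: cvg_cst].
(* Subtracting Stein's equation at x from that at z gives v (dh z - dh x) = (z - x) h z + x (h z - h
   x) + g z - g x; the three terms yield B0, A B1 and 1. *)
- move=> A; exists ((B0 + A * B1 + 1) / v) => x y xA yA.
  have [z zy ->] := mean_value_oriented x y hd.
  have [w _ ew] := mean_value_oriented x z hd.
  rewrite -mulrBl normrM.
  apply: (@le_trans _ _ ((B0 + A * B1 + 1) / v * `|y - x| * `|y - x|)); last first.
    by rewrite -mulrA -expr2 real_normK // num_real.
  rewrite ler_wpM2r // mulrAC ler_pdivlMr // -[X in _ * X](gtr0_norm v0) -normrM.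
  have -> : (dh z - dh x) * v = (z - x) * h z + x * (dh w * (z - x)) + (g z - g x).
    by rewrite -ew dhE /=; field; rewrite gt_eqF.
  rewrite (le_trans (ler_normD _ _)) // [leRHS]mulrDl mul1r lerD //; last first.
    by rewrite (le_trans (gL _ _)).
  rewrite (le_trans (ler_normD _ _)) // !normrM [leRHS]mulrDl lerD //.
    by rewrite [leRHS]mulrC; apply: ler_pM => //; exact: bh.
  rewrite -mulrA ler_pM ?mulr_ge0 //.
  by apply: ler_pM => //; exact: bdh.
Qed.

End stein_equation.

(** * Wasserstein distance and convergence in law *)

Section integral_normal_prob.
Variables (R : realType) (s : R).
Local Notation leb := (@lebesgue_measure R).
Local Notation phi := (normal_pdf 0 s).
Local Notation nu := (normal_prob 0 s).
Local Notation rn := (Radon_Nikodym_SigmaFinite.f nu leb).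

Let dom : nu `<< leb.
Proof. exact: normal_prob_dominates. Qed.

Lemma Radon_Nikodym_normal_prob : ae_eq leb setT rn (EFin \o phi).
Proof.
apply: integral_ae_eq => //.
- exact: Radon_Nikodym_SigmaFinite.f_integrable.
- by apply/measurable_EFinP; exact: measurable_normal_pdf.
- by move=> E _ mE; rewrite -Radon_Nikodym_SigmaFinite.f_integral.
Qed.

Lemma ge0_integral_normal_prob (f : R -> \bar R) : (forall x, (0 <= f x)%E) ->
  measurable_fun setT f ->
  (\int[nu]_x f x = \int[leb]_x (f x * (phi x)%:E))%E.
Proof.
move=> f0 mf.
have mphi : measurable_fun setT (EFin \o phi).
  by apply/measurable_EFinP; exact: measurable_normal_pdf.
rewrite -(Radon_Nikodym_SigmaFinite.change_of_variables dom f0 measurableT mf).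
apply: ae_eq_integral => //.
- apply: emeasurable_funM => //.
  exact: measurable_int (Radon_Nikodym_SigmaFinite.f_integrable dom).
- exact: emeasurable_funM.
- exact: ae_eqe_mul2l Radon_Nikodym_normal_prob.
Qed.

Lemma integral_normal_prob (f : R -> R) : measurable_fun setT f ->
  leb.-integrable setT (EFin \o (fun x => f x * phi x)) ->
  nu.-integrable setT (EFin \o f) /\
  \int[nu]_x f x = \int[leb]_x (f x * phi x).
Proof.
move=> mf ifphi.
have mE : measurable_fun setT (EFin \o f) by apply/measurable_EFinP.
have inu : nu.-integrable setT (EFin \o f).
  apply/integrableP; split => //.
  rewrite ge0_integral_normal_prob //; last exact: measurableT_comp.
  move/integrableP : ifphi => [_]; congr (_ < _)%E.
  by apply: eq_integral => x _ /=; rewrite normrM [`|phi x|]ger0_norm ?normal_pdf_ge0.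
split=> //; rewrite /Rintegral integralE [in RHS]integralE.
congr (fine (_ - _)); rewrite ge0_integral_normal_prob //;
  try exact: measurable_funepos; try exact: measurable_funeneg.
- apply: eq_integral => x _; rewrite /= !funeposE /= -!EFin_max -EFinM; congr EFin.
  by rewrite maxr_pMl ?normal_pdf_ge0 // mul0r.
- apply: eq_integral => x _; rewrite /= !funenegE /= -!EFin_max -EFinM; congr EFin.
  by rewrite maxr_pMl ?normal_pdf_ge0 // mul0r mulNr.
Qed.

End integral_normal_prob.

Section centered_normal_law.
Variables (R : realType) (v : R).
Hypothesis v0 : 0 < v.
Local Notation leb := (@lebesgue_measure R).

Lemma centered_normal_lipschitz (g : R -> R) :
  (forall x y, `|g x - g y| <= `|x - y|) ->
  (centered_normal v).-integrable setT (EFin \o g) /\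
  \int[centered_normal v]_x g x = \int[leb]_x (g x * normal_pdf 0 (Num.sqrt v) x).
Proof.
move=> gL; have s0 : 0 < Num.sqrt v by rewrite sqrtr_gt0.
have mg : measurable_fun setT g.
  by apply: continuous_measurable_fun; exact: lipschitz1_continuous.
have [ig <-] : (normal_prob 0 (Num.sqrt v)).-integrable setT (EFin \o g) /\ _ :=
  integral_normal_prob mg (integrable_lipschitz_normal_pdf s0 gL).
rewrite /centered_normal gt_eqF //; split.
  apply: integrable_pushforward => //; exact/measurable_EFinP.
rewrite /Rintegral integral_distribution //.
exact/measurable_EFinP.
Qed.

End centered_normal_law.

(** Integrability on both sides makes the difference of extended reals in [wasserstein] a difference
    of reals. *)
Lemma wasserstein_le (R : realType) (mu nu : probability R R) (W : R) :
  (forall g : R -> R, (forall x y, `|g x - g y| <= `|x - y|) ->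
     [/\ mu.-integrable setT (EFin \o g), nu.-integrable setT (EFin \o g) &
     `|\int[mu]_x g x - \int[nu]_x g x| <= W]) ->
  (wasserstein mu nu <= W%:E)%E.
Proof.
move=> hW; apply: ge_ereal_sup => _ [g gL <-].
have [i1 i2 le] := hW g (fun x y => ltac:(by have := gL (x, y); rewrite /= mul1r; apply)).
rewrite -(fineK (integrable_fin_num measurableT i1)) -(fineK (integrable_fin_num measurableT i2)).
by rewrite -EFinB abse_EFin lee_fin.
Qed.

Section inf_convolution.
Variables (R : realType) (h : R -> R) (B : R).
Hypotheses (hc : continuous h) (hB : forall x, `|h x| <= B).
Implicit Types (k : nat) (x y : R).

(** The Pasch-Hausdorff envelope: the largest k-Lipschitz function below [h]. *)
Definition inf_convolution k x := inf [set h y + k%:R * `|x - y| | y in [set: R]].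

Let hB1 y : - B <= h y. Proof. by have := hB y; rewrite ler_norml => /andP[]. Qed.

Let lb k x : lbound [set h y + k%:R * `|x - y| | y in [set: R]] (- B).
Proof. by move=> _ [y _ <-]; rewrite (le_trans (hB1 y)) // lerDl mulr_ge0. Qed.

Let inf_le k x y : inf_convolution k x <= h y + k%:R * `|x - y|.
Proof. by apply: ge_inf; [exists (- B); exact: lb|exists y]. Qed.

Let le_inf k x a : (forall y, a <= h y + k%:R * `|x - y|) -> a <= inf_convolution k x.
Proof.
by move=> ha; apply: lb_le_inf; [exists (h x + k%:R * `|x - x|), x|move=> _ [y _ <-]].
Qed.

Lemma inf_convolution_le k x : inf_convolution k x <= h x.
Proof. by have := inf_le k x x; rewrite subrr normr0 mulr0 addr0. Qed.

Lemma inf_convolution_ge k x : - B <= inf_convolution k x.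
Proof. by apply: le_inf => y; apply: lb; exists y. Qed.

Lemma inf_convolution_norm k x : `|inf_convolution k x| <= B.
Proof.
rewrite ler_norml inf_convolution_ge (le_trans (inf_convolution_le _ _)) //.
by rewrite (le_trans (ler_norm _)).
Qed.

Lemma inf_convolution_lipschitz k x y :
  `|inf_convolution k x - inf_convolution k y| <= k%:R * `|x - y|.
Proof.
have H a b : inf_convolution k a - k%:R * `|a - b| <= inf_convolution k b.
  apply: le_inf => z; rewrite lerBlDr (le_trans (inf_le k a z)) // -addrA lerD2l.
  by rewrite -mulrDr ler_wpM2l // [leRHS]addrC ler_distD.
rewrite ler_norml; have := H x y; have := H y x; rewrite (distrC y x); lra.
Qed.

(** Points within d of x are handled by continuity. For the others the penalty is at least k d >= 2
    B, which outweighs the oscillation of [h]. *)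
Lemma cvg_inf_convolution x : inf_convolution k x @[k --> \oo] --> h x.
Proof.
apply/cvgrPdist_le => e e0.
have /cvgrPdist_lt /(_ _ e0) [d /= d0 hd] := (hc (x := x)).
have [K HK] : exists K : nat, 2 * B / d <= K%:R.
  by exists (Num.truncn (2 * B / d)).+1; apply/ltW/truncnS_gt.
near=> k.
rewrite ger0_norm ?subr_ge0 ?inf_convolution_le // lerBlDl -lerBlDr.
apply: le_inf => y.
have [xy|xy] := ltP `|x - y| d.
  have := hd y xy; rewrite ltr_norml => /andP[_ h1].
  by rewrite (@le_trans _ _ (h y)) // ?lerDl ?mulr_ge0 //; lra.
have hx : h x <= B by rewrite (le_trans (ler_norm _)).
have kd : 2 * B <= k%:R * `|x - y|.
  rewrite ler_pdivrMr // in HK; apply: (le_trans HK).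
  rewrite ler_pM // ?(ltW d0) // ler_nat; near: k; exact: nbhs_infty_ge.
have := hB1 y; lra.
Unshelve. all: by end_near. Qed.

End inf_convolution.

Section weak_convergence.
Variable R : realType.
Implicit Types (mu nu : probability R R) (h g : R -> R).

Lemma bounded_measurable_continuous h (B : R) : continuous h ->
  (forall x, `|h x| <= B) -> bounded_measurable h.
Proof. by move=> hc hB; split; [exact: continuous_measurable_fun|exists B]. Qed.

Let klip_continuous g (k : nat) : (forall x y, `|g x - g y| <= k%:R * `|x - y|) ->
  continuous g.
Proof.
move=> gL x; apply/cvgrPdist_lt => e e0; near=> y.
apply: (le_lt_trans (gL x y)).
apply: (@le_lt_trans _ _ (k.+1%:R * `|x - y|)); first by rewrite ler_wpM2r // ler_nat.
rewrite mulrC -ltr_pdivlMr //; near: y; apply: cvgr_dist_lt => //.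
by rewrite divr_gt0.
Unshelve. all: by end_near. Qed.

Lemma bounded_measurable_lipschitz d (T : measurableType d) (g : R -> R) (u : T -> R) :
  (forall x y, `|g x - g y| <= `|x - y|) -> bounded_measurable u ->
  bounded_measurable (fun x => g (u x)).
Proof.
move=> gL [mu' [B uB]]; split.
  apply: measurableT_comp => //; apply: continuous_measurable_fun.
  exact: lipschitz1_continuous.
exists (B + `|g 0|) => M; rewrite -[g (u M)](subrK (g 0)).
by rewrite (le_trans (ler_normD _ _)) // lerD2r (le_trans (gL _ _)) // subr0.
Qed.

Lemma cvg_in_law_lipschitz (mu : nat -> probability R R) nu (W : nat -> R) :
  W n @[n --> \oo] --> 0 ->
  (\forall n \near \oo, forall g (B : R), (forall x y, `|g x - g y| <= `|x - y|) ->
     (forall x, `|g x| <= B) ->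
     `|\int[mu n]_x g x - \int[nu]_x g x| <= W n) ->
  cvg_in_law mu nu.
Proof.
move=> W0 hW h hc [M [_ hM]].
have {hM} hB x : `|h x| <= M + 1 by apply: hM => //; rewrite ltrDl.
move: (M + 1) hB => {M} B hB.
(* A lower bound on the limit is enough, because it is applied to h and to -h. *)
have lower f : continuous f -> (forall x, `|f x| <= B) -> forall e, 0 < e ->
    \forall n \near \oo, \int[nu]_x f x - e <= \int[mu n]_x f x.
  move=> fc fB e e0.
  pose fk k := inf_convolution f k.
  have fkc k : continuous (fk k).
    by apply: (@klip_continuous _ k) => x y; exact: inf_convolution_lipschitz fB k x y.
  have bfk k : bounded_measurable (fk k).
    by apply: (@bounded_measurable_continuous _ B) => // x; exact: inf_convolution_norm.
  have bf := bounded_measurable_continuous fc fB.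
  have : (\int[nu]_x (fk k x)%:E @[k --> \oo] --> \int[nu]_x (f x)%:E)%E.
    have [] := @dominated_convergence _ _ _ nu setT measurableT (fun k => EFin \o fk k)
      (EFin \o f) (EFin \o cst B).
    - by move=> k; apply/measurable_EFinP; case: (bfk k).
    - by apply/measurable_EFinP; case: bf.
    - by apply: aeW => x _; apply: cvg_EFin; [near=> k|exact: cvg_inf_convolution fc fB x].
    - exact: bounded_measurable_integrable (bounded_measurable_cst _ B).
    - by apply: aeW => x k _ /=; rewrite lee_fin; exact: inf_convolution_norm.
    by [].
  have iE (m : probability R R) u : bounded_measurable u ->
      (\int[m]_x (u x)%:E = (\int[m]_x u x)%:E)%E.
    move=> bu; rewrite /Rintegral fineK // integrable_fin_num //.
    exact: bounded_measurable_integrable.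
  (* One envelope whose mean under [nu] is within e / 2 of that of f is fixed. The remaining e / 2
     is for its means under [mu n], after division by k + 1, which makes it 1-Lipschitz and is
     nonzero even for k = 0. *)
  rewrite (iE nu f bf) => /fine_cvgP[_ /cvgrPdist_le /(_ (e / 2))].
  rewrite divr_gt0 // => /(_ isT) [k _ /(_ k (leqnn k))] /= hk.
  have {}hk : \int[nu]_x f x - e / 2 <= \int[nu]_x fk k x.
    by move: hk; rewrite /Rintegral ler_norml => /andP[_]; lra.
  have W1 : \forall n \near \oo, k.+1%:R * W n <= e / 2.
    have /cvgrPdist_le /(_ (e / 2 / k.+1%:R)) : W n @[n --> \oo] --> 0 by [].
    rewrite !divr_gt0 // => /(_ isT); apply: filterS => n.
    rewrite sub0r normrN => /(le_trans (ler_norm _)).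
    by rewrite ler_pdivlMr // mulrC.
  near=> n.
  have Wn : k.+1%:R * W n <= e / 2 by near: n.
  have Hn : forall g (B : R), (forall x y, `|g x - g y| <= `|x - y|) ->
     (forall x, `|g x| <= B) -> `|\int[mu n]_x g x - \int[nu]_x g x| <= W n by near: n.
  have k0 : (k.+1%:R : R) != 0 by [].
  have /Hn Hk : forall x y, `|k.+1%:R^-1 * fk k x - k.+1%:R^-1 * fk k y| <= `|x - y|.
    move=> x y; rewrite -mulrBr normrM ger0_norm // ler_pdivrMl //.
    rewrite (le_trans (inf_convolution_lipschitz fB k x y)) //.
    by rewrite ler_wpM2r // ler_nat.
  have /Hk : forall x, `|k.+1%:R^-1 * fk k x| <= k.+1%:R^-1 * B.
    by move=> x; rewrite normrM ger0_norm // ler_wpM2l //; exact: inf_convolution_norm.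
  rewrite !RintegralZl ?bounded_measurable_integrable // -mulrBr normrM ger0_norm //.
  rewrite ler_pdivrMl // => /le_trans /(_ Wn).
  rewrite ler_norml => /andP[Hm _].
  have le1 : \int[mu n]_x fk k x <= \int[mu n]_x f x.
    apply: le_Rintegral => //; try exact: bounded_measurable_integrable.
    by move=> x _; exact: inf_convolution_le fB k x.
  lra.
apply/cvgrPdist_le => e e0.
have := lower h hc hB e e0.
have hNc : continuous (fun x => - h x) by move=> x; apply: cvgN; exact: hc.
have hNB x : `|- h x| <= B by rewrite normrN.
have := lower _ hNc hNB e e0; apply: filterS2 => n.
have bh := bounded_measurable_continuous hc hB.
have neg (m : probability R R) : \int[m]_x (- h x) = - \int[m]_x h x.
  under eq_Rintegral do rewrite -mulN1r.
  by rewrite RintegralZl ?mulN1r //; exact: bounded_measurable_integrable.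
rewrite !neg ler_norml => h1 h2; apply/andP; split; lra.
Unshelve. all: by end_near. Qed.

End weak_convergence.

(** * Fourier coefficients *)

Section power_sums.
Variable R : realType.
Implicit Types (s : R) (k d N : nat).

(** Discrete form of comparing the sum of t^(-s) with its integral, obtained from ln (1 - 1/t) <=
    -1/t and 1 + x <= exp x. *)
Lemma powR_telescope s k : 1 < s -> (0 < k)%N ->
  (s - 1) * k.+1%:R `^ (- s) <= k%:R `^ (1 - s) - k.+1%:R `^ (1 - s).
Proof.
move=> s1 k0; set t : R := k.+1%:R.
have t0 : 0 < t by rewrite ltr0n.
have kR : 0 < k%:R :> R by rewrite ltr0n.
have kt : k%:R = (1 + - t^-1) * t.
  by rewrite mulrDl mulNr mulVf ?gt_eqF // mul1r /t -natr1 addrK.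
have t1 : - 1 < - t^-1.
  by rewrite ltrN2 invf_lt1 // ltr1n ltnS.
have lnk : ln k%:R <= ln t - t^-1 :> R.
  rewrite kt lnM ?posrE //; last by rewrite -subr_gt0 opprK addrC in t1.
  by rewrite addrC lerD2l le_ln1Dx.
rewrite lerBrDr.
have -> : t `^ (- s) = t `^ (1 - s) * t^-1.
  rewrite (_ : 1 - s = - s + 1); last by rewrite addrC.
  rewrite powRD; last by rewrite (gt_eqF t0) implybT.
  by rewrite powRr1 ?(ltW t0) // mulfK ?gt_eqF.
rewrite /powR !gt_eqF //.
have -> : (s - 1) * (expR ((1 - s) * ln t) * t^-1) + expR ((1 - s) * ln t) =
  expR ((1 - s) * ln t) * (1 + (s - 1) * t^-1) by ring.
have -> : (1 - s) * ln k%:R = (1 - s) * ln t + (s - 1) * (ln t - ln k%:R) by ring.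
rewrite expRD ler_wpM2l ?expR_ge0 // (le_trans (expR_ge1Dx _)) // ler_expR.
by rewrite ler_wpM2l ?subr_ge0 ?(ltW s1) // lerBrDr addrC -lerBrDr.
Qed.

Lemma powR_sum_tail s d N : 1 < s -> (0 < d)%N ->
  \sum_(d <= j < N) j.+1%:R `^ (- s) <= (s - 1)^-1 * d%:R `^ (1 - s).
Proof.
move=> s1 d0; have s10 : 0 < s - 1 by rewrite subr_gt0.
have [Nd|dN] := leqP N d.
  by rewrite big_geq // mulr_ge0 ?powR_ge0 // invr_ge0 ltW.
rewrite -ler_pdivrMl ?invr_gt0 // invrK.
apply: (@le_trans _ _ (d%:R `^ (1 - s) - N%:R `^ (1 - s))); last first.
  by rewrite gerBl powR_ge0.
elim: N dN => // N IH; rewrite ltnS leq_eqVlt => /orP[/eqP <-|dN].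
  by rewrite big_nat1 powR_telescope.
rewrite big_nat_recr ?(ltnW dN) //= mulrDr.
have := IH dN; have := @powR_telescope s N s1 (leq_trans d0 (ltnW dN)); lra.
Qed.

Lemma series_tail_bound (u b : nat -> R) (T : R) d : (forall j, `|u j| <= b j) ->
  (forall N, \sum_(d <= j < N) b j <= T) ->
  cvgn (series u) /\ `|limn (series u) - series u d| <= T.
Proof.
move=> ub bT.
have b0 j : 0 <= b j := le_trans (normr_ge0 _) (ub j).
have cu : cvgn (series u).
  apply: normed_cvg; apply: (@series_le_cvg _ _ b) => [j|//|//|]; first exact: normr_ge0.
  apply: nondecreasing_is_cvgn.
    by apply/nondecreasing_seqP => m; rewrite seriesSr lerDl.
  exists (series b d + T) => _ [N _ <-].
  have [Nd|dN] := leqP d N.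
    by rewrite /series /= (big_cat_nat (n := d)) //= lerD2l.
  have : series b N <= series b d.
    rewrite /series /= (big_cat_nat (n := N) (p := d)) //= ?lerDl ?(ltnW dN) //.
    exact: sumr_ge0.
  move=> /le_trans; apply; rewrite lerDl.
  by have := bT d; rewrite big_geq.
split => //.
have H : \forall N \near \oo, `|series u N - series u d| <= T.
  near=> N; have dN : (d <= N)%N by near: N; exact: nbhs_infty_ge.
  rewrite /series /= (big_cat_nat (n := d)) //= addrAC subrr add0r.
  rewrite (le_trans (ler_norm_sum _ _ _)) // (le_trans _ (bT N)) //.
  exact: ler_sum.
apply: cvgr_to_le H; apply: cvg_norm; apply: cvgB; [exact: cu|exact: cvg_cst].
Unshelve. all: by end_near. Qed.

End power_sums.

Lemma posz_bij : @set_bij nat int [set j | (0 < j)%N] [set z : int | 0 < z] Posz.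
Proof.
split; first by move=> j.
- by move=> i j _ _ [].
- by case=> // j j0; exists j.
Qed.

Lemma oppz_bij :
  @set_bij nat int [set j | (0 < j)%N] [set z : int | z < 0] (fun j => - j%:Z).
Proof.
split; first by move=> j /= j0; rewrite oppr_lt0.
- by move=> i j _ _ /oppr_inj [].
- by case=> // j j0; exists j.+1.
Qed.

Lemma esum_int_even (R : realType) (w : nat -> \bar R) : (forall j, (0 <= w j)%E) ->
  w 0%N = 0%E ->
  (\esum_(z in [set: int]) w `|z|%N = 2%:E * \sum_(1 <= j <oo) w j)%E.
Proof.
move=> w0 w00.
have series_pos : (\sum_(1 <= j <oo) w j = \esum_(j in [set j | (0 < j)%N]) w j)%E.
  by rewrite eseries_cond nneseries_esum //; apply: eq_esum.
rewrite (esumID [set z : int | 0 < z]) // !setTI.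
rewrite (esumID [set z : int | z < 0] (~` _)) //.
have -> : ~` [set z : int | 0 < z] `&` [set z | z < 0] = [set z : int | z < 0].
  by apply/seteqP; split => z /=; [case|move=> z0; split=> //; lia].
rewrite (reindex_esum _ _ _ _ posz_bij) (reindex_esum _ _ _ _ oppz_bij).
rewrite [X in (_ + (_ + X))%E]esum1 ?adde0.
  rewrite (eq_esum (b := w)) // [X in (_ + X)%E](eq_esum (b := w)).
    by rewrite -series_pos mule_natl mule2n.
  by move=> j _; rewrite abszN.
by move=> z /= [z1 z2]; rewrite (_ : z = 0) //; lia.
Qed.

Section fourier_coefficients.
Variables (R : realType) (f : R[i] -> R).
Hypothesis f_L1 : circle_integrable f.
Local Notation leb := (@lebesgue_measure R).
Local Notation circle := (`[0, 2 * pi]%classic : set R).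
Local Notation norm_coef j := (Normc.normc (fourier_coef f j)).

Lemma expi_conj (x : R) : expi (- x) = Num.conj (expi x).
Proof. by rewrite /expi cosN sinN; apply/eqP; rewrite eq_complex /= !eqxx. Qed.

Lemma integrable_circle_bounded (u : R -> R) : measurable_fun setT u ->
  (forall x, `|u x| <= 1) -> leb.-integrable circle (EFin \o (fun x => f (expi x) * u x)).
Proof.
move=> mu u1; apply: (@le_integrable _ _ _ leb circle _ _ (fun x => (f (expi x))%:E)) => //.
  apply/measurable_EFinP; apply: measurable_funM; last exact: measurable_funTS.
  by apply/measurable_EFinP; exact: measurable_int f_L1.
by move=> x _; rewrite !abse_EFin lee_fin normrM ler_piMr.
Qed.

Lemma measurable_cos_mul (a : R) : measurable_fun setT (fun x : R => cos (a * x)).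
Proof.
apply: continuous_measurable_fun => x.
by apply: continuous_comp; [exact: mulrl_continuous|exact: continuous_cos].
Qed.

Lemma measurable_sin_mul (a : R) : measurable_fun setT (fun x : R => sin (a * x)).
Proof.
apply: continuous_measurable_fun => x.
by apply: continuous_comp; [exact: mulrl_continuous|exact: continuous_sin].
Qed.

Lemma fourier_coefE (j : int) : fourier_coef f j =
  ((2 * pi)^-1 * \int[leb]_(x in circle) (f (expi x) * cos (j%:~R * x))) +i*
  (- ((2 * pi)^-1 * \int[leb]_(x in circle) (f (expi x) * sin (j%:~R * x)))).
Proof.
rewrite /fourier_coef /complex_integral.
have -> : \int[leb]_(x in circle) complex.Re ((f (expi x))%:C * expi (- (j%:~R * x))) =
    \int[leb]_(x in circle) (f (expi x) * cos (j%:~R * x)).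
  by apply: eq_Rintegral => x _; rewrite /= mul0r subr0 cosN.
have -> : \int[leb]_(x in circle) complex.Im ((f (expi x))%:C * expi (- (j%:~R * x))) =
    - \int[leb]_(x in circle) (f (expi x) * sin (j%:~R * x)).
  rewrite -[RHS]mulN1r -RintegralZl //; last first.
    apply: integrable_circle_bounded; first exact: measurable_sin_mul.
    by move=> x; exact: sin_max.
  by apply: eq_Rintegral => x _; rewrite /= mul0r addr0 sinN mulN1r mulrN.
by apply/eqP; rewrite eq_complex /= !mul0r subr0 addr0 mulrN !eqxx.
Qed.

Lemma fourier_coefN (j : int) : fourier_coef f (- j) = Num.conj (fourier_coef f j).
Proof.
rewrite !fourier_coefE.
have eC : \int[leb]_(x in circle) (f (expi x) * cos ((- j)%:~R * x)) =
    \int[leb]_(x in circle) (f (expi x) * cos (j%:~R * x)).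
  by apply: eq_Rintegral => x _; rewrite intrN mulNr cosN.
have eS : \int[leb]_(x in circle) (f (expi x) * sin ((- j)%:~R * x)) =
    - \int[leb]_(x in circle) (f (expi x) * sin (j%:~R * x)).
  rewrite -[RHS]mulN1r -RintegralZl //; last first.
    apply: integrable_circle_bounded; first exact: measurable_sin_mul.
    by move=> x; exact: sin_max.
  by apply: eq_Rintegral => x _; rewrite intrN mulNr sinN mulN1r mulrN.
by rewrite eC eS mulrN.
Qed.

Lemma normc_fourier_coefN (j : int) : norm_coef (- j) = norm_coef j.
Proof.
rewrite fourier_coefN.
by case: (fourier_coef f j) => a b /=; rewrite sqrrN.
Qed.

Lemma fourier_varianceE : fourier_variance f =
  (2%:E * \sum_(1 <= j <oo) (j%:R * norm_coef j%:Z ^+ 2)%:E)%E.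
Proof.
rewrite -esum_int_even; last 2 first.
- by move=> j; rewrite lee_fin mulr_ge0 // sqr_ge0.
- by rewrite mul0r.
apply: eq_esum => z _; congr EFin; rewrite mulrC; congr (_ * _ ^+ 2).
by case: z => // k; rewrite NegzE normc_fourier_coefN abszN.
Qed.

(** On the circle the inverse of z is its conjugate, and the coefficients at j and -j are conjugate
    because f is real; the two terms of index j add up to twice a real part. *)
Lemma fourier_partial_sumE N (z : R[i]) : `|z| = 1 ->
  complex.Re (fourier_partial_sum f N z) = complex.Re (fourier_coef f 0) +
    series (fun j => 2 * complex.Re (fourier_coef f j.+1%:Z * z ^+ j.+1)) N.
Proof.
move=> z1; rewrite /fourier_partial_sum raddfD /=; congr (_ + _).
rewrite raddf_sum /series /= big_add1 /=; apply: eq_bigr => j _.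
have zV : z^-1 = Num.conj z.
  have z0 : z != 0 by rewrite -normr_eq0 z1 oner_neq0.
  by apply: (mulfI z0); rewrite mulfV // -normCK z1 expr1n.
rewrite fourier_coefN -exprz_inv zV -!exprnP -rmorphXn.
by case: (fourier_coef f j.+1) (z ^+ j.+1) => a1 a2 [b1 b2] /=; ring.
Qed.

End fourier_coefficients.

Section fourier_decay_bounds.
Variables (R : realType) (f : R[i] -> R) (kappa C : R).
Hypotheses (f_L1 : circle_integrable f) (kappa1 : 1 < kappa) (C0 : 0 < C).
Hypothesis decay : forall j, j != 0 ->
  Normc.normc (fourier_coef f j) <= C * (`|j|%N%:R `^ (- kappa)).
Local Notation a j := (Normc.normc (fourier_coef f j%:Z)).
Local Notation w := (fun j : nat => 2 * (j.+1%:R * a j.+1 ^+ 2)).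

Lemma normc_ge0 (z : R[i]) : 0 <= Normc.normc z.
Proof. by case: z => x y; exact: sqrtr_ge0. Qed.

Lemma coef_decay j : a j.+1 <= C * j.+1%:R `^ (- kappa).
Proof. exact: decay. Qed.

Lemma coef_tail d N : (0 < d)%N ->
  \sum_(d <= j < N) a j.+1 <= C / (kappa - 1) * d%:R `^ (1 - kappa).
Proof.
move=> d0; rewrite -mulrA; apply: le_trans (ler_wpM2l (ltW C0) (powR_sum_tail N kappa1 d0)).
by rewrite mulr_sumr; apply: ler_sum => j _; exact: coef_decay.
Qed.

Lemma weight_decay j : j.+1%:R * a j.+1 ^+ 2 <= C ^+ 2 * j.+1%:R `^ (- (2 * kappa - 1)).
Proof.
have t0 : (0 : R) < j.+1%:R by [].
have -> : (j.+1%:R : R) `^ (- (2 * kappa - 1)) = j.+1%:R * (j.+1%:R `^ (- kappa)) ^+ 2.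
  rewrite (_ : - (2 * kappa - 1) = 1 + (- kappa + - kappa)); last by ring.
  by rewrite !powRD ?(gt_eqF t0) ?implybT // powRr1 ?(ltW t0).
rewrite [leRHS]mulrCA ler_wpM2l ?(ltW t0) // -exprMn lerXn2r ?nnegrE ?normc_ge0 //.
- by rewrite mulr_ge0 ?powR_ge0 ?(ltW C0).
- exact: coef_decay.
Qed.

Let kappa2 : 1 < 2 * kappa - 1. Proof. by move: kappa1; lra. Qed.

Lemma weight_tail d N : (0 < d)%N ->
  \sum_(d <= j < N) j.+1%:R * a j.+1 ^+ 2 <=
  C ^+ 2 / (2 * kappa - 2) * d%:R `^ (2 - 2 * kappa).
Proof.
move=> d0; rewrite -mulrA.
have := powR_sum_tail N kappa2 d0.
rewrite (_ : 2 * kappa - 1 - 1 = 2 * kappa - 2); last by ring.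
rewrite (_ : 1 - (2 * kappa - 1) = 2 - 2 * kappa); last by ring.
move=> /(ler_wpM2l (sqr_ge0 C)); apply: le_trans.
by rewrite mulr_sumr; apply: ler_sum => j _; exact: weight_decay.
Qed.

Lemma fourier_coef_sum d : \sum_(j < d) a j.+1 <= C + C / (kappa - 1).
Proof.
case: d => [|d]; first by rewrite big_ord0 addr_ge0 ?divr_ge0 ?subr_ge0 ?ltW.
rewrite -(big_mkord xpredT (fun j => a j.+1)) big_ltn // lerD //.
  by have := coef_decay 0; rewrite powR1 mulr1.
by have := @coef_tail 1 d.+1 isT; rewrite powR1 mulr1.
Qed.

Let wtail d N : (0 < d)%N -> \sum_(d <= j < N) w j <=
  2 * (C ^+ 2 / (2 * kappa - 2) * d%:R `^ (2 - 2 * kappa)).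
Proof. by move=> d0; rewrite -mulr_sumr ler_wpM2l // weight_tail. Qed.

Let w0 j : 0 <= w j. Proof. by rewrite mulr_ge0 // mulr_ge0 // sqr_ge0. Qed.

Let cvg_w d (d0 : (0 < d)%N) : cvgn (series w) /\ `|limn (series w) - series w d| <=
  2 * (C ^+ 2 / (2 * kappa - 2) * d%:R `^ (2 - 2 * kappa)).
Proof.
by apply: (@series_tail_bound _ w w) => [j|N]; [rewrite ger0_norm|exact: wtail].
Qed.

Lemma fourier_variance_limit : fourier_variance f = (limn (series w))%:E.
Proof.
rewrite fourier_varianceE // -nneseriesZl //; last first.
  by move=> j _; rewrite lee_fin mulr_ge0 // sqr_ge0.
apply/cvg_lim => //; rewrite -cvg_shiftS /=.
have -> : (fun n => (\sum_(1 <= i < n.+1) (2%:E * (i%:R * a i ^+ 2)%:E))%E) =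
    EFin \o series w.
  by apply/funext => n; rewrite big_add1 /= -sumEFin.
by apply: cvg_EFin; [near=> n|have [] := @cvg_w 1 isT].
Unshelve. all: by end_near. Qed.

Lemma fourier_variance_tail d : (0 < d)%N ->
  `|limn (series w) - \sum_(j < d) w j| <=
  2 * (C ^+ 2 / (2 * kappa - 2) * d%:R `^ (2 - 2 * kappa)).
Proof. by move=> /cvg_w[_]; rewrite /series /= big_mkord. Qed.

(** Gives nonnegativity of the variance and, when the variance is 0, the vanishing of every
    nonconstant coefficient. *)
Lemma fourier_weight_le d : w d <= limn (series w).
Proof.
have [cw _] := @cvg_w 1 isT.
apply: le_trans (nondecreasing_cvgn_le _ cw d.+1).
  by rewrite seriesSr lerDr; apply: sumr_ge0.
by apply/nondecreasing_seqP => m; rewrite seriesSr lerDl.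
Qed.

Lemma fourier_sum_tail (z : R[i]) d : (0 < d)%N -> `|z| = 1 ->
  cvgn (fun N => complex.Re (fourier_partial_sum f N z)) /\
  `|fourier_sum f z - (complex.Re (fourier_coef f 0) +
      \sum_(j < d) 2 * complex.Re (fourier_coef f j.+1%:Z * z ^+ j.+1))| <=
  2 * (C / (kappa - 1) * d%:R `^ (1 - kappa)).
Proof.
move=> d0 z1; set u := fun j : nat => 2 * complex.Re (fourier_coef f j.+1%:Z * z ^+ j.+1).
have [cu tu] : cvgn (series u) /\ `|limn (series u) - series u d| <=
    2 * (C / (kappa - 1) * d%:R `^ (1 - kappa)).
  apply: (@series_tail_bound _ u (fun j => 2 * a j.+1)) => [j|N].
    rewrite /u normrM ger0_norm // ler_wpM2l //.
    rewrite -lecR (_ : (a j.+1)%:C = `|fourier_coef f j.+1%:Z * z ^+ j.+1|); last first.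
      by rewrite normrM normrX z1 expr1n mulr1; case: (fourier_coef _ _).
    exact: normc_ge_Re.
  by rewrite -mulr_sumr ler_wpM2l // coef_tail.
have sE : (fun N => complex.Re (fourier_partial_sum f N z)) =
    (fun N => complex.Re (fourier_coef f 0) + series u N).
  by apply/funext => N; rewrite fourier_partial_sumE.
have cs : complex.Re (fourier_coef f 0) + series u N @[N --> \oo] -->
    complex.Re (fourier_coef f 0) + limn (series u).
  by apply: cvgD; [exact: cvg_cst|exact: cu].
rewrite /fourier_sum sE; split; first by apply/cvg_ex; eexists; exact: cs.
rewrite (cvg_lim _ cs) // -(big_mkord xpredT u) -/(series u d).
by rewrite opprD addrACA subrr add0r.
Qed.

End fourier_decay_bounds.

(** * Fourier series of smooth functions *)

Section bessel.
Context d (T : measurableType d) (R : realType) (mu : probability T R).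
Variables (g : T -> R[i]) (e : nat -> T -> R[i]).
Hypotheses (bg : bounded_cmeasurable g) (be : forall k, bounded_cmeasurable (e k)).
Hypothesis orthonormal : forall j k,
  cexp mu (fun x => e j x * Num.conj (e k x)) = (j == k)%:R.
Let a k := cexp mu (fun x => g x * Num.conj (e k x)).

(** The remainder h of g after projection is orthogonal to the e_k with k < N, so 0 <= E |h|^2 = E
    [h conj g] = E |g|^2 minus the sum of the |a_k|^2. *)
Lemma bessel N : \sum_(k < N) `|a k| ^+ 2 <= cexp mu (fun x => g x * Num.conj (g x)).
Proof.
pose p x := \sum_(k < N) a k * e k x; pose h x := g x - p x.
have bp : bounded_cmeasurable p.
  by apply: bounded_cmeasurable_sum => k _; exact: bounded_cmeasurableZ.
have bh : bounded_cmeasurable h by exact: bounded_cmeasurableB.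
have bc u v : bounded_cmeasurable u -> bounded_cmeasurable v ->
    bounded_cmeasurable (fun x => u x * Num.conj (v x)).
  by move=> bu bv; apply: bounded_cmeasurableM => //; exact: bounded_cmeasurable_conj.
have he (l : 'I_N) : cexp mu (fun x => h x * Num.conj (e l x)) = 0.
  rewrite (@eq_cexp _ _ _ _ _ (fun x => g x * Num.conj (e l x) -
    \sum_(k < N) a k * (e k x * Num.conj (e l x)))); last first.
    move=> x; rewrite /h mulrBl; congr (_ - _); rewrite /p mulr_suml.
    by apply: eq_bigr => k _; rewrite mulrA.
  rewrite cexpB; [|exact: bc|]; last first.
    by apply: bounded_cmeasurable_sum => k _; apply: bounded_cmeasurableZ; exact: bc.
  rewrite cexp_sum; last by move=> k _; apply: bounded_cmeasurableZ; exact: bc.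
  rewrite (bigD1 l) //= cexpZ; last exact: bc.
  rewrite orthonormal eqxx mulr1 big1 ?addr0 ?subrr // => k kl.
  rewrite cexpZ; last exact: bc.
  by rewrite orthonormal (inj_eq val_inj) (negbTE kl) mulr0.
have : 0 <= cexp mu (fun x => h x * Num.conj (h x)).
  by apply: cexp_ge0 => x; exact: mul_conjC_ge0.
rewrite (@eq_cexp _ _ _ _ _ (fun x => h x * Num.conj (g x) -
    \sum_(k < N) Num.conj (a k) * (h x * Num.conj (e k x)))); last first.
  move=> x; rewrite {2}/h rmorphB mulrBr; congr (_ - _); rewrite /p rmorph_sum mulr_sumr.
  by apply: eq_bigr => k _; rewrite rmorphM mulrCA.
rewrite cexpB; [|exact: bc|]; last first.
  by apply: bounded_cmeasurable_sum => k _; apply: bounded_cmeasurableZ; exact: bc.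
rewrite cexp_sum; last by move=> k _; apply: bounded_cmeasurableZ; exact: bc.
rewrite [X in _ - X]big1 ?subr0; last first.
  by move=> k _; rewrite cexpZ ?he ?mulr0 //; exact: bc.
rewrite (@eq_cexp _ _ _ _ _ (fun x => g x * Num.conj (g x) -
    \sum_(k < N) a k * Num.conj (g x * Num.conj (e k x)))); last first.
  move=> x; rewrite /h mulrBl; congr (_ - _); rewrite /p mulr_suml.
  apply: eq_bigr => k _; rewrite rmorphM -mulrA; congr (_ * _).
  by rewrite mulrC; congr (_ * _); exact/esym/conjCK.
have bs k : bounded_cmeasurable (fun x => Num.conj (g x * Num.conj (e k x))).
  by apply: bounded_cmeasurable_conj; exact: bc.
rewrite cexpB; [|exact: bc|]; last first.
  by apply: bounded_cmeasurable_sum => k _; exact: bounded_cmeasurableZ.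
rewrite cexp_sum; last by move=> k _; exact: bounded_cmeasurableZ.
rewrite subr_ge0; congr (_ <= _); apply: eq_bigr => k _.
by rewrite cexpZ // cexp_conj ?normCK //; exact: bc.
Qed.

End bessel.

Section circle.
Variable R : realType.
Local Notation leb := (@lebesgue_measure R).
Local Notation circle := (`[0, 2 * pi]%classic : set R).
Implicit Types (x t : R) (z : R[i]).

Lemma two_pi_gt0 : (0 : R) < 2 * pi. Proof. by rewrite mulr_gt0 ?pi_gt0. Qed.

Lemma expi_period x : expi (x + 2 * pi) = expi x.
Proof. by rewrite /expi mulr_natl cosD2pi sinD2pi. Qed.

Lemma expiD x t : expi (x + t) = expi x * expi t.
Proof. by rewrite /expi cosD sinD; apply/eqP; rewrite eq_complex /= eqxx addrC eqxx. Qed.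

Lemma expi0 : expi 0 = 1 :> R[i].
Proof. by rewrite /expi cos0 sin0. Qed.

Lemma expiX x n : expi (n%:R * x) = expi x ^+ n.
Proof.
by elim: n => [|n IH]; rewrite ?mul0r ?expi0 ?expr0 // -natr1 mulrDl mul1r expiD IH exprSr.
Qed.

Lemma norm_expi x : `|expi x| = 1.
Proof. by rewrite normc_def /= cos2Dsin2 sqrtr1. Qed.

Lemma circle_arg z : `|z| = 1 -> exists2 r, 0 <= r <= 2 * pi & z = expi r.
Proof.
case: z => a b; rewrite normc_def /= => -[ab].
have {ab} ab : a ^+ 2 + b ^+ 2 = 1.
  by rewrite -[LHS]sqr_sqrtr ?addr_ge0 ?sqr_ge0 // ab expr1n.
have a1 : -1 <= a <= 1 by have := sqr_ge0 b; nra.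
have sb : sin (acos a) = `|b|.
  by rewrite sin_acos // -ab addrAC subrr add0r sqrtr_sqr.
have ca : cos (acos a) = a by rewrite acosK // in_itv.
have := acos_ge0 a1; have := acos_lepi a1; have := pi_gt0 R => p0 h1 h2.
have [b0|b0] := leP 0 b.
  exists (acos a); first by lra.
  by rewrite /expi ca sb ger0_norm.
exists (- acos a + 2 * pi); first by lra.
by rewrite expi_period /expi cosN sinN ca sb ltr0_norm // opprK.
Qed.

(* On [0, pi/2] the half-angle formula reduces sin to [0, pi/4], where
   cos^2 >= 1/2. *)
Lemma sin_ge_half x : 0 <= x <= pi / 2 -> x / 2 <= sin x.
Proof.
move=> /andP[x0 xp]; have p0 := pi_gt0 R.
have c4 : (cos (pi / 4) : R) ^+ 2 = 1 / 2.
  have := cos_mulr2n (pi / 4 : R); rewrite (_ : (pi / 4) *+ 2 = pi / 2 :> R); last first.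
    by rewrite -mulr_natr; field.
  by rewrite cos_pihalf -mulr_natr; lra.
have cge y : 0 <= y <= pi / 4 -> cos (pi / 4) <= cos y.
  move=> /andP[y0 y4]; move: y4; rewrite le_eqVlt => /orP[/eqP ->//|y4].
  by rewrite ltW // ltr_cos // in_itv /=; lra.
have c0 : 0 <= cos (pi / 4) :> R by apply: cos_ge0_pihalf; lra.
have [z hz e] := mean_value_oriented 0 (x / 2) (fun y : R => is_derive_sin y).
move: e hz; rewrite sin0 !subr0 => e hz.
have cz : cos (pi / 4) <= cos z.
  have -> : cos z = cos `|z| by case: (leP 0 z) => [/ger0_norm|/ltr0_norm] ->; rewrite ?cosN.
  apply: cge; rewrite normr_ge0 /= (le_trans hz) // ger0_norm; lra.
have sx : sin x = cos (x / 2) * (cos z * (x / 2)) * 2.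
  by rewrite -e mulr_natr -sin_mulr2n; congr sin; rewrite -mulr_natr; field.
have cx : cos (pi / 4) <= cos (x / 2) by apply: cge; lra.
have : cos (pi / 4) * cos (pi / 4) <= cos (x / 2) * cos z by apply: ler_pM.
rewrite -expr2 c4 sx => /(ler_wpM2r x0) hu.
have -> : cos (x / 2) * (cos z * (x / 2)) * 2 = cos (x / 2) * cos z * x by field.
by rewrite (le_trans _ hu) // mul1r mulrC.
Qed.

(** With |x| = 2 w, 1 - cos x = 2 sin^2 w, and sin w >= w / 2 on [0, pi/2]. *)
Lemma cos_quadratic x : `|x| <= pi -> x ^+ 2 <= 8 * (1 - cos x).
Proof.
move=> xp; rewrite -[x ^+ 2]real_normK ?num_real //.
have -> : cos x = cos `|x| by case: (leP 0 x) => [/ger0_norm|/ltr0_norm] ->; rewrite ?cosN.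
move: (`|x|) (normr_ge0 x) xp => y y0 yp.
have [w yE] : exists w, y = w *+ 2 by exists (y / 2); rewrite -[RHS]mulr_natr divfK.
move: y0 yp; rewrite yE -[w *+ 2]mulr_natr => w0 wp; have {}w0 : 0 <= w by lra.
have h : w / 2 <= sin w by apply: sin_ge_half; lra.
have {h} : (w / 2) ^+ 2 <= sin w ^+ 2.
  by rewrite lerXn2r // nnegrE ?divr_ge0 // (le_trans _ h) // divr_ge0.
rewrite mulr_natr cos_mulr2n cos2sin2 -[(_ - _) *+ 2]mulr_natr -[w *+ 2]mulr_natr.
rewrite !exprMn; move: (sin w ^+ 2) (w ^+ 2) => S W.
have -> : (2^-1 : R) ^+ 2 = 4^-1 by rewrite exprVn -natrX.
have -> : (2 : R) ^+ 2 = 4 by rewrite -natrX.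
lra.
Qed.

Local Notation unif := (uniform_prob two_pi_gt0).

Lemma Rintegral_uniform (phi : R -> R) : bounded_measurable phi ->
  \int[unif]_x phi x = (2 * pi)^-1 * \int[leb]_(x in circle) phi x.
Proof.
move=> [mphi [B phiB]].
have ip : leb.-integrable circle (EFin \o phi).
  apply: measurable_bounded_integrable => //.
  - by rewrite /= lebesgue_measure_itv /= lte_fin two_pi_gt0 -EFinB ltry.
  - exact: measurable_funTS.
  - by exists B; split; [exact: num_real|move=> M BM x _; rewrite /= (le_trans (phiB x)) // ltW].
rewrite /Rintegral integralE [in RHS]integralE.
have fp : (\int[leb]_(x in circle) (EFin \o phi)^\+ x)%E \is a fin_num.
  by apply: integrable_fin_num => //; exact: integrable_funepos.
have fn : (\int[leb]_(x in circle) (EFin \o phi)^\- x)%E \is a fin_num.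
  by apply: integrable_fin_num => //; exact: integrable_funeneg.
have mE : measurable_fun setT (EFin \o phi) by apply/measurable_EFinP.
rewrite !integral_uniform //; try exact: measurable_funepos; try exact: measurable_funeneg.
rewrite subr0 -(fineK fp) -(fineK fn) -!EFinM -!EFinB /=.
by rewrite mulrBr.
Qed.

End circle.

Section circle_expectation.
Variable R : realType.
Local Notation leb := (@lebesgue_measure R).
Local Notation circle := (`[0, 2 * pi]%classic : set R).
Local Notation unif := (uniform_prob (two_pi_gt0 R)).
Local Notation zexp k x := (expi (k%:~R * x)).

Lemma zexpD (k l : int) (x : R) : zexp (k + l) x = zexp k x * zexp l x.
Proof. by rewrite intrD mulrDl expiD. Qed.

Lemma zexpN (k : int) (x : R) : zexp (- k) x = Num.conj (zexp k x).
Proof. by rewrite intrN mulNr expi_conj. Qed.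

Lemma bounded_cmeasurable_zexp (k : int) :
  @bounded_cmeasurable _ (measurableTypeR R) R (fun x => zexp k x).
Proof.
split; [exact: measurable_cos_mul|exact: measurable_sin_mul|].
by exists 1 => x; rewrite norm_expi.
Qed.

Lemma expi_intr2pi (j : int) : expi (j%:~R * (2 * pi)) = 1 :> R[i].
Proof.
case: j => n; first by rewrite -pmulrn expiX -[2 * pi]add0r expi_period expi0 expr1n.
by rewrite NegzE intrN mulNr expi_conj -pmulrn expiX -[2 * pi]add0r expi_period expi0 expr1n rmorph1.
Qed.

Lemma circle_mean_zexp (k : int) : cexp unif (fun x => zexp k x) = (k == 0)%:R.
Proof.
have [->|k0] := eqVneq k 0.
  by under eq_cexp do rewrite mulr0z mul0r expi0; exact: cexp_cst.
have kR : k%:~R != 0 :> R by rewrite intr_eq0.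
have bm (u : R -> R) : measurable_fun setT u -> (forall x, `|u x| <= 1) ->
    @bounded_measurable _ (measurableTypeR R) R u by move=> mu u1; split; [|exists 1].
rewrite /cexp /= !Rintegral_uniform; last 2 first.
- by apply: bm => [|x]; [exact: measurable_sin_mul|exact: sin_max].
- by apply: bm => [|x]; [exact: measurable_cos_mul|exact: cos_max].
have k2pi := expi_intr2pi k.
have cmul (u : R -> R) : continuous u -> continuous (fun x : R => u (k%:~R * x)).
  by move=> cu x; apply: continuous_comp; [exact: mulrl_continuous|exact: cu].
move: k2pi => /eqP; rewrite eq_complex /= => /andP[/eqP c2 /eqP s2].
have dl (x : R) : is_derive x (1 : R) (fun x : R => k%:~R * x) k%:~R.
  by apply: is_derive_eq; rewrite /GRing.scale /= mulr1.
have -> : \int[leb]_(x in circle) cos (k%:~R * x) = 0.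
  apply: (Rintegral_derive_periodic (G := fun x : R => k%:~R^-1 * sin (k%:~R * x)) (two_pi_gt0 R)).
  - move=> x; have dc := is_derive1_comp (is_derive_sin (k%:~R * x)) (dl x).
    by apply: is_derive_eq; rewrite /GRing.scale /=; field.
  - by apply: cmul; exact: continuous_cos.
  - by rewrite s2 !mulr0 sin0 mulr0.
have -> : \int[leb]_(x in circle) sin (k%:~R * x) = 0.
  apply: (Rintegral_derive_periodic (G := fun x : R => - (k%:~R^-1 * cos (k%:~R * x)))
    (two_pi_gt0 R)).
  - move=> x; have dc := is_derive1_comp (is_derive_cos (k%:~R * x)) (dl x).
    by apply: is_derive_eq; rewrite /GRing.scale /=; field.
  - by apply: cmul; exact: continuous_sin.
  - by rewrite c2 !mulr0 cos0.
by rewrite !mulr0.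
Qed.

Lemma fourier_coef_cexp (f : R[i] -> R) (j : int) :
  @bounded_measurable _ (measurableTypeR R) R (fun x => f (expi x)) ->
  fourier_coef f j = cexp unif (fun x => (f (expi x))%:C * zexp (- j) x).
Proof.
move=> bf.
have bfz : @bounded_cmeasurable _ (measurableTypeR R) R
    (fun x => (f (expi x))%:C * zexp (- j) x).
  apply: bounded_cmeasurableM; first exact: bounded_cmeasurable_real.
  exact: bounded_cmeasurable_zexp.
rewrite /cexp !Rintegral_uniform; first last.
- exact: bounded_cmeasurable_Re.
- exact: bounded_cmeasurable_Im.
rewrite /fourier_coef /complex_integral.
under eq_Rintegral do rewrite -mulNr -intrN.
under [X in _ +i* X]eq_Rintegral do rewrite -mulNr -intrN.
by apply/eqP; rewrite eq_complex /= !mul0r subr0 addr0 !eqxx.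
Qed.

(** Riemann-Lebesgue along any sequence of distinct frequencies: by Bessel's inequality the squares
    are summable. *)
Lemma bessel_cvg0 (g : measurableTypeR R -> R[i]) (k : nat -> int) :
  bounded_cmeasurable g -> injective k ->
  Normc.normc (cexp unif (fun x => g x * zexp (- k N) x)) @[N --> \oo] --> 0.
Proof.
move=> bg kI; pose a N := cexp unif (fun x => g x * zexp (- k N) x).
have orth i j : cexp unif (fun x => zexp (k i) x * Num.conj (zexp (k j) x)) = (i == j)%:R.
  transitivity (cexp unif (fun x => zexp (k i - k j) x)).
    by apply: eq_cexp => x; rewrite zexpD zexpN.
  by rewrite circle_mean_zexp subr_eq0 (inj_eq kI).
have H N : \sum_(j < N) Normc.normc (a j) ^+ 2 <=
    complex.Re (cexp unif (fun x => g x * Num.conj (g x))).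
  have e : (\sum_(j < N) Normc.normc (a j) ^+ 2)%:C =
      \sum_(j < N) `|cexp unif (fun x => g x * Num.conj (zexp (k j) x))| ^+ 2.
    rewrite rmorph_sum; apply: eq_bigr => j _; rewrite rmorphXn; congr (_ ^+ 2).
    have -> : cexp unif (fun x => g x * Num.conj (zexp (k j) x)) = a j.
      by apply: eq_cexp => x; rewrite zexpN.
    by case: (a j).
  have : (\sum_(j < N) Normc.normc (a j) ^+ 2)%:C <=
      cexp unif (fun x => g x * Num.conj (g x)).
    by rewrite e; exact: (bessel bg (fun N => bounded_cmeasurable_zexp (k N)) orth N).
  by rewrite lecE /= => /andP[_].
have cs : cvgn (series (fun j => Normc.normc (a j) ^+ 2)).
  apply: nondecreasing_is_cvgn.
    by apply/nondecreasing_seqP => m; rewrite seriesSr lerDl sqr_ge0.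
  exists (complex.Re (cexp unif (fun x => g x * Num.conj (g x)))) => _ [N _ <-].
  by rewrite /series /= big_mkord.
apply/cvgrPdist_lt => e e0.
have /cvgrPdist_lt /(_ (e ^+ 2)) := cvg_series_cvg_0 cs.
rewrite exprn_gt0 // => /(_ isT); apply: filterS => N.
rewrite !sub0r !normrN ger0_norm ?sqr_ge0 // ger0_norm ?normc_ge0 //.
rewrite -/(a N) => lt; rewrite ltNge; apply/negP => le; move: lt; rewrite ltNge => /negP; apply.
by rewrite lerXn2r // nnegrE ?normc_ge0 ?(ltW e0).
Qed.

End circle_expectation.

Section smooth_functions.
Variables (R : realType) (f : R[i] -> R).
Hypothesis f_smooth : circle_smooth f.
Local Notation leb := (@lebesgue_measure R).
Local Notation circle := (`[0, 2 * pi]%classic : set R).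
Local Notation unif := (uniform_prob (two_pi_gt0 R)).
Local Notation zexp k x := (expi (k%:~R * x)).
Local Notation F k := (derive1n k (fun y : R => f (expi y))).

Lemma is_derive_smooth k (x : R) : is_derive x (1 : R) (F k) (F k.+1 x).
Proof.
have -> : F k.+1 x = 'D_1 (F k) x by rewrite -derive1E.
by apply/derivableP; exact: f_smooth.
Qed.

Lemma continuous_smooth k : continuous (F k).
Proof.
move=> x; apply: differentiable_continuous; apply/derivable1_diffP.
exact: f_smooth.
Qed.

Lemma periodic_smooth k (x : R) : F k (x + 2 * pi) = F k x.
Proof.
elim: k x => [|k IH] x; first by rewrite /= expi_period.
have dl : is_derive x (1 : R) (fun y : R => y + 2 * pi) 1.
  by apply: is_derive_eq; rewrite addr0.
have := @is_derive1_comp _ (F k) _ x _ _ (is_derive_smooth k (x + 2 * pi)) dl.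
rewrite (_ : _ \o _ = F k); last by apply/funext => y; exact: IH.
rewrite mulr1 => h.
have d1 := @derive_val _ _ _ _ _ _ _ h.
have d2 := @derive_val _ _ _ _ _ _ _ (is_derive_smooth k x).
exact: etrans (esym d1) d2.
Qed.

Lemma bounded_smooth k (a b : R) : exists B, forall x, a <= x <= b -> `|F k x| <= B.
Proof.
have [M [_ hM]] : bounded_set (F k @` `[a, b]).
  apply: compact_bounded; apply: continuous_compact; last exact: segment_compact.
  by apply: continuous_subspaceT; exact: continuous_smooth.
exists (M + 1) => x xab; apply: (hM (M + 1)); first by rewrite ltrDl.
by exists x => //=; rewrite in_itv.
Qed.

Lemma bounded_measurable_smooth :
  @bounded_measurable _ (measurableTypeR R) R (fun x => f (expi x)).
Proof.
split; first by apply: continuous_measurable_fun; exact: (@continuous_smooth 0).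
have [B hB] := bounded_smooth 0 0 (2 * pi); exists B => x.
have [r r2 ->] := circle_arg (norm_expi x).
exact: hB.
Qed.

Section decay.
Variable j : R.
Hypothesis j2pi : cos (j * (2 * pi)) = 1 /\ sin (j * (2 * pi)) = 0.
Let A k := \int[leb]_(x in circle) (F k x * cos (j * x)).
Let B k := \int[leb]_(x in circle) (F k x * sin (j * x)).

Let dcos (x : R) : is_derive x (1 : R) (fun x => cos (j * x)) (- (j * sin (j * x))).
Proof.
have dl : is_derive x (1 : R) (fun x : R => j * x) j.
  by apply: is_derive_eq; rewrite /GRing.scale /= mulr1.
have := is_derive1_comp (is_derive_cos (j * x)) dl.
by rewrite mulNr mulrC.
Qed.

Let dsin (x : R) : is_derive x (1 : R) (fun x => sin (j * x)) (j * cos (j * x)).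
Proof.
have dl : is_derive x (1 : R) (fun x : R => j * x) j.
  by apply: is_derive_eq; rewrite /GRing.scale /= mulr1.
have := is_derive1_comp (is_derive_sin (j * x)) dl.
by rewrite mulrC.
Qed.

Let cmul (u : R -> R) : continuous u -> continuous (fun x : R => u (j * x)).
Proof. by move=> cu x; apply: continuous_comp; [exact: mulrl_continuous|exact: cu]. Qed.

Let ic (u : R -> R) : continuous u -> leb.-integrable circle (EFin \o u).
Proof.
move=> cu; apply: continuous_compact_integrable; first exact: segment_compact.
exact: continuous_subspaceT.
Qed.

Let cF k (u : R -> R) : continuous u -> continuous (fun x : R => F k x * u (j * x)).
Proof. by move=> cu x; apply: cvgM; [exact: continuous_smooth|exact: cmul]. Qed.

Let Fper k : F k (2 * pi) = F k 0.
Proof. by rewrite -(periodic_smooth k 0) add0r. Qed.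

Let parts_cos k : A k.+1 = j * B k.
Proof.
have [c2 s2] := j2pi.
have : \int[leb]_(x in circle) (F k.+1 x * cos (j * x) - j * (F k x * sin (j * x))) = 0.
  apply: (Rintegral_derive_periodic (G := fun x => F k x * cos (j * x)) (two_pi_gt0 R)).
  - move=> x; have d1 := is_derive_smooth k x; have d2 := dcos x.
    apply: is_derive_eq.
    by rewrite /GRing.scale /=; ring.
  - have c1 := @cF k.+1 _ (@continuous_cos R); have c3 := @cF k _ (@continuous_sin R).
    by move=> x; apply: cvgB; [exact: c1|apply: cvgM; [exact: cvg_cst|exact: c3]].
  - by rewrite Fper c2 mulr0 cos0.
rewrite RintegralB //; last 2 first.
- by apply: ic; exact: (cF (@continuous_cos R)).
- by apply: integrable_EFinZ => //; apply: ic; exact: (cF (@continuous_sin R)).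
rewrite RintegralZl //; last by apply: ic; exact: (cF (@continuous_sin R)).
by move/eqP; rewrite subr_eq0 => /eqP.
Qed.

Let parts_sin k : B k.+1 = - (j * A k).
Proof.
have [c2 s2] := j2pi.
have : \int[leb]_(x in circle) (F k.+1 x * sin (j * x) + j * (F k x * cos (j * x))) = 0.
  apply: (Rintegral_derive_periodic (G := fun x => F k x * sin (j * x)) (two_pi_gt0 R)).
  - move=> x; have d1 := is_derive_smooth k x; have d2 := dsin x.
    apply: is_derive_eq.
    by rewrite /GRing.scale /=; ring.
  - have c1 := @cF k.+1 _ (@continuous_sin R); have c3 := @cF k _ (@continuous_cos R).
    by move=> x; apply: cvgD; [exact: c1|apply: cvgM; [exact: cvg_cst|exact: c3]].
  - by rewrite Fper s2 !mulr0 sin0 mulr0.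
rewrite RintegralD //; last 2 first.
- by apply: ic; exact: (cF (@continuous_sin R)).
- by apply: integrable_EFinZ => //; apply: ic; exact: (cF (@continuous_cos R)).
rewrite RintegralZl //; last by apply: ic; exact: (cF (@continuous_cos R)).
by move/eqP; rewrite addr_eq0 => /eqP.
Qed.

(** Each integration by parts exchanges the cosine and sine integrals and multiplies them by j up to
    sign. Periodicity kills the boundary terms. *)
Lemma smooth_parts k : A k ^+ 2 + B k ^+ 2 = j ^+ (2 * k) * (A 0%N ^+ 2 + B 0%N ^+ 2).
Proof.
elim: k => [|k IH]; first by rewrite muln0 mul1r.
rewrite parts_cos parts_sin sqrrN !exprMn -mulrDr addrC IH mulrA -exprD.
by congr (_ ^+ _ * _); lia.
Qed.

Lemma smooth_coef_bound k (M : R) : (forall x, 0 <= x <= 2 * pi -> `|F k x| <= M) ->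
  A k ^+ 2 + B k ^+ 2 <= 2 * (2 * pi * M) ^+ 2.
Proof.
move=> FM.
have bnd (u : R -> R) : continuous u -> (forall x, `|u x| <= 1) ->
    (\int[leb]_(x in circle) (F k x * u (j * x))) ^+ 2 <= (2 * pi * M) ^+ 2.
  move=> cu u1.
  have iu : leb.-integrable circle (EFin \o (fun x => F k x * u (j * x))).
    by apply: ic; exact: cF.
  rewrite -[leLHS]real_normK ?num_real // lerXn2r ?nnegrE //.
    rewrite mulr_ge0 ?(ltW (two_pi_gt0 R)) //.
    by rewrite (le_trans _ (FM 0 _)) // lexx (ltW (two_pi_gt0 R)).
  rewrite (le_trans (le_normr_Rintegral _ iu)) //.
  apply: (@le_trans _ _ (\int[leb]_(x in circle) M)).
    apply: le_Rintegral => //.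
    - exact: integrable_norm iu.
    - by apply: (ic (u := fun=> M)) => x; exact: cvg_cst.
    - move=> x /=; rewrite in_itv /= => x2; rewrite normrM.
      by rewrite (le_trans _ (FM x x2)) // ler_piMr.
  rewrite Rintegral_cst // /= lebesgue_measure_itv /= lte_fin two_pi_gt0 /= subr0.
  by rewrite mulrC.
rewrite mulr_natl mulr2n lerD // bnd //.
- exact: continuous_cos.
- exact: cos_max.
- exact: continuous_sin.
- exact: sin_max.
Qed.

End decay.

Lemma fourier_decay_smooth (f_L1 : circle_integrable f) (kappa : R) : fourier_decay f kappa.
Proof.
pose m := (Num.truncn kappa).+1.
have km : kappa <= m%:R by apply/ltW/truncnS_gt.
have [M hM] := bounded_smooth m 0 (2 * pi).
have M0 : 0 <= M.
  by rewrite (le_trans _ (hM 0 _)) // lexx (ltW (two_pi_gt0 R)).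
(* After m >= kappa integrations by parts, the coefficient times |j|^m is at most sqrt 2 M <= 2 M;
   the 1 makes the constant positive. *)
exists (2 * M + 1); first by rewrite ltr_wpDl // mulr_ge0.
move=> j j0; set a := `|j|%N%:R : R.
have a1 : 1 <= a by rewrite ler1n absz_gt0.
have a0 : 0 < a := lt_le_trans ltr01 a1.
apply: (@le_trans _ _ (2 * M * a `^ (- m%:R))); last first.
  apply: ler_pM; rewrite ?powR_ge0 ?mulr_ge0 ?lerDl //.
  by apply: ler_powR => //; rewrite lerN2.
rewrite powRN powR_mulrn ?(ltW a0) //.
have j2 : cos ((j%:~R : R) * (2 * pi)) = 1 /\ sin ((j%:~R : R) * (2 * pi)) = 0.
  by have /eqP := expi_intr2pi R j; rewrite eq_complex /= => /andP[/eqP -> /eqP ->].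
have := smooth_coef_bound j%:~R hM; rewrite smooth_parts //.
have -> : (j%:~R : R) ^+ (2 * m) = (a ^+ m) ^+ 2.
  rewrite exprM -[X in X ^+ m](real_normK (num_real _)) -intr_norm -natr_absz -/a.
  by rewrite -!exprM mulnC.
rewrite fourier_coefE //=.
set A := \int[leb]_(x in _) (_ * cos _); set B := \int[leb]_(x in _) (_ * sin _) => h.
have am : 0 < a ^+ m by rewrite exprn_gt0.
rewrite ler_pdivlMr //.
rewrite -(@ler_pXn2r _ 2) // ?nnegrE ?mulr_ge0 ?sqrtr_ge0 ?(ltW am) //.
rewrite exprMn sqr_sqrtr ?addr_ge0 ?sqr_ge0 //.
have p0 := two_pi_gt0 R; move: h; move: (2 * pi) p0 (a ^+ m) => P p0 D h.
have := ler_wpM2l (sqr_ge0 P^-1) h.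
have -> : P^-1 ^+ 2 * (2 * (P * M) ^+ 2) = 2 * M ^+ 2 by field; rewrite gt_eqF.
move=> h2; apply: (@le_trans _ _ (2 * M ^+ 2)); last by have := sqr_ge0 M; lra.
by rewrite (le_trans _ h2) // le_eqVlt; apply/orP; left; apply/eqP; ring.
Qed.

End smooth_functions.

Section fourier_inversion.
Variables (R : realType) (f : R[i] -> R) (x0 : R).
Hypotheses (f_smooth : circle_smooth f) (x0_itv : 0 <= x0 <= 2 * pi).
Local Notation unif := (uniform_prob (two_pi_gt0 R)).
Local Notation zexp k x := (expi (k%:~R * x)).
Local Notation F t := (f (expi t)).
Let D (t : R) : R := F t - F x0.
Let u (t : R) : R := cos t - cos x0.
Let w (t : R) : R := sin t - sin x0.
Let N2 (t : R) : R := u t ^+ 2 + w t ^+ 2.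

Let N2E t : N2 t = 2 * (1 - cos (t - x0)).
Proof.
rewrite /N2 /u /w cosB; have := cos2Dsin2 t; have := cos2Dsin2 x0.
by move: (cos t) (sin t) (cos x0) (sin x0) => a b c e h1 h2; lra.
Qed.

Let N2_ge0 t : 0 <= N2 t. Proof. by rewrite addr_ge0 ?sqr_ge0. Qed.

(** [N2] is the squared chord from expi x0 to expi t. Modulo 2 pi, t may be taken within pi of x0;
    there the mean value theorem bounds [D] by the arc, and [cos_quadratic] bounds the arc by the
    chord. *)
Lemma smooth_chord_lipschitz : exists2 K, 0 <= K & forall t, D t ^+ 2 <= K * N2 t.
Proof.
have p0 := pi_gt0 R.
(* This interval contains every point within pi of x0, as x0 lies in [0, 2 pi]. *)
have [L hL] := bounded_smooth f_smooth 1 (- (2 * pi)) (4 * pi).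
exists (4 * L ^+ 2) => [|t]; first by rewrite mulr_ge0 ?sqr_ge0.
have near_case r : `|r - x0| <= pi -> D r ^+ 2 <= 4 * L ^+ 2 * N2 r.
  move=> rx; have [z hz] := mean_value_oriented x0 r (is_derive_smooth f_smooth 0).
  rewrite /D /= => ->; rewrite exprMn N2E.
  have Lz : `|derive1n 1 (fun y : R => f (expi y)) z| <= L.
    apply: hL; move: (le_trans hz rx); rewrite ler_norml => /andP[h1 h2].
    by move/andP: x0_itv => [h3 h4]; apply/andP; split; lra.
  have L2 : (derive1n 1 (fun y : R => f (expi y)) z) ^+ 2 <= L ^+ 2.
    by rewrite -[leLHS]real_normK ?num_real // lerXn2r // nnegrE // (le_trans _ Lz).
  have q := cos_quadratic rx.
  rewrite (_ : 4 * L ^+ 2 * _ = L ^+ 2 * (8 * (1 - cos (r - x0)))); last by ring.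
  by apply: ler_pM; rewrite ?sqr_ge0.
have ext r s : expi r = expi s :> R[i] -> D r = D s /\ N2 r = N2 s.
  by move=> e; rewrite /D /N2 /u /w e; case: e => -> ->.
have [r r2 e] := circle_arg (norm_expi t).
have [-> ->] := ext _ _ e.
move/andP: r2 => [r0 r2]; move/andP: x0_itv => [h3 h4].
have [h|h] := leP (r - x0) pi; last first.
  have [|-> ->] := ext r (r - 2 * pi); first by rewrite -[r in LHS](subrK (2 * pi)) expi_period.
  by apply: near_case; rewrite ler_norml; apply/andP; split; lra.
have [h'|h'] := leP (- pi) (r - x0); first by apply: near_case; rewrite ler_norml h' h.
have [|-> ->] := ext r (r + 2 * pi); first by rewrite expi_period.
by apply: near_case; rewrite ler_norml; apply/andP; split; lra.
Qed.

(* The difference quotient of f at expi x0, written with the conjugate of the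
   chord so that its real and imaginary parts are explicit. *)
Let gam (t : measurableTypeR R) : R[i] :=
  (D t * N2 t `^ (-1) * u t) +i* (- (D t * N2 t `^ (-1) * w t)).

Let gam_mul t : gam t * (zexp 1 t - expi x0) = (D t)%:C.
Proof.
have -> : (zexp 1 t - expi x0) = (u t) +i* (w t) by rewrite mul1r.
have [K K0 hK] := smooth_chord_lipschitz.
rewrite /gam powR_inv1 ?N2_ge0 //; apply/eqP; rewrite eq_complex /=.
(* At the point itself the chord inequality forces D t = 0, so the default value of the inverse at 0
   does no harm. *)
have [N0|N0] := eqVneq (N2 t) 0.
  have -> : D t = 0.
    by apply/eqP; rewrite -sqrf_eq0 eq_le sqr_ge0 andbT (le_trans (hK t)) // N0 mulr0.
  by rewrite !mul0r oppr0 !mul0r subrr addr0 eqxx.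
apply/andP; split; apply/eqP; last by ring.
rewrite (_ : _ - _ = D t * (N2 t)^-1 * N2 t); last by rewrite /N2; ring.
by rewrite mulfVK.
Qed.

Let bgam : @bounded_cmeasurable _ (measurableTypeR R) R gam.
Proof.
have mD : measurable_fun setT D.
  have cF0 : continuous (fun t : R => F t) := @continuous_smooth _ _ f_smooth 0.
  by apply: measurable_funB => //; exact: continuous_measurable_fun.
have mu' : measurable_fun setT u.
  by apply: measurable_funB => //; exact: continuous_measurable_fun (@continuous_cos R).
have mw : measurable_fun setT w.
  by apply: measurable_funB => //; exact: continuous_measurable_fun (@continuous_sin R).
have mN : measurable_fun setT (fun t => N2 t `^ (-1)).
  apply: (measurableT_comp (measurable_powR (-1))).
  by apply: measurable_funD; exact: measurable_funX.
have [K K0 hK] := smooth_chord_lipschitz.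
split.
- by apply: measurable_funM => //; exact: measurable_funM.
- by apply: measurableT_comp => //; apply: measurable_funM => //; exact: measurable_funM.
exists (Num.sqrt K) => t; rewrite normc_def /= lecR ler_sqrt // sqrrN.
rewrite powR_inv1 ?N2_ge0 // (_ : _ + _ = D t ^+ 2 * (N2 t)^-1 ^+ 2 * N2 t); last first.
  by rewrite /N2; ring.
have [N0|N0] := eqVneq (N2 t) 0; first by rewrite N0 mulr0.
have Np : 0 < N2 t by rewrite lt0r N0 N2_ge0.
by rewrite -mulrA expr2 -[_ * _ * N2 t]mulrA mulVf // mulr1 ler_pdivrMr // -expr2.
Qed.

Let ghat (k : int) : R[i] := cexp unif (fun t => gam t * zexp (- k) t).

(** F is gam times the chord plus the constant F x0. Multiplied by (expi x0)^k, the first two terms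
    are consecutive values of one sequence, and the last one occurs only for k = 0. *)
Let coef_telescope (k : int) : fourier_coef f k =
  ghat (k - 1) - expi x0 * ghat k + (F x0)%:C * (k == 0)%:R.
Proof.
rewrite fourier_coef_cexp; last exact: bounded_measurable_smooth.
have bz (l : int) : @bounded_cmeasurable _ (measurableTypeR R) R (fun t => gam t * zexp l t).
  by apply: bounded_cmeasurableM; [exact: bgam|exact: bounded_cmeasurable_zexp].
transitivity (cexp unif (fun t => gam t * zexp (- (k - 1)) t -
    expi x0 * (gam t * zexp (- k) t) + (F x0)%:C * zexp (- k) t)).
  apply: eq_cexp => t; rewrite opprB addrC -[1 - k]/(1 + - k) zexpD.
  have -> : (F t)%:C = gam t * (zexp 1 t - expi x0) + (F x0)%:C.
    by rewrite gam_mul -rmorphD /D subrK.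
  by ring.
rewrite cexpD; first last.
- by apply: bounded_cmeasurableZ; exact: bounded_cmeasurable_zexp.
- by apply: bounded_cmeasurableB => //; exact: bounded_cmeasurableZ.
rewrite cexpB //; last exact: bounded_cmeasurableZ.
rewrite !cexpZ //; last exact: bounded_cmeasurable_zexp.
by rewrite circle_mean_zexp oppr_eq0.
Qed.

Let partial_sumE N : fourier_partial_sum f N (expi x0) =
  (F x0)%:C + ghat (- N.+1%:Z) * expi x0 ^ (- N%:Z) - ghat N%:Z * expi x0 ^ N.+1%:Z.
Proof.
have z0 : expi x0 != 0 :> R[i] by rewrite -normr_eq0 norm_expi oner_neq0.
elim: N => [|N IH].
  rewrite /fourier_partial_sum big_geq // addr0 coef_telescope eqxx mulr1 sub0r.
  by rewrite expr0z mulr1 expr1z addrC addrA mulrC.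
rewrite /fourier_partial_sum big_nat_recr //= addrA -/(fourier_partial_sum f N _) IH.
rewrite !coef_telescope /= mulr0 !addr0.
have -> : N.+1%:Z - 1 = N%:Z by lia.
have -> : - N.+1%:Z - 1 = - N.+2%:Z by lia.
have e1 (z : R[i]) : z ^ (Posz N.+2) = z * z ^ (Posz N.+1) by rewrite -!exprnP exprS.
have e2 (z : R[i]) : z != 0 -> z ^ (- (Posz N)) = z * z ^ (- (Posz N.+1)).
  by move=> zn; rewrite -!exprnN exprS invfM mulrA mulfV // mul1r.
by rewrite e1 (e2 _ z0); ring.
Qed.

Lemma fourier_inversion : fourier_sum f (expi x0) = f (expi x0).
Proof.
apply/cvg_lim => //; apply/cvgrPdist_lt => e e0.
have e2 : 0 < e / 2 by rewrite divr_gt0.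
have /cvgrPdist_lt /(_ _ e2) h1 := bessel_cvg0 (k := fun N => - N.+1%:Z) bgam
  ltac:(by move=> i j /oppr_inj [] ->).
have /cvgrPdist_lt /(_ _ e2) h2 := bessel_cvg0 (k := fun N => N%:Z) bgam
  ltac:(by move=> i j [] ->).
move: h1 h2; apply: filterS2 => N.
rewrite !sub0r !normrN => h1 h2.
rewrite ger0_norm ?normc_ge0 // -/(ghat (- N.+1%:Z)) in h1.
rewrite ger0_norm ?normc_ge0 // -/(ghat N%:Z) in h2.
rewrite distrC -ltcR; apply: le_lt_trans (_ : `|fourier_partial_sum f N (expi x0) - (F x0)%:C| < _).
  rewrite (_ : complex.Re _ - _ = complex.Re (fourier_partial_sum f N (expi x0) - (F x0)%:C)).
    exact: normc_ge_Re.
  by case: (fourier_partial_sum _ _ _).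
rewrite partial_sumE.
have -> : forall a b c : R[i], a + b - c - a = b - c by move=> a b c; ring.
rewrite (le_lt_trans (ler_normD _ _)) // normrN !normrM.
have zk (k : int) : `|expi x0 ^ k| = 1 :> R[i].
  by case: k => n; rewrite ?NegzE -?exprnP -?exprnN ?normfV normrX norm_expi expr1n ?invr1.
rewrite !zk !mulr1.
have nE z : `|z| = (Normc.normc z)%:C :> R[i] by case: z.
by rewrite !nE -rmorphD ltcR; move: h1 h2; lra.
Qed.

End fourier_inversion.

(** * Fluctuations of linear statistics *)

Section haar_approximation.
Variables (R : realType) (n' : nat).
Local Notation n := n'.+1.
Local Notation UR := (unitary R n).
Variable mu : probability UR R.
Hypothesis hmu : is_haar mu.
Variables (f : R[i] -> R) (kappa C : R).
Hypotheses (f_L1 : circle_integrable f) (kappa1 : 1 < kappa) (C0 : 0 < C).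
Hypothesis decay : forall j, j != 0 ->
  Normc.normc (fourier_coef f j) <= C * (`|j|%N%:R `^ (- kappa)).
Local Notation c := (fun j : nat => fourier_coef f j%:Z).
Local Notation a j := (Normc.normc (fourier_coef f j%:Z)).
Local Notation S := (linear_statistic c).
Local Notation T d := (2 * (C / (kappa - 1) * d%:R `^ (1 - kappa))).

(** The mean of L_n(f) is the coefficient of index 0, so this is the fluctuation; see
    [fluctuationE]. *)
Definition centered_statistic (M : UR) : R :=
  \sum_(i < n) (fourier_sum f (eigen M i) - complex.Re (fourier_coef f 0)).
Local Notation Y := centered_statistic.

(** A uniform bound with a factor n, too weak for the rate. It serves for fixed n only, to get
    measurability, boundedness and limits as the truncation grows. *)
Lemma centered_statistic_tail d M : (0 < d)%N -> `|Y M - S d M| <= n%:R * T d.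
Proof.
move=> d0.
have -> : S d M = \sum_(i < n) \sum_(j < d) 2 * complex.Re (c j.+1 * eigen M i ^+ j.+1).
  rewrite exchange_big; apply: eq_bigr => j _; rewrite power_trace_eigen.
  by rewrite -mulr_sumr; congr (_ * _); rewrite mulr_sumr raddf_sum.
rewrite -sumrB (le_trans (ler_norm_sum _ _ _)) //.
rewrite -[X in X * _](_ : (\sum_(i < n) 1) = n%:R :> R); last by rewrite sumr_const card_ord.
rewrite mulr_suml; apply: ler_sum => i _; rewrite mul1r.
have [_] := fourier_sum_tail f_L1 kappa1 C0 decay d0 (norm_eigen M i).
by rewrite opprD addrA.
Qed.

Lemma tail_small (K e : R) : 0 < e -> exists2 N, (0 < N)%N & K * N%:R `^ (1 - kappa) <= e.
Proof.
move=> e0; have k0 : 0 < kappa - 1 by rewrite subr_gt0.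
pose x := (`|K| / e) `^ (kappa - 1)^-1.
exists (Num.truncn x).+1 => //; set N := _.+1.
have xN : x <= N%:R by apply/ltW/truncnS_gt.
have h : `|K| / e <= N%:R `^ (kappa - 1).
  have <- : (`|K| / e) `^ ((kappa - 1)^-1 * (kappa - 1)) = `|K| / e.
    by rewrite mulVf ?lt0r_neq0 // powRr1 // divr_ge0 // ltW.
  by rewrite powRrM ge0_ler_powR ?nnegrE ?powR_ge0 // ltW.
rewrite -opprB powRN (le_trans (ler_wpM2r _ (ler_norm K))) ?invr_ge0 ?powR_ge0 //.
by rewrite ler_pdivrMr ?powR_gt0 ?ltr0n // mulrC -ler_pdivrMr.
Qed.

Lemma measurable_centered_statistic : measurable_fun setT Y.
Proof.
apply: (@measurable_fun_cvg _ _ R setT (fun N => S N)) => //.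
  by move=> N; have [] := @bounded_linear_statistic R n' c N.
move=> M _; apply/cvgrPdist_le => e e0.
have [N N0 hN] := tail_small (n%:R * (2 * (C / (kappa - 1)))) e0.
near=> m; have Nm : (N <= m)%N by near: m; exact: nbhs_infty_ge.
have m0 : (0 < m)%N by apply: leq_trans Nm.
apply: (le_trans (centered_statistic_tail M m0)); apply: le_trans hN.
rewrite !mulrA ler_wpM2l //.
  by rewrite !mulr_ge0 ?invr_ge0 ?subr_ge0 ?(ltW C0) ?(ltW kappa1).
rewrite -opprB !powRN lef_pV2 ?posrE ?powR_gt0 ?ltr0n //.
by apply: ge0_ler_powR; rewrite ?nnegrE ?subr_ge0 ?(ltW kappa1) // ler_nat.
Unshelve. all: by end_near. Qed.

Lemma bounded_centered_statistic : bounded_measurable Y.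
Proof.
split; first exact: measurable_centered_statistic.
have [_ [B hB]] := @bounded_linear_statistic R n' c 1.
exists (n%:R * T 1 + B) => M; rewrite -[Y M](subrK (S 1 M)).
rewrite (le_trans (ler_normD _ _)) // lerD //; exact: centered_statistic_tail.
Qed.

Lemma bounded_statistic_gap d N : bounded_measurable (fun M : UR => S N M - S d M).
Proof. by apply: bounded_measurableB; exact: bounded_linear_statistic. Qed.

Lemma haar_statistic_mean N : \int[mu]_M S N M = 0.
Proof.
apply: (@complexI R); rewrite -cexp_real.
rewrite (@eq_cexp _ _ _ _ _ (fun M => \sum_(j < N) (c j.+1 * power_trace j.+1 M +
   Num.conj (c j.+1 * power_trace j.+1 M)))); last by move=> M; exact: linear_statisticE.
have bp k : bounded_cmeasurable (fun M : UR => c k * power_trace k M).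
  by apply: bounded_cmeasurableZ; exact: bounded_power_trace.
rewrite cexp_sum; last first.
  by move=> k _; apply: bounded_cmeasurableD => //; exact: bounded_cmeasurable_conj.
rewrite big1 // => k _; rewrite cexpD //; last exact: bounded_cmeasurable_conj.
rewrite cexp_conj // cexpZ; last exact: bounded_power_trace.
by rewrite haar_power_trace_mean // mulr0 rmorph0 addr0.
Qed.

Lemma haar_centered_statistic_mean : \int[mu]_M Y M = 0.
Proof.
apply/eqP; rewrite -normr_eq0 eq_le normr_ge0 andbT; apply/ler_addgt0Pr => e e0.
have [N N0 hN] := tail_small (n%:R * (2 * (C / (kappa - 1)))) e0.
rewrite add0r -[X in `|X|]subr0 -(haar_statistic_mean N).
have bY := bounded_centered_statistic; have bS := @bounded_linear_statistic R n' c N.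
rewrite -RintegralB ?bounded_measurable_integrable //.
apply: bounded_Rintegral_le; first exact: bounded_measurableB.
move=> M; rewrite (le_trans (centered_statistic_tail M N0)) //.
by rewrite !mulrA in hN *.
Qed.

(** By orthogonality only the diagonal terms |c_j|^2 E |p_j|^2 <= j |c_j|^2 remain, so the bound is
    free of n. The gap is twice a real part, whence the 4. *)
Lemma haar_statistic_gap_sqr d N : (0 < d <= N)%N ->
  \int[mu]_M (S N M - S d M) ^+ 2 <=
  4 * (C ^+ 2 / (2 * kappa - 2) * d%:R `^ (2 - 2 * kappa)).
Proof.
move=> /andP[d0 dN].
pose Z (M : UR) := \sum_(d <= j < N) c j.+1 * power_trace j.+1 M.
have bp k : bounded_cmeasurable (fun M : UR => power_trace k M) by exact: bounded_power_trace.
have bcp k : bounded_cmeasurable (fun M : UR => c k * power_trace k M).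
  exact: bounded_cmeasurableZ.
have bZ : bounded_cmeasurable Z by apply: bounded_cmeasurable_sum => k _.
have gapE M : S N M - S d M = 2 * complex.Re (Z M).
  rewrite /linear_statistic -!(big_mkord xpredT (fun j => 2 * complex.Re (c j.+1 * power_trace j.+1 M))).
  rewrite (big_cat_nat (n := d)) //= addrAC subrr add0r /Z raddf_sum mulr_sumr.
  by [].
have ZZ : cexp mu (fun M => Z M * Num.conj (Z M)) <=
    (C ^+ 2 / (2 * kappa - 2) * d%:R `^ (2 - 2 * kappa))%:C.
  rewrite (@eq_cexp _ _ _ _ _ (fun M => \sum_(d <= j < N) \sum_(d <= k < N)
      (c j.+1 * Num.conj (c k.+1)) * (power_trace j.+1 M * Num.conj (power_trace k.+1 M)))); last first.
    move=> M; rewrite /Z rmorph_sum big_distrl; apply: eq_bigr => j _.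
    by rewrite big_distrr; apply: eq_bigr => k _; rewrite /= rmorphM mulrACA.
  have bpp j k : bounded_cmeasurable (fun M : UR =>
      power_trace j.+1 M * Num.conj (power_trace k.+1 M)).
    by apply: bounded_cmeasurableM => //; exact: bounded_cmeasurable_conj.
  rewrite cexp_sum; last first.
    by move=> j _; apply: bounded_cmeasurable_sum => k _; exact: bounded_cmeasurableZ.
  have := weight_tail kappa1 C0 decay N d0; rewrite -lecR; apply: le_trans.
  rewrite rmorph_sum !big_nat; apply: ler_sum => j /andP[dj jN].
  rewrite cexp_sum; last by move=> k _; exact: bounded_cmeasurableZ.
  rewrite (bigD1_seq j) /= ?mem_index_iota ?dj ?iota_uniq //.
  rewrite [X in _ + X]big1 ?addr0; last first.
    move=> k kj; rewrite cexpZ // haar_power_trace_orthogonal ?mulr0 //.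
    by rewrite eqSS eq_sym.
  rewrite cexpZ // haar_power_trace_second_moment // -normCK.
  have -> : `|c j.+1| = (a j.+1)%:C by case: (fourier_coef _ _).
  rewrite -rmorphXn -(rmorph_nat (real_complex R)) -rmorphM lecR mulrC.
  by rewrite ler_wpM2r ?sqr_ge0 // ler_nat geq_minl.
have bg := bounded_statistic_gap d N.
rewrite -lecR -cexp_real.
apply: (@le_trans _ _ (cexp mu (fun M => 4 * (Z M * Num.conj (Z M))))).
  apply: cexp_le.
  - by apply: bounded_cmeasurable_real; exact: (bounded_measurableM bg bg).
  - apply: bounded_cmeasurableZ; apply: bounded_cmeasurableM => //.
    exact: bounded_cmeasurable_conj.
  move=> M; rewrite gapE -normCK rmorphXn rmorphM rmorph_nat exprMn -natrX ler_wpM2l //.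
  have -> : ((complex.Re (Z M))%:C) ^+ 2 = `|complex.Re (Z M)|%:C ^+ 2 :> R[i].
    by rewrite -!rmorphXn real_normK // num_real.
  have h0 : 0 <= `|complex.Re (Z M)|%:C :> R[i] by rewrite ler0c.
  rewrite !expr2; apply: (ler_pM h0 h0); exact: normc_ge_Re.
rewrite cexpZ; last by apply: bounded_cmeasurableM => //; exact: bounded_cmeasurable_conj.
by rewrite [leRHS]rmorphM rmorph_nat ler_wpM2l.
Qed.

(** From second to first moment by y <= t / 2 + y^2 / (2 t), with t = d^(1 - kappa), the order of
    the square root of the second moment. *)
Lemma haar_statistic_gap d N : (0 < d <= N)%N ->
  \int[mu]_M `|S N M - S d M| <=
  (1 + 4 * (C ^+ 2 / (2 * kappa - 2))) / 2 * d%:R `^ (1 - kappa).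
Proof.
move=> dN; have /andP[d0 _] := dN; have := haar_statistic_gap_sqr dN.
set t := d%:R `^ (1 - kappa); have t0 : 0 < t by rewrite powR_gt0 // ltr0n.
have -> : d%:R `^ (2 - 2 * kappa) = t ^+ 2 :> R.
  rewrite /t -powR_mulrn ?powR_ge0 // -powRrM; congr powR; ring.
set V := C ^+ 2 / _ => h2.
have bg := bounded_statistic_gap d N.
have bg2 : bounded_measurable (fun M => (S N M - S d M) ^+ 2) := bounded_measurableM bg bg.
apply: (@le_trans _ _ (\int[mu]_M (t / 2 + (2 * t)^-1 * (S N M - S d M) ^+ 2))).
  apply: le_Rintegral => //.
  - by apply: bounded_measurable_integrable; exact: bounded_measurable_norm.
  - apply: bounded_measurable_integrable; apply: bounded_measurableD.
      exact: bounded_measurable_cst.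
    by apply: bounded_measurableM => //; exact: bounded_measurable_cst.
  move=> M _; rewrite -[(S N M - S d M) ^+ 2]real_normK ?num_real //; set y := `|_|.
  rewrite -subr_ge0 (_ : _ - _ = (2 * t)^-1 * (y - t) ^+ 2).
    by rewrite mulr_ge0 ?sqr_ge0 // invr_ge0 mulr_ge0 // ltW.
  by field; rewrite gt_eqF.
rewrite RintegralD ?bounded_measurable_integrable //; last 2 first.
- exact: bounded_measurable_cst.
- by apply: bounded_measurableM => //; exact: bounded_measurable_cst.
rewrite Rintegral_probability_cst RintegralZl ?bounded_measurable_integrable //.
have := ler_wpM2l (_ : 0 <= (2 * t)^-1) h2.
rewrite invr_ge0 mulr_ge0 ?(ltW t0) // => /(_ isT) h3.
rewrite (_ : _ / 2 * t = t / 2 + (2 * t)^-1 * (4 * (V * t ^+ 2))); last by field; rewrite gt_eqF.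
by rewrite lerD2l.
Qed.

(** The level N depends on n and is so large that the crude tail is below e; from d to N the bound
    free of n applies. *)
Lemma haar_centered_statistic_gap d : (0 < d)%N ->
  \int[mu]_M `|Y M - S d M| <=
  (1 + 4 * (C ^+ 2 / (2 * kappa - 2))) / 2 * d%:R `^ (1 - kappa).
Proof.
move=> d0; apply/ler_addgt0Pr => e e0.
have [N0 N00 hN0] := tail_small (n%:R * (2 * (C / (kappa - 1)))) e0.
pose N := maxn N0 d.
have NN : (0 < N)%N by rewrite leq_max d0 orbT.
have hN : n%:R * T N <= e.
  apply: le_trans hN0; rewrite !mulrA ler_wpM2l //.
    by rewrite !mulr_ge0 ?invr_ge0 ?subr_ge0 ?(ltW C0) ?(ltW kappa1).
  rewrite -opprB !powRN lef_pV2 ?posrE ?powR_gt0 ?ltr0n //.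
  by apply: ge0_ler_powR; rewrite ?nnegrE ?subr_ge0 ?(ltW kappa1) // ler_nat leq_maxl.
have bg := bounded_statistic_gap d N.
have bY := bounded_centered_statistic; have bS := @bounded_linear_statistic R n' c d.
apply: (@le_trans _ _ (\int[mu]_M (`|S N M - S d M| + e))).
  apply: le_Rintegral => //.
  - apply: bounded_measurable_integrable; apply: bounded_measurable_norm.
    exact: bounded_measurableB.
  - apply: bounded_measurable_integrable; apply: bounded_measurableD.
      exact: bounded_measurable_norm.
    exact: bounded_measurable_cst.
  move=> M _; rewrite [leRHS]addrC (le_trans (ler_distD (S N M) _ _)) // lerD2r.
  exact: le_trans (centered_statistic_tail M NN) hN.
rewrite RintegralD ?bounded_measurable_integrable //; last 2 first.
- exact: bounded_measurable_norm.
- exact: bounded_measurable_cst.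
rewrite Rintegral_probability_cst lerD2r haar_statistic_gap // d0 /=.
exact: leq_maxr.
Qed.

End haar_approximation.

(** * The rate of convergence for Lipschitz test functions *)

Section haar_wasserstein.
Variables (R : realType) (f : R[i] -> R) (kappa C : R).
Hypotheses (f_L1 : circle_integrable f) (kappa1 : 1 < kappa) (C0 : 0 < C).
Hypothesis decay : forall j, j != 0 ->
  Normc.normc (fourier_coef f j) <= C * (`|j|%N%:R `^ (- kappa)).
Local Notation c := (fun j : nat => fourier_coef f j%:Z).
Local Notation a j := (Normc.normc (fourier_coef f j%:Z)).
Local Notation leb := (@lebesgue_measure R).
Local Notation w := (fun j : nat => 2 * (j.+1%:R * a j.+1 ^+ 2)).
Local Notation v := (limn (series w)).
Local Notation Y := (centered_statistic f).
Local Notation S := (linear_statistic c).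

Lemma stein_haar_error : 0 < v -> exists2 K : R, 0 <= K &
  forall n' (mu : probability (unitary R n'.+1) R), is_haar mu ->
  forall (g : R -> R) (d : nat), (forall x y, `|g x - g y| <= `|x - y|) -> (0 < d)%N ->
  `|\int[mu]_M g (S d M) - \int[leb]_x (g x * normal_pdf 0 (Num.sqrt v) x)| <=
  K * (d%:R `^ (1 - kappa) + d%:R ^+ 2 / n'.+1%:R).
Proof.
move=> v0; have s0 : 0 < Num.sqrt v by rewrite sqrtr_gt0.
have [B0 [B1 H]] := stein_equation s0.
pose A := C + C / (kappa - 1).
pose W := B0 ^+ 2 + 1 + A * (2 * B1 ^+ 2 + 3).
pose V := 2 * (C ^+ 2 / (2 * kappa - 2)).
have V0 : 0 <= V.
  rewrite mulr_ge0 // divr_ge0 ?sqr_ge0 // subr_ge0 -[leLHS]mulr1 ler_wpM2l // ltW //.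
have A0 : 0 <= A by rewrite addr_ge0 ?divr_ge0 ?subr_ge0 ?(ltW C0) ?(ltW kappa1).
have W0 : 0 <= W.
  have q0 := sqr_ge0 B0; have q1 := sqr_ge0 B1.
  have q : 0 <= A * (2 * B1 ^+ 2 + 3) by apply: mulr_ge0 => //; lra.
  by rewrite /W; move: q; set y := A * _; lra.
exists (`|B1| * V + A * W); first by apply: addr_ge0; apply: mulr_ge0.
move=> n' mu hmu g d gL d0.
have [h [dh [ch cdh taylor [hB dhB e]]]] := H g gL.
have cA : \sum_(j < d) `|c j.+1| <= A%:C.
  have := fourier_coef_sum kappa1 C0 decay d; rewrite -lecR; apply: le_trans.
  by rewrite rmorph_sum; apply: ler_sum => j _; case: (fourier_coef _ _).
have := @stein_haar_bound R n' mu hmu c d h dh ch cdh taylor B0 B1 hB dhB A cA.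
have bS := @bounded_linear_statistic R n' c d.
have bh := @bounded_measurable_h R n' c d h ch B0 hB.
have bdh := @bounded_measurable_dh R n' c d dh cdh B1 dhB.
set vd := \sum_(j < d) _ => hS.
(* Stein's equation is solved for the limit variance [v], whereas S has the truncated variance [vd].
   Their difference is at most V d^(2 - 2 kappa) <= V d^(1 - kappa). *)
have -> : \int[mu]_M g (S d M) - \int[leb]_x (g x * normal_pdf 0 (Num.sqrt v) x) =
    (v - vd) * \int[mu]_M dh (S d M) -
    (\int[mu]_M (S d M * h (S d M)) - vd * \int[mu]_M dh (S d M)).
  have -> : \int[mu]_M g (S d M) = \int[mu]_M ((v * dh (S d M) - S d M * h (S d M)) +
      \int[leb]_x (g x * normal_pdf 0 (Num.sqrt v) x)).
    apply: eq_Rintegral => M _; have := e (S d M); rewrite sqr_sqrtr ?(ltW v0) // => ->.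
    by rewrite subrK.
  have bv : bounded_measurable (fun M : unitary R n'.+1 => v * dh (S d M)).
    by apply: bounded_measurableM => //; exact: bounded_measurable_cst.
  have bSh := bounded_measurableM bS bh.
  rewrite RintegralD ?bounded_measurable_integrable //; last 2 first.
  - exact: bounded_measurableB.
  - exact: bounded_measurable_cst.
  rewrite Rintegral_probability_cst RintegralB ?bounded_measurable_integrable //.
  rewrite RintegralZl ?bounded_measurable_integrable //.
  by rewrite addrK; ring.
have d1 : 1 <= d%:R :> R by rewrite ler1n.
have hv : `|v - vd| <= V * d%:R `^ (1 - kappa).
  have := fourier_variance_tail kappa1 C0 decay d0; rewrite -/vd => /le_trans; apply.
  rewrite mulrA -/V; apply: ler_wpM2l => //; apply: ler_powR => //.
  by move: kappa1; lra.
rewrite (le_trans (ler_normB _ _)) // mulrDr lerD //.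
  rewrite normrM; apply: (@le_trans _ _ (V * d%:R `^ (1 - kappa) * `|B1|)).
    apply: ler_pM => //; apply: (le_trans (bounded_Rintegral_le mu bdh (fun M => dhB (S d M)))).
    exact: ler_norm.
  by rewrite -mulrA [_ * `|B1|]mulrC mulrA mulrDl [V * _]mulrC lerDl !mulr_ge0 // powR_ge0.
rewrite (le_trans hS) // -/W -mulrA ler_wpM2r ?divr_ge0 ?sqr_ge0 //.
by rewrite lerDr mulr_ge0.
Qed.

(* The exponent 1 / (kappa + 5/2) makes d^2 / n no larger than d^(1 - kappa) for
   d = n^(1 / (kappa + 5/2)). *)
Lemma truncation_level n : (0 < n)%N -> exists2 d, (0 < d)%N &
  d%:R `^ (1 - kappa) + d%:R ^+ 2 / n%:R <=
  (2 `^ (kappa - 1) + 1) * n%:R `^ (- ((kappa - 1) / (kappa + 5 / 2))) :> R.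
Proof.
move=> n0; pose al : R := (kappa + 5 / 2)^-1.
have k0 : 0 < kappa + 5 / 2 by move: kappa1; lra.
have al0 : 0 < al by rewrite invr_gt0.
have alk : al * (kappa + 5 / 2) = 1 by rewrite mulVf ?gt_eqF.
have n1 : 1 <= n%:R :> R by rewrite ler1n.
have np : 0 < n%:R :> R by rewrite ltr0n.
pose x : R := n%:R `^ al.
have x1 : 1 <= x by rewrite -(powRr0 (n%:R : R)) ler_powR // ltW.
have x0 : 0 < x := lt_le_trans ltr01 x1.
have /andP[dx xd] := truncn_itv (ltW x0).
set d := Num.truncn x in dx xd.
have d0 : (0 < d)%N by rewrite truncn_gt0.
have d1 : 1 <= d%:R :> R by rewrite ler1n.
have dp : 0 < d%:R :> R by rewrite ltr0n.
exists d => //; rewrite mulrDl lerD //.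
  have -> : - ((kappa - 1) / (kappa + 5 / 2)) = al * (- (kappa - 1)) by rewrite /al; ring.
  rewrite powRrM -/x -opprB !powRN -[leRHS]invrK invfM invrK lef_pV2 ?posrE ?powR_gt0 //; last first.
    by rewrite mulr_gt0 ?invr_gt0 ?powR_gt0.
  rewrite mulrC ler_pdivrMr ?powR_gt0 // -powRM ?(ltW dp) //.
  apply: ge0_ler_powR; rewrite ?nnegrE ?subr_ge0 ?(ltW kappa1) ?(ltW x0) ?mulr_ge0 ?(ltW dp) //.
  by apply: (le_trans (ltW xd)); rewrite -natr1; lra.
rewrite mul1r; apply: (@le_trans _ _ (x ^+ 2 / n%:R)).
  by rewrite ler_wpM2r ?invr_ge0 ?(ltW np) // lerXn2r // nnegrE ltW.
rewrite -powR_mulrn ?(ltW x0) // -powRrM -(powR_inv1 (ltW np)) -powRD; last first.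
  by rewrite (gt_eqF np) implybT.
rewrite ler_powR // (_ : - _ = - ((kappa - 1) * al)) //.
by move: alk al0 kappa1; nra.
Qed.

Lemma haar_lipschitz_bound : exists2 K : R, 0 < K &
  forall n' (mu : probability (unitary R n'.+1) R), is_haar mu ->
  forall g : R -> R, (forall x y, `|g x - g y| <= `|x - y|) ->
  `|\int[mu]_M g (Y M) - \int[centered_normal v]_x g x| <=
  K * n'.+1%:R `^ (- ((kappa - 1) / (kappa + 5 / 2))).
Proof.
have v_ge0 : 0 <= v.
  apply: le_trans (fourier_weight_le kappa1 C0 decay 0).
  by rewrite mulr_ge0 // mulr_ge0 // sqr_ge0.
have gap n' (mu : probability (unitary R n'.+1) R) (g : R -> R) (u u' : unitary R n'.+1 -> R) :
    (forall x y, `|g x - g y| <= `|x - y|) -> bounded_measurable u -> bounded_measurable u' ->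
    `|\int[mu]_M g (u M) - \int[mu]_M g (u' M)| <= \int[mu]_M `|u M - u' M|.
  move=> gL bu bu'; have b1 := bounded_measurable_lipschitz gL bu.
  have b2 := bounded_measurable_lipschitz gL bu'.
  have b3 := bounded_measurableB b1 b2.
  rewrite -RintegralB ?bounded_measurable_integrable //.
  rewrite (le_trans (le_normr_Rintegral _ (bounded_measurable_integrable mu b3))) //.
  apply: le_Rintegral => //.
  - by apply: bounded_measurable_integrable; exact: bounded_measurable_norm.
  - apply: bounded_measurable_integrable; apply: bounded_measurable_norm.
    exact: bounded_measurableB.
have bY n' := @bounded_centered_statistic R n' f kappa C f_L1 kappa1 C0 decay.
(* In the degenerate case every nonconstant coefficient vanishes, so the centred statistic is 0 and
   both laws are the point mass at 0. *)
have [v0|v0] := eqVneq v 0.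
  exists 1 => // n' mu hmu g gL; rewrite mul1r.
  have a0 j : fourier_coef f j.+1%:Z = 0.
    have := fourier_weight_le kappa1 C0 decay j; rewrite v0 => wj.
    have : a j.+1 ^+ 2 == 0.
      rewrite eq_le sqr_ge0 andbT; move: wj; rewrite pmulr_rle0 // pmulr_rle0 //.
    rewrite sqrf_eq0 => /eqP; exact: Normc.eq0_normc.
  have Y0 (M : unitary R n'.+1) : Y M = 0.
    apply/eqP; rewrite -normr_eq0 eq_le normr_ge0 andbT; apply/ler_addgt0Pr => e e0.
    have [N N0 hN] := tail_small kappa1 (n'.+1%:R * (2 * (C / (kappa - 1)))) e0.
    have := centered_statistic_tail f_L1 kappa1 C0 decay M N0.
    rewrite /linear_statistic big1 ?subr0; last by move=> j _; rewrite a0 mul0r mulr0.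
    by move=> /le_trans; apply; rewrite add0r !mulrA in hN *.
  under eq_Rintegral do rewrite Y0.
  rewrite Rintegral_probability_cst v0 /centered_normal eqxx /Rintegral.
  rewrite integral_dirac //; last first.
    by apply/measurable_EFinP; apply: continuous_measurable_fun; exact: lipschitz1_continuous.
  by rewrite diracT mul1e /= subrr normr0 powR_ge0.
have vp : 0 < v by rewrite lt0r v0.
have [K K0 hK] := stein_haar_error vp.
pose G := (1 + 4 * (C ^+ 2 / (2 * kappa - 2))) / 2.
have G0 : 0 <= G.
  rewrite divr_ge0 // addr_ge0 // mulr_ge0 // divr_ge0 ?sqr_ge0 // subr_ge0.
  by rewrite -[leLHS]mulr1 ler_wpM2l // ltW.
exists ((G + K) * (2 `^ (kappa - 1) + 1) + 1).
  by rewrite ltr_wpDl // mulr_ge0 // ?addr_ge0 // ?powR_ge0.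
move=> n' mu hmu g gL.
have [d d0 hd] := truncation_level (ltn0Sn n').
have [_ ->] := centered_normal_lipschitz vp gL.
have bS := @bounded_linear_statistic R n' c d.
have h1 := gap _ mu g _ _ gL (bY n') bS.
have h2 := haar_centered_statistic_gap hmu f_L1 kappa1 C0 decay d0.
have h3 := hK n' mu hmu g d gL d0.
set L := \int[leb]_x _ in h3 *.
rewrite (le_trans (ler_distD (\int[mu]_M g (S d M)) _ _)) //.
rewrite (le_trans (lerD (le_trans h1 h2) h3)) // -/G.
set D1 := d%:R `^ _ in hd *; set D2 := d%:R ^+ 2 / _ in hd *.
set rate := n'.+1%:R `^ _ in hd *.
have D20 : 0 <= D2 by rewrite divr_ge0 ?sqr_ge0.
have r0 : 0 <= rate by rewrite powR_ge0.
apply: (@le_trans _ _ ((G + K) * (D1 + D2))).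
  by rewrite mulrDl lerD2r mulrDr lerDl mulr_ge0.
rewrite [leRHS]mulrDl mul1r -[X in _ <= X + _]mulrA ler_wpDr //.
by apply: ler_wpM2l => //; exact: addr_ge0.
Qed.

End haar_wasserstein.

(** * From Haar integrals to the law of the fluctuation *)

Section fluctuation_law.
Variables (R : realType) (f : R[i] -> R).
Local Notation F := (fourier_sum f).

Lemma rv_of_measurable d (T : measurableType d) (P : probability T R) (u : T -> R) :
  measurable_fun setT u -> exists X : {RV P >-> R}, X =1 u.
Proof. by move=> mu; exists (mfun_Sub (mem_set mu)). Qed.

Lemma fluctuation0 d (T : measurableType d) (P : probability T R)
    (M : {RV P >-> unitary R 0}) (g : R[i] -> R) x : fluctuation g M x = 0.
Proof. by rewrite /fluctuation mul0r. Qed.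

Lemma bounded_measurable_comp d d' (T : measurableType d) (T' : measurableType d')
    (M : T -> T') (u : T' -> R) : measurable_fun setT M -> bounded_measurable u ->
  bounded_measurable (fun x => u (M x)).
Proof. by move=> mM [mu' [B uB]]; split; [exact: measurableT_comp|exists B]. Qed.

Lemma Rintegral_distribution d d' (T : measurableType d) (T' : measurableType d')
    (P : probability T R) (M : {RV P >-> T'}) (u : T' -> R) : bounded_measurable u ->
  \int[distribution P M]_y u y = \int[P]_x u (M x).
Proof.
move=> bu; have bM := bounded_measurable_comp (@measurable_funPT _ _ _ _ M) bu.
rewrite /Rintegral integral_distribution //.
  by apply/measurable_EFinP; case: bu.
exact: bounded_measurable_integrable bM.
Qed.

Lemma centered_normal_integrable (v : R) (g : R -> R) : 0 <= v ->
  (forall x y, `|g x - g y| <= `|x - y|) ->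
  (centered_normal v).-integrable setT (EFin \o g).
Proof.
move=> v0 gL; have [v00|vn] := eqVneq v 0; last first.
  by have [] := centered_normal_lipschitz (_ : 0 < v) gL; rewrite // lt0r vn.
have mg : measurable_fun setT (EFin \o g).
  apply/measurable_EFinP; apply: continuous_measurable_fun; exact: lipschitz1_continuous.
rewrite v00 /centered_normal eqxx; apply/integrableP; split => //.
rewrite integral_dirac //; last exact: measurableT_comp.
by rewrite diracT mul1e /= ltry.
Qed.

Variables (kappa C : R).
Hypotheses (f_L1 : circle_integrable f) (kappa1 : 1 < kappa) (C0 : 0 < C).
Hypothesis decay : forall j, j != 0 ->
  Normc.normc (fourier_coef f j) <= C * (`|j|%N%:R `^ (- kappa)).

Section fixed_dimension.
Variables (n' : nat) (d : measure_display) (T : measurableType d) (P : probability T R).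
Variable M : {RV P >-> unitary R n'.+1}.
Hypothesis hM : is_haar (distribution P M).
Local Notation Y := (@centered_statistic R n' f).

Let bY : bounded_measurable Y.
Proof. exact: (@bounded_centered_statistic R n' f kappa C f_L1 kappa1 C0 decay). Qed.

(** The centred statistic has Haar mean 0, so the expectation of L_n(f) is the Fourier coefficient
    of index 0 and the factors n and 1 / n cancel. *)
Lemma fluctuationE x : fluctuation F M x = Y (M x).
Proof.
have n0 : n'.+1%:R != 0 :> R by [].
have empE (U : unitary R n'.+1) : empirical_mean F U = n'.+1%:R^-1 * Y U + complex.Re (fourier_coef f 0).
  rewrite /empirical_mean eigenvalues_sum /centered_statistic.
  move: (complex.Re _) => r; rewrite sumrB sumr_const card_ord -[r *+ _]mulr_natl.
  by rewrite mulrBr [X in _ - X]mulrA mulVf // mul1r subrK.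
have bE : bounded_measurable (fun U : unitary R n'.+1 =>
    n'.+1%:R^-1 * Y U + complex.Re (fourier_coef f 0)).
  apply: bounded_measurableD; last exact: bounded_measurable_cst.
  by apply: bounded_measurableM => //; exact: bounded_measurable_cst.
rewrite /fluctuation empE.
have -> : fine ('E_P[fun w => empirical_mean F (M w)])%E = complex.Re (fourier_coef f 0).
  transitivity (\int[P]_w (n'.+1%:R^-1 * Y (M w) + complex.Re (fourier_coef f 0))).
    rewrite unlock /Rintegral; congr fine; apply: eq_integral => w _.
    by rewrite empE.
  rewrite -(Rintegral_distribution M bE) RintegralD ?bounded_measurable_integrable //; last 2 first.
  - by apply: bounded_measurableM => //; exact: bounded_measurable_cst.
  - exact: bounded_measurable_cst.
  rewrite Rintegral_probability_cst RintegralZl ?bounded_measurable_integrable //.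
  by rewrite (haar_centered_statistic_mean hM f_L1 kappa1 C0 decay) mulr0 add0r.
by rewrite addrK mulVKf.
Qed.

Lemma fluctuation_law (X : {RV P >-> R}) (g : R -> R) : X =1 fluctuation F M ->
  (forall x y, `|g x - g y| <= `|x - y|) ->
  (distribution P X).-integrable setT (EFin \o g) /\
  \int[distribution P X]_x g x = \int[distribution P M]_U g (Y U).
Proof.
move=> XE gL; have bgY := bounded_measurable_lipschitz gL bY.
have mg : measurable_fun setT (EFin \o g).
  apply/measurable_EFinP; apply: continuous_measurable_fun; exact: lipschitz1_continuous.
have gXE : (fun x => g (X x)) = (fun x => g (Y (M x))).
  by apply/funext => x; rewrite XE fluctuationE.
have igX : P.-integrable setT (EFin \o (fun x => g (X x))).
  rewrite gXE; apply: bounded_measurable_integrable.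
  by apply: (bounded_measurable_comp _ bgY); exact: measurable_funPT.
split; first exact: integrable_pushforward.
rewrite (Rintegral_distribution M bgY).
transitivity (\int[P]_x g (X x)); last by rewrite gXE.
by rewrite /Rintegral integral_distribution.
Qed.

Lemma measurable_fluctuation : measurable_fun setT (fluctuation F M).
Proof.
rewrite (_ : fluctuation F M = (fun x => Y (M x))).
  by apply: measurableT_comp; [case: bY|exact: measurable_funPT].
by apply/funext => x; exact: fluctuationE.
Qed.

End fixed_dimension.

Lemma fluctuation_clt : exists2 K : R, 0 < K &
  forall (d : nat -> measure_display)
      (T : forall n, measurableType (d n))
      (P : forall n, probability (T n) R)
      (M : forall n, {RV (P n) >-> unitary R n}),
    (forall n, (0 < n)%N -> is_haar (distribution (P n) (M n))) ->
    exists X : forall n, {RV (P n) >-> R},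
      [/\ forall n, X n =1 fluctuation (fourier_sum f) (M n),
          cvg_in_law (fun n => distribution (P n) (X n))
            (centered_normal (fine (fourier_variance f))) &
          forall n, (0 < n)%N ->
            (wasserstein (distribution (P n) (X n))
               (centered_normal (fine (fourier_variance f))) <=
             (K * n%:R `^ (- ((kappa - 1) / (kappa + 5 / 2))))%:E)%E].
Proof.
rewrite (fourier_variance_limit f_L1 kappa1 C0 decay) /=.
set v := limn _.
have v_ge0 : 0 <= v.
  apply: le_trans (fourier_weight_le kappa1 C0 decay 0).
  by rewrite mulr_ge0 // mulr_ge0 // sqr_ge0.
have [K K0 hK] := haar_lipschitz_bound f_L1 kappa1 C0 decay.
exists K => // d T P M hM.
have mX n : measurable_fun setT (fluctuation F (M n)).
  (* In dimension 0 nothing is assumed on the law, but the fluctuation is 0 there. *)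
  case: n => [|n']; last exact: measurable_fluctuation (hM n'.+1 isT).
  rewrite (_ : fluctuation _ _ = cst 0); first exact: measurable_cst.
  by apply/funext => x; rewrite fluctuation0.
pose X n := sval (cid (rv_of_measurable (P n) (mX n))).
have XE n : X n =1 fluctuation F (M n) by exact: svalP (cid (rv_of_measurable (P n) (mX n))).
have bound n (g : R -> R) : (0 < n)%N -> (forall x y, `|g x - g y| <= `|x - y|) ->
    (distribution (P n) (X n)).-integrable setT (EFin \o g) /\
    `|\int[distribution (P n) (X n)]_x g x - \int[centered_normal v]_x g x| <=
    K * n%:R `^ (- ((kappa - 1) / (kappa + 5 / 2))).
  case: n => // n' _ gL.
  have [ig ->] := fluctuation_law (hM n'.+1 isT) (XE n'.+1) gL.
  by split => //; exact: hK (hM n'.+1 isT) g gL.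
exists X; split => //; last first.
  move=> n n0; apply: wasserstein_le => g gL.
  have [ig le] := bound n g n0 gL; split => //.
  exact: centered_normal_integrable.
apply: (@cvg_in_law_lipschitz _ _ _ (fun n => K * n%:R `^ (- ((kappa - 1) / (kappa + 5 / 2))))).
  set p := (kappa - 1) / _.
  have p0 : 0 < p by rewrite divr_gt0 ?subr_gt0 //; move: kappa1; lra.
  apply/cvgrPdist_le => e e0.
  (* Taken at 1 + p, the exponent of [tail_small] is -p, that of the rate. *)
  have [|N N0 hN] := @tail_small R (1 + p) _ K e e0; first by rewrite ltrDl.
  rewrite opprD addrA subrr add0r in hN.
  near=> n; have Nn : (N <= n)%N by near: n; exact: nbhs_infty_ge.
  have n0 : (0 < n)%N by apply: leq_trans Nn.
  rewrite sub0r normrN ger0_norm ?mulr_ge0 ?powR_ge0 ?(ltW K0) //.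
  apply: le_trans hN; rewrite ler_wpM2l ?(ltW K0) // !powRN.
  rewrite lef_pV2 ?posrE ?powR_gt0 ?ltr0n //.
  by apply: ge0_ler_powR; rewrite ?nnegrE ?(ltW p0) // ler_nat.
near=> n => g B gL _; have n0 : (0 < n)%N by near: n; exact: nbhs_infty_gt.
by have [] := bound n g n0 gL.
Unshelve. all: by end_near. Qed.

End fluctuation_law.

(** All eigenvalues lie on the circle, where a smooth f equals the sum of its Fourier series. *)
Lemma fluctuation_smooth (R : realType) (f : R[i] -> R) n (d : measure_display)
    (T : measurableType d) (P : probability T R) (M : {RV P >-> unitary R n}) :
  circle_smooth f -> fluctuation (fourier_sum f) M =1 fluctuation f M.
Proof.
case: n M => [|n'] M f_smooth x; first by rewrite !fluctuation0.
have E (U : unitary R n'.+1) : empirical_mean (fourier_sum f) U = empirical_mean f U :> R.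
  rewrite /empirical_mean !(@eigenvalues_sum R n'); congr (_ * _); apply: eq_bigr => i _.
  have [r r2 ->] := circle_arg (norm_eigen U i).
  exact: fourier_inversion.
rewrite /fluctuation E; congr (_ * (_ - fine _)).
by rewrite (_ : (fun w => empirical_mean (fourier_sum f) (M w)) = (fun w => empirical_mean f (M w))) //;
  apply/funext => w.
Qed.

Theorem theorem3p1 (R : realType) (f : R[i] -> R) (f_L1 : circle_integrable f) :
  (forall kappa : R, 1 < kappa -> fourier_decay f kappa ->
    [/\ fourier_variance f =
          (2%:E * \sum_(1 <= j <oo)
             (j%:R * Normc.normc (fourier_coef f j%:Z) ^+ 2)%:E)%E,
        (fourier_variance f < +oo)%E &
        exists2 C : R, 0 < C &
          forall (d : nat -> measure_display)
              (T : forall n, measurableType (d n))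
              (P : forall n, probability (T n) R)
              (M : forall n, {RV (P n) >-> unitary R n}),
            (forall n, (0 < n)%N -> is_haar (distribution (P n) (M n))) ->
            exists X : forall n, {RV (P n) >-> R},
              [/\ forall n, X n =1 fluctuation (fourier_sum f) (M n),
                  cvg_in_law (fun n => distribution (P n) (X n))
                    (centered_normal (fine (fourier_variance f))) &
                  forall n, (0 < n)%N ->
                    (wasserstein (distribution (P n) (X n))
                       (centered_normal (fine (fourier_variance f))) <=
                     (C * n%:R `^ (- ((kappa - 1) / (kappa + 5 / 2))))%:E)%E]])
  /\
  (circle_smooth f -> forall eps : R, 0 < eps ->
    exists2 C : R, 0 < C &
      forall (d : nat -> measure_display)
          (T : forall n, measurableType (d n))
          (P : forall n, probability (T n) R)
          (M : forall n, {RV (P n) >-> unitary R n}),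
        (forall n, (0 < n)%N -> is_haar (distribution (P n) (M n))) ->
        exists X : forall n, {RV (P n) >-> R},
          (forall n, X n =1 fluctuation f (M n)) /\
          \forall n \near \oo,
            (wasserstein (distribution (P n) (X n))
               (centered_normal (fine (fourier_variance f))) <=
             (C / n%:R `^ (1 - eps))%:E)%E).
Proof.
split=> [kappa kappa1 [C C0 decay]|f_smooth eps eps0].
  split; first exact: fourier_varianceE.
    by rewrite (fourier_variance_limit f_L1 kappa1 C0 decay) ltry.
  exact: fluctuation_clt f_L1 kappa1 C0 decay.
(* The exponent is 1 - (7/2) / (kappa + 5/2), so kappa + 5/2 >= 7 / (2 eps) suffices, which 4 / eps
   ensures; the 2 gives kappa > 1. *)
pose kappa := 2 + 4 / eps : R.
have k4 : 0 < 4 / eps by rewrite divr_gt0.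
have kappa1 : 1 < kappa by rewrite /kappa; lra.
have [C C0 decay] := fourier_decay_smooth f_smooth f_L1 kappa.
have [K K0 hK] := fluctuation_clt f_L1 kappa1 C0 decay.
exists K => // d T P M hM; have [X [XE _ hX]] := hK d T P M hM.
exists X; split => [n x|]; first by rewrite XE fluctuation_smooth.
near=> n; have n0 : (0 < n)%N by near: n; exact: nbhs_infty_gt.
apply: (le_trans (hX n n0)); rewrite lee_fin ler_wpM2l ?(ltW K0) //.
rewrite -powRN ler_powR ?ler1n // lerN2.
have kp : 0 < kappa + 5 / 2 by rewrite /kappa; lra.
rewrite ler_pdivlMr //.
have ek : eps * kappa = 2 * eps + 4 by rewrite /kappa; field; rewrite gt_eqF.
by rewrite mulrBl mul1r mulrDr ek; lra.
Unshelve. all: by end_near. Qed.
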